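(* Let $n,m\ge 1$ be integers and let $T$ be an operator such that, for some $1<p_0<\infty$, $T:L^{p_0}(w)\to L^{p_0}(w)$ is uniformly compact with respect to $A_{p_0}(\mathbb R^{n+m})$. Then, for every $1<p,q<\infty$, $T:L^p_uL^q_v(\mathbb R^{n+m})\to L^p_uL^q_v(\mathbb R^{n+m})$ is uniformly compact with respect to $(A_p,A_q)$.
   Context: Weights. A weight on $\mathbb R^d$ is a non-negative, locally integrable function, not a.e. zero. For $1<p<\infty$, $w\in A_p(\mathbb R^d)$ if $[w]_{A_p}=\sup_Q \left(\frac1{|Q|}\int_Q w\right)\left(\frac1{|Q|}\int_Q w^{1-p'}\right)^{p-1}<\infty$, the supremum being over all cubes $Q\subset\mathbb R^d$, with $\frac1p+\frac1{p'}=1$. Spaces. $L^{p}(w)$ is the weighted Lebesgue space with norm $\left(\int |f|^p w\right)^{1/p}$. For $1\le p,q<\infty$ and weights $u$ on $\mathbb R^n$, $v$ on $\mathbb R^m$, $L^p_uL^q_v(\mathbb R^{n+m})$ is the space of measurable $f:\mathbb R^{n+m}\to\mathbb C$ with $$\|f\|_{L^p_uL^q_v}=\left(\int_{\mathbb R^n}\left[\int_{\mathbb R^m}|f(x,y)|^q v(y)\,dy\right]^{p/q}u(x)\,dx\right)^{1/p}<\infty .$$ Operators. An operator $T$ as in the claim is a map defined on $\bigcup_{w\in A_{p_0}(\mathbb R^{n+m})}L^{p_0}(w)$ with values in (a.e. classes of) measurable functions on $\mathbb R^{n+m}$. (This union contains $L^p_uL^q_v$ for all $1<p,q<\infty$,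 $u\in A_p(\mathbb R^n)$, $v\in A_q(\mathbb R^m)$.) Uniform compactness, mixed-norm case. $T$ is uniformly compact in $L^p_uL^q_v$ with respect to $(A_p,A_q)$ if there is an increasing function $\varphi:(0,\infty)\to(0,\infty)$ such that (weights $u$ are in $A_p(\mathbb R^n)$ and $v$ in $A_q(\mathbb R^m)$ throughout): (1) for every $K\ge1$ and every $u,v$ with $\max([u]_{A_p},[v]_{A_q})\le K$, $\sup_{\|f\|_{L^p_uL^q_v}\le1}\|Tf\|_{L^p_uL^q_v}\le\varphi(K)$; (2) for every $\varepsilon>0$ and $K\ge1$ there is $R=R(\varepsilon,K)>0$ such that $$\sup_{\max([u]_{A_p},[v]_{A_q})\le K}\ \sup_{\|f\|_{L^p_uL^q_v}\le1}\|\chi_{B(0,R)^c}Tf\|_{L^p_uL^q_v}\le\varphi(K)\varepsilon ,$$ where $B(0,R)$ is the ball in $\mathbb R^{n+m}$; (3) for every $\varepsilon>0$ and $K\ge1$ there is $\delta=\delta(\varepsilon,K)>0$ such that for every $h=(h_1,h_2)\in\mathbb R^n\times\mathbb R^m$ with $|h|\le\delta$, $$\sup_{\max([u]_{A_p},[v]_{A_q})\le K}\ \sup_{\|f\|_{L^p_uL^q_v}\le1}\|Tf-Tf(\cdot+h_1,\cdot+h_2)\|_{L^p_uL^q_v}\le\varphi(K)\varepsilon .$$ Uniform compactness, Lebesgue case. $T:L^{p_0}(w)\to L^{p_0}(w)$ is uniformly compact with respect to $A_{p_0}(\mathbb R^{n+m})$ if there is an increasing $\varphi:(0,\infty)\to(0,\infty)$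 such that the analogues of (1)-(3) hold with the norm of $L^{p_0}(w)$ on $\mathbb R^{n+m}$ in place of that of $L^p_uL^q_v$, and with ''all $w\in A_{p_0}(\mathbb R^{n+m})$ with $[w]_{A_{p_0}}\le K$'' in place of ''all $u,v$ with $\max([u]_{A_p},[v]_{A_q})\le K$''. *)

(* Defs.v *)
From HB Require Import structures.
From mathcomp Require Import all_boot all_order all_algebra.
From mathcomp Require Import all_classical all_reals all_analysis.
From mathcomp Require Import complex.
Import Order.TTheory GRing.Theory Num.Theory.
Import numFieldNormedType.Exports.

Set Implicit Arguments.
Unset Strict Implicit.
Unset Printing Implicit Defensive.

Local Open Scope classical_set_scope.
Local Open Scope ring_scope.

(* The sigma-algebra on 'rV[T]_d generated by the coordinates, as the library
   does for d.-tuple T; for T = R it is the Borel sigma-algebra of R^d. *)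
Definition row_coord (T : Type) (d : nat) (i : 'I_d) (x : 'rV[T]_d) : T :=
  x ord0 i.

Section measurable_row.
Context {disp : measure_display} {T : measurableType disp} (d : nat).

Let coors : 'I_d -> 'rV[T]_d -> T := @row_coord T d.

Let row_set0 : g_sigma_preimage coors set0.
Proof. exact: sigma_algebra0. Qed.

Let row_setC A : g_sigma_preimage coors A -> g_sigma_preimage coors (~` A).
Proof. exact: sigma_algebraC. Qed.

Let row_bigcup (F : (set 'rV[T]_d)^nat) :
  (forall i, g_sigma_preimage coors (F i)) ->
  g_sigma_preimage coors (\bigcup_i (F i)).
Proof. exact: sigma_algebra_bigcup. Qed.

HB.instance Definition _ := @isMeasurable.Build (measure_tuple_display disp)
  'rV[T]_d (g_sigma_preimage coors) row_set0 row_setC row_bigcup.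

End measurable_row.
Section lebesgue_row.
Context (R : realType).

Lemma measurable_row_coord d (i : 'I_d) :
  measurable_fun [set: 'rV[R]_d] (@row_coord R d i).
Proof.
move=> _ Y mY; rewrite setTI; apply: sub_sigma_algebra => /=.
rewrite -bigcup_seq/=; exists i => /=; first by rewrite mem_index_enum.
by exists Y => //; rewrite setTI.
Qed.

Lemma measurable_row d disp (T : measurableType disp) (f : T -> 'rV[R]_d) :
  (forall i, measurable_fun setT (fun x => row_coord i (f x))) ->
  measurable_fun [set: T] f.
Proof.
move=> mf; move=> _ Y; rewrite setTI.
rewrite /measurable /= => /(_ (fun B => measurable (f @^-1` B))); apply.
split; first split.
- by rewrite preimage_set0.
- by move=> A mA; rewrite setTD preimage_setC; exact: measurableC.
- by move=> F mF; rewrite preimage_bigcup; exact: bigcupT_measurable.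
- move=> B /=; rewrite -bigcup_seq => -[i _ [C mC <-]] /=.
  by have := mf i measurableT _ mC; rewrite !setTI.
Qed.

Definition cons_row d (x : measurableTypeR R * 'rV[R]_d) : 'rV[R]_d.+1 :=
  row_mx (x.1 : R)%:M x.2.

Lemma cons_row0 d (x : measurableTypeR R * 'rV[R]_d) :
  cons_row x ord0 ord0 = x.1.
Proof.
have -> : ord0 = lshift d ord0 :> 'I_(1 + d) by exact: val_inj.
by rewrite [LHS]row_mxEl mxE eqxx mulr1n.
Qed.

Lemma cons_rowS d (x : measurableTypeR R * 'rV[R]_d) i :
  cons_row x ord0 (lift ord0 i) = x.2 ord0 i.
Proof.
have -> : lift ord0 i = rshift 1 i :> 'I_(1 + d) by exact: val_inj.
exact: row_mxEr.
Qed.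

Lemma measurable_cons_row d : measurable_fun setT (@cons_row d).
Proof.
apply: measurable_row => i; rewrite /row_coord.
have [j ->|->] := unliftP ord0 i.
  under eq_fun do rewrite cons_rowS.
  exact: (measurableT_comp (measurable_row_coord j) measurable_snd).
under eq_fun do rewrite cons_row0.
exact: measurable_fst.
Qed.

Definition uncons_row d (x : 'rV[R]_d.+1) : measurableTypeR R * 'rV[R]_d :=
  (x ord0 ord0, \row_j x ord0 (lift ord0 j)).

Lemma cons_rowK d : cancel (@cons_row d) (@uncons_row d).
Proof.
move=> [t x]; rewrite /uncons_row cons_row0; congr pair.
by apply/rowP => j; rewrite mxE cons_rowS.
Qed.

Lemma uncons_rowK d : cancel (@uncons_row d) (@cons_row d).
Proof.
move=> x; apply/rowP => i; have [j ->|->] := unliftP ord0 i.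
  by rewrite cons_rowS mxE.
by rewrite cons_row0.
Qed.

Lemma measurable_uncons_row d : measurable_fun setT (@uncons_row d).
Proof.
apply/measurable_fun_pair; first exact: measurable_row_coord.
apply: measurable_row => i; rewrite /row_coord /=.
under eq_fun do rewrite mxE.
exact: measurable_row_coord.
Qed.

Section lebesgue_next.
Variables (d : nat) (mu : {sigma_finite_measure set 'rV[R]_d -> \bar R}).

Definition lebesgue_next : set 'rV[R]_d.+1 -> \bar R :=
  pushforward (@lebesgue_measure R \x mu)%E (@cons_row d).

Let mc := @measurable_cons_row d.

Let next0 : lebesgue_next set0 = 0%E.
Proof. exact: measure0. Qed.

Let next_ge0 A : (0 <= lebesgue_next A)%E.
Proof. exact: measure_ge0. Qed.

Let next_sigma_additive : semi_sigma_additive lebesgue_next.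
Proof. exact: measure_semi_sigma_additive. Qed.

HB.instance Definition _ := isMeasure.Build _ _ _ lebesgue_next
  next0 next_ge0 next_sigma_additive.

Let next_sigma_finite : sigma_finite setT lebesgue_next.
Proof.
have /sigma_finiteP[G [TG ndG Goo]] := sigma_finiteT mu.
have /sigma_finiteP[F [TF ndF Foo]] := sigma_finiteT (@lebesgue_measure R).
exists (fun k => @uncons_row d @^-1` (F k `*` G k)).
  rewrite -preimage_bigcup (_ : \bigcup_i _ = setT) ?preimage_setT//.
  apply/seteqP; split => // -[t x] _.
  have [k _ Fkt] : (\bigcup_i F i) t by rewrite -TF.
  have [l _ Glx] : (\bigcup_i G i) x by rewrite -TG.
  exists (maxn k l) => //; split.
    by move: t Fkt; exact/subsetPset/ndF/leq_maxl.
  by move: x Glx; exact/subsetPset/ndG/leq_maxr.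
move=> k; have [mF muF] := Foo k; have [mG muG] := Goo k.
have mFG : measurable (F k `*` G k) by exact: measurableX.
split; first by rewrite -[X in measurable X]setTI; exact: measurable_uncons_row.
rewrite /lebesgue_next /pushforward (_ : _ @^-1` _ = F k `*` G k).
  by rewrite product_measure1E// lte_mul_pinfty// ge0_fin_numE.
by rewrite -comp_preimage (_ : _ \o _ = id)//; apply/funext/cons_rowK.
Qed.

HB.instance Definition _ := Measure_isSigmaFinite.Build _ _ _ lebesgue_next
  next_sigma_finite.

End lebesgue_next.

Fixpoint lebesgue_row (d : nat) : {sigma_finite_measure set 'rV[R]_d -> \bar R} :=
  if d is d'.+1 then lebesgue_next (lebesgue_row d') else dirac (0 : 'rV[R]_0).

Lemma lebesgue_row_box d (a b : 'rV[R]_d) :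
  lebesgue_row d [set x : 'rV[R]_d | forall i, a ord0 i <= x ord0 i <= b ord0 i] =
  (\prod_(i < d) Num.max 0 (b ord0 i - a ord0 i))%:E.
Proof.
elim: d a b => [|d IH] a b.
  by rewrite big_ord0 /= diracE mem_set// => -[].
pose a' := \row_j a ord0 (lift ord0 j); pose b' := \row_j b ord0 (lift ord0 j).
rewrite /= /lebesgue_next /pushforward.
pose B := [set x : 'rV[R]_d | forall i, a' ord0 i <= x ord0 i <= b' ord0 i].
have mB : measurable B.
  rewrite (_ : B = \bigcap_(i in [set: 'I_d])
      (row_coord i @^-1` `[a' ord0 i, b' ord0 i])).
    apply: fin_bigcap_measurable => // i _.
    by rewrite -[X in measurable X]setTI; apply: measurable_row_coord.
  apply/seteqP; split => x /=.
    by move=> h i _ /=; rewrite in_itv/=; exact: h.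
  by move=> h i; have := h i I; rewrite /= in_itv.
have -> : @cons_row d @^-1`
      [set x : 'rV[R]_d.+1 | forall i, a ord0 i <= x ord0 i <= b ord0 i] =
    `[a ord0 ord0, b ord0 ord0]%classic `*` B.
  apply/seteqP; split => -[t x] /=.
    move=> h; split; first by have := h ord0; rewrite cons_row0 in_itv.
    by move=> i; have := h (lift ord0 i); rewrite cons_rowS !mxE.
  move=> [t_ab xB] i; have [j ->|->] := unliftP ord0 i.
    by have := xB j; rewrite cons_rowS !mxE.
  by rewrite cons_row0; move: t_ab; rewrite in_itv.
rewrite product_measure1E//.
rewrite IH [X in (X * _)%E](lebesgue_measure_itv `[a ord0 ord0, b ord0 ord0])/=.
rewrite big_ord_recl EFinM.
congr (_ * _)%E; last by under eq_bigr do rewrite !mxE.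
rewrite lte_fin; case: ltP => ab.
  by rewrite max_r// subr_ge0 ltW.
by rewrite max_l// subr_le0.
Qed.

End lebesgue_row.

Section mixed_norm_spaces.
Context (R : realType).

Local Notation mu d := (lebesgue_row R d).

Definition euclidean_norm d (x : 'rV[R]_d) : R :=
  Num.sqrt (\sum_(i < d) x ord0 i ^+ 2).

Definition is_weight d (w : 'rV[R]_d -> R) : Prop :=
  [/\ measurable_fun setT w,
      forall x, 0 <= w x,
      forall K : set 'rV[R]_d, compact K ->
        (\int[mu d]_(x in K) (w x)%:E < +oo)%E &
      ~ {ae mu d, forall x, w x = 0}].

Definition cube d (a : 'rV[R]_d) (l : R) : set 'rV[R]_d :=
  [set x : 'rV[R]_d | forall i, a ord0 i <= x ord0 i <= a ord0 i + l].

Definition average d (Q : set 'rV[R]_d) (g : 'rV[R]_d -> \bar R) : \bar R :=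
  ((mu d Q)^-1 * \int[mu d]_(x in Q) g x)%E.

Definition conjugate_exponent (p : R) : R := p / (p - 1).

(* The library's 0 `^ r is 0 for every r != 0, whereas w ^ (1 - p') is +oo
   where the weight w vanishes. *)
Definition dual_weight d (p : R) (w : 'rV[R]_d -> R) (x : 'rV[R]_d) : \bar R :=
  if w x == 0 then +oo%E else (w x `^ (1 - conjugate_exponent p))%:E.

Definition Ap_constant d (p : R) (w : 'rV[R]_d -> R) : \bar R :=
  ereal_sup [set r : \bar R | exists (a : 'rV[R]_d) (l : R), 0 < l /\
    r = (average (cube a l) (fun x => (w x)%:E) *
         average (cube a l) (dual_weight p w) `^ (p - 1))%E].

Definition Ap d (p : R) (w : 'rV[R]_d -> R) : Prop :=
  is_weight w /\ (Ap_constant p w < +oo)%E.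

Definition measurable_complex d (f : 'rV[R]_d -> complex R) : Prop :=
  measurable_fun setT (fun x => complex.Re (f x)) /\
  measurable_fun setT (fun x => complex.Im (f x)).

Definition Lp_norm d (p : R) (w : 'rV[R]_d -> R)
    (f : 'rV[R]_d -> complex R) : \bar R :=
  ((\int[mu d]_x (Normc.normc (f x) `^ p * w x)%:E) `^ p^-1)%E.

Definition mixed_norm n m (p q : R) (u : 'rV[R]_n -> R) (v : 'rV[R]_m -> R)
    (f : 'rV[R]_(n + m) -> complex R) : \bar R :=
  ((\int[mu n]_x
     ((\int[mu m]_y (Normc.normc (f (row_mx x y)) `^ q * v y)%:E) `^ (p / q) *
      (u x)%:E)) `^ p^-1)%E.

Definition in_space d (N : ('rV[R]_d -> complex R) -> \bar R)
    (f : 'rV[R]_d -> complex R) : Prop :=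
  measurable_complex f /\ (N f < +oo)%E.

Definition operator_domain d (p0 : R) (f : 'rV[R]_d -> complex R) : Prop :=
  exists2 w, Ap p0 w & in_space (Lp_norm p0 w) f.

(* T is a total function, but only its values on operator_domain p0 matter; the
   second clause lets it act on classes of functions modulo a.e. equality. *)
Definition is_operator d (p0 : R)
    (T : ('rV[R]_d -> complex R) -> ('rV[R]_d -> complex R)) : Prop :=
  (forall f, operator_domain p0 f -> measurable_complex (T f)) /\
  (forall f g, operator_domain p0 f -> operator_domain p0 g ->
    {ae mu d, forall x, f x = g x} -> {ae mu d, forall x, T f x = T g x}).

(* The clauses shared by the Lebesgue and the mixed-norm case: X K is the
   collection of the norms whose weights have constants at most K.  The first
   conjunct is the mapping property of T on each of these spaces. *)
Definition uniformly_compact d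
    (X : R -> set (('rV[R]_d -> complex R) -> \bar R))
    (T : ('rV[R]_d -> complex R) -> ('rV[R]_d -> complex R)) : Prop :=
  (forall K N f, X K N -> in_space N f -> in_space N (T f)) /\
  exists phi : R -> R,
    [/\ forall t : R, 0 < t -> 0 < phi t,
        forall s t : R, 0 < s -> s <= t -> phi s <= phi t,
        forall (K : R) N f, 1 <= K -> X K N ->
          measurable_complex f -> (N f <= 1)%E ->
          (N (T f) <= (phi K)%:E)%E,
        forall eps K : R, 0 < eps -> 1 <= K ->
          exists2 r : R, 0 < r & forall N f, X K N ->
            measurable_complex f -> (N f <= 1)%E ->
            (N (fun x => if (euclidean_norm x < r)%R then 0%R else T f x)
               <= (phi K * eps)%:E)%E &
        forall eps K : R, 0 < eps -> 1 <= K ->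
          exists2 delta : R, 0 < delta &
          forall h : 'rV[R]_d, euclidean_norm h <= delta ->
          forall N f, X K N -> measurable_complex f -> (N f <= 1)%E ->
            (N (fun x => T f x - T f (x + h))%R <= (phi K * eps)%:E)%E].

Definition Lp_norms d (p : R) (K : R) :
    set (('rV[R]_d -> complex R) -> \bar R) :=
  [set N | exists w : 'rV[R]_d -> R,
    [/\ Ap p w, (Ap_constant p w <= K%:E)%E & N = Lp_norm p w]].

Definition mixed_norms n m (p q : R) (K : R) :
    set (('rV[R]_(n + m) -> complex R) -> \bar R) :=
  [set N | exists (u : 'rV[R]_n -> R) (v : 'rV[R]_m -> R),
    [/\ Ap p u, Ap q v,
        (maxe (Ap_constant p u) (Ap_constant q v) <= K%:E)%E &
        N = mixed_norm p q u v]].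

Definition uniformly_compact_Lp d (p : R)
    (T : ('rV[R]_d -> complex R) -> ('rV[R]_d -> complex R)) : Prop :=
  uniformly_compact (@Lp_norms d p) T.

Definition uniformly_compact_mixed n m (p q : R)
    (T : ('rV[R]_(n + m) -> complex R) -> ('rV[R]_(n + m) -> complex R)) : Prop :=
  uniformly_compact (@mixed_norms n m p q) T.

End mixed_norm_spaces.

(* Main.v *)
Require Import Defs.
From mathcomp Require Import all_boot all_order all_algebra.
From mathcomp Require Import all_classical all_reals all_analysis.
From mathcomp Require Import measurable_realfun complex.
From mathcomp Require Import ring lra.
Import Order.TTheory GRing.Theory Num.Theory.
Import numFieldNormedType.Exports.

Set Implicit Arguments.
Unset Strict Implicit.
Unset Printing Implicit Defensive.

Local Open Scope classical_set_scope.
Local Open Scope ring_scope.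

(** Rubio de Francia extrapolation is applied twice: on R^(n+m), from the exponent
    p0 to q, with the product weights w(x) v(y); then on R^n, from q to p, to the
    function x |-> ||f(x, .)||_{L^q(v)}. One extrapolation step majorizes f and the
    function dual to T f by A_1 weights F and H, obtained by summing the iterates
    of a maximal operator; then F^(1-p0) H is an A_{p0} weight with controlled
    constant, and Hoelder's inequality transfers the L^{p0} bound. The maximal
    operator runs over rational cubes; it is bounded on L^p(w) by Lerner's
    argument, which needs only the Vitali covering lemma. Since the bounds depend
    on the weight through its A_p constant alone, the estimates (1)-(3) transfer,
    the same radius and shift serving for all the weights at hand. *)

(** * Extended reals and integrals *)

Section ereal_facts.
Local Open Scope ereal_scope.
Context (R : realType).

Lemma mulEFinVK (c : R) (x : \bar R) : c != 0%R -> c%:E * ((c^-1)%:E * x) = x.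
Proof. by move=> c0; rewrite muleA -EFinM divff// mul1e. Qed.

Lemma mulEFinKV (c : R) (x : \bar R) : c != 0%R -> (c^-1)%:E * (c%:E * x) = x.
Proof. by move=> c0; rewrite muleA -EFinM mulVf// mul1e. Qed.

Lemma lee_poweR (r : R) (x y : \bar R) :
  (0 <= r)%R -> 0 <= x -> x <= y -> x `^ r <= y `^ r.
Proof.
move=> r0 x0 xy; apply: gt0_ler_poweR => //; rewrite in_itv/= leey andbT//.
exact: le_trans xy.
Qed.

Lemma ler_powR_ge0 (r x y : R) : (0 <= r)%R -> (0 <= x)%R -> (x <= y)%R ->
  (x `^ r <= y `^ r)%R.
Proof.
move=> r0 x0 xy; apply: ge0_ler_powR => //; rewrite nnegrE//.
exact: le_trans xy.
Qed.

Lemma poweRK (r : R) (x : \bar R) : r != 0%R -> 0 <= x -> (x `^ r) `^ r^-1 = x.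
Proof. by move=> r0 x0; rewrite -poweRrM divff// poweRe1. Qed.

Lemma powRK (r x : R) : (r != 0 -> 0 <= x -> (x `^ r) `^ r^-1 = x)%R.
Proof. by move=> r0 x0; rewrite -powRrM divff// powRr1. Qed.

Lemma poweRVK (r : R) (x : \bar R) : r != 0%R -> 0 <= x -> (x `^ r^-1) `^ r = x.
Proof. by move=> r0 x0; rewrite -poweRrM mulVf// poweRe1. Qed.

Lemma powRVK (r x : R) : (r != 0 -> 0 <= x -> (x `^ r^-1) `^ r = x)%R.
Proof. by move=> r0 x0; rewrite -powRrM mulVf// powRr1. Qed.

Lemma invr_powR (x r : R) : (0 <= x -> x^-1 `^ r = (x `^ r)^-1)%R.
Proof.
by move=> x0; rewrite -powR_inv1// powRAC powR_inv1// powR_ge0.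
Qed.

End ereal_facts.

Section integral_facts.
Local Open Scope ereal_scope.
Context d (T : measurableType d) (R : realType) (mu : {measure set T -> \bar R}).

Lemma ge0_integral_setU_le (A B : set T) (f : T -> \bar R) :
  measurable A -> measurable B -> measurable_fun setT f -> (forall x, 0 <= f x) ->
  \int[mu]_(x in A `|` B) f x <= \int[mu]_(x in A) f x + \int[mu]_(x in B) f x.
Proof.
move=> mA mB mf f0.
have mBA : measurable (B `\` A) by exact: measurableD.
have -> : A `|` B = A `|` (B `\` A).
  by rewrite setUDr setDv setD0.
rewrite ge0_integral_setU//.
- apply: leeD => //; apply: ge0_subset_integral => //; first exact: measurable_funS mf.
- exact: measurable_funS mf.
- by rewrite disj_set2E setDIK.
Qed.

Lemma ge0_integral_bigsetU_le (I : Type) (F : I -> set T) (s : seq I)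
    (f : T -> \bar R) :
  (forall i, measurable (F i)) -> measurable_fun setT f -> (forall x, 0 <= f x) ->
  \int[mu]_(x in \big[setU/set0]_(i <- s) F i) f x <=
  \sum_(i <- s) \int[mu]_(x in F i) f x.
Proof.
move=> mF mf f0; elim: s => [|i s ih]; first by rewrite !big_nil integral_set0.
rewrite !big_cons; apply: (le_trans (ge0_integral_setU_le _ _ _ _)) => //.
  by apply: bigsetU_measurable.
exact: leeD.
Qed.

Lemma integral_indicM (A : set T) (f : T -> \bar R) :
  measurable A -> \int[mu]_x (f x * (\1_A x)%:E) = \int[mu]_(x in A) f x.
Proof.
move=> mA; rewrite [RHS]integral_mkcond; apply: eq_integral => x _.
by rewrite patchE indicE; case: (x \in A); rewrite ?mule1 ?mule0.
Qed.

Lemma ge0_integral_gt0 (A : set T) (f : T -> \bar R) :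
  measurable A -> measurable_fun setT f -> (forall x, 0 < f x) -> 0 < mu A ->
  0 < \int[mu]_(x in A) f x.
Proof.
move=> mA mf f0 muA; rewrite lt0e integral_ge0 ?andbT; last by move=> x _; exact: ltW.
apply/eqP => /= A0.
have : ae_eq mu A f (cst 0).
  apply/(ae_eq_integral_abs mu mA); first exact: measurable_funS mf.
  by rewrite -[RHS]A0; apply: eq_integral => x _; rewrite gee0_abs// ltW.
move=> -[N [mN N0 sub]].
have AN : A `<=` N.
  by move=> x Ax; apply: sub => /= /(_ Ax) fx0; have := f0 x; rewrite fx0 ltxx.
have : mu A <= mu N by apply: le_measure; rewrite ?inE.
by rewrite N0 leNgt muA.
Qed.

Lemma measurable_fun_ereal_sup (f : nat -> T -> \bar R) :
  (forall i, measurable_fun setT (f i)) ->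
  measurable_fun setT (fun x => ereal_sup (range (f ^~ x))).
Proof.
move=> mf; have := measurable_fun_esups mf 0%N; apply: eq_measurable_fun => x _.
by rewrite /esups/= /sdrop; congr ereal_sup; apply/seteqP; split => y /= [k _ <-]; exists k.
Qed.

Lemma measurable_fun_nneseries (h : nat -> T -> \bar R) :
  (forall i x, 0 <= h i x) -> (forall i, measurable_fun setT (h i)) ->
  measurable_fun setT (fun x => \sum_(0 <= i <oo) h i x).
Proof.
by move=> h0 mh; apply: (ge0_emeasurable_sum (P := xpredT)) => *; [exact: h0|exact: mh].
Qed.

End integral_facts.

(** * A maximal operator over a countable basis *)

(* [Q (s i)] stands for a dilate of [Q i] containing every set of the basis of no
   larger size [r] that meets [Q i]. *)
Record dilation_basis d (T : measurableType d) (R : realType)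
    (mu : {measure set T -> \bar R}) (Q : nat -> set T) (s : nat -> nat)
    (r : nat -> R) (k : R) : Prop := DilationBasis {
  basis_measurable : forall i, measurable (Q i);
  basis_gt0 : forall i, (0 < mu (Q i))%E;
  basis_lty : forall i, (mu (Q i) < +oo)%E;
  basis_dilate : forall i j, Q i `&` Q j !=set0 -> r i <= r j ->
    Q i `<=` Q (s j);
  basis_dilate_le : forall i, (mu (Q (s i)) <= k%:E * mu (Q i))%E;
  basis_directed : forall i x, exists j, Q j x /\ Q i `<=` Q j }.

Record positive_weight d (T : measurableType d) (R : realType)
    (mu : {measure set T -> \bar R}) (Q : nat -> set T) (w : T -> R) : Prop :=
  PositiveWeight {
  weight_measurable : measurable_fun setT w;
  weight_gt0 : forall x, 0 < w x;
  weight_lty : forall i, (\int[mu]_(x in Q i) (w x)%:E < +oo)%E }.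

Section maximal_operator.
Local Open Scope ereal_scope.
Context d (T : measurableType d) (R : realType) (mu : {measure set T -> \bar R}).
Variables (Q : nat -> set T) (s : nat -> nat) (r : nat -> R) (k : R).
Hypothesis BQ : dilation_basis mu Q s r k.

Let mQ i : measurable (Q i). Proof. exact: basis_measurable BQ i. Qed.

Definition mass (w : T -> R) (i : nat) : R :=
  fine (\int[mu]_(x in Q i) (w x)%:E).

Definition maxop (w : T -> R) (f : T -> \bar R) (x : T) : \bar R :=
  ereal_sup (range (fun i => ((mass w i)^-1)%:E *
    \int[mu]_(y in Q i) (f y * (w y)%:E) * (\1_(Q i) x)%:E)).

Lemma basis_nonempty i : Q i !=set0.
Proof.
apply/set0P/eqP => Qi0; have := basis_gt0 BQ i.
by rewrite Qi0 measure0 ltxx.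
Qed.

Lemma basis_sub_dilate i : Q i `<=` Q (s i).
Proof.
by apply: (basis_dilate BQ) => //; rewrite setIid; exact: basis_nonempty.
Qed.

Lemma vitali_selection (t : seq nat) : exists t' : seq nat,
  [/\ {subset t' <= t}, uniq t', trivIset [set` t'] Q &
      forall i, i \in t -> exists2 j, j \in t' & Q i `<=` Q (s j)].
Proof.
have [n] := ubnP (size t); elim: n t => // n ih [|i0 t] szt.
  by exists [::]; split => //; rewrite set_nil; exact: trivIset_set0.
set t0 := i0 :: t.
have [j jt rj] : exists2 j, j \in t0 & forall i, i \in t0 -> (r i <= r j)%R.
  rewrite {}/t0; elim: t i0 {szt} => [|i1 t iht] i0.
    by exists i0; rewrite ?mem_head// => i; rewrite inE => /eqP ->.
  have [j jt rj] := iht i1.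
  have [le|lt] := leP (r i0) (r j).
    exists j; first by rewrite inE jt orbT.
    by move=> i; rewrite inE => /predU1P[->//|/rj].
  exists i0; first by rewrite mem_head.
  move=> i; rewrite inE => /predU1P[->//|/rj /le_trans]; apply; exact: ltW.
set t1 := [seq i <- t0 | `[< Q i `&` Q j = set0 >]].
have jt1 : j \notin t1.
  rewrite mem_filter negb_and; apply/orP; left; apply/negP => /asboolP.
  by rewrite setIid; apply/eqP/set0P; exact: basis_nonempty.
have [|t' [t't1 ut' tt' ct']] := ih t1.
  rewrite -ltnS; apply: leq_trans szt; rewrite ltnS -/t0.
  rewrite size_filter -(count_predC (fun i => `[< Q i `&` Q j = set0 >]) t0).
  rewrite -addn1 leq_add2l -has_count; apply/hasP; exists j => //=.
  by apply: contra jt1; rewrite mem_filter jt andbT.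
exists (j :: t'); split.
- move=> i; rewrite inE => /predU1P[->//|/t't1].
  by rewrite mem_filter => /andP[].
- by rewrite /= ut' andbT; apply: contra jt1; exact: t't1.
- have H i : i \in t' -> Q i `&` Q j = set0.
    by move=> /t't1; rewrite mem_filter => /andP[/asboolP].
  apply/trivIsetP => i l /=; rewrite !inE.
  move=> /predU1P[->|it] /predU1P[->|lt]; rewrite ?eqxx// => il.
  + by rewrite setIC H.
  + by rewrite H.
  + by move/trivIsetP : tt'; exact.
- move=> i it; have [ij|/eqP/set0P ij] := pselect (Q i `&` Q j = set0).
    have [|l lt il] := ct' i; first by rewrite mem_filter it andbT; apply/asboolP.
    by exists l => //; rewrite inE lt orbT.
  exists j; first by rewrite mem_head.
  by apply: (basis_dilate BQ) => //; exact: rj.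
Qed.

Section one_weight.
Variables (w : T -> R).
Hypothesis Pw : positive_weight mu Q w.

Let mw : measurable_fun setT (EFin \o w).
Proof. by apply/measurable_EFinP; exact: weight_measurable Pw. Qed.

Let w0 x : 0 <= (w x)%:E. Proof. by rewrite lee_fin ltW// (weight_gt0 Pw). Qed.

Lemma massE i : (mass w i)%:E = \int[mu]_(x in Q i) (w x)%:E.
Proof.
rewrite /mass fineK// ge0_fin_numE; first exact: weight_lty Pw i.
by apply: integral_ge0 => x _.
Qed.

Lemma mass_gt0 i : (0 < mass w i)%R.
Proof.
rewrite -lte_fin massE; apply: ge0_integral_gt0 => //.
  by move=> x; rewrite lte_fin (weight_gt0 Pw).
exact: basis_gt0 BQ i.
Qed.

Variable (f : T -> \bar R).
Hypotheses (mf : measurable_fun setT f) (f0 : forall x, 0 <= f x).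

Let mfw : measurable_fun setT (fun x => f x * (w x)%:E).
Proof. exact: emeasurable_funM. Qed.

Let fw0 x : 0 <= f x * (w x)%:E. Proof. exact: mule_ge0. Qed.

Lemma avg_ge0 i : 0 <= ((mass w i)^-1)%:E * \int[mu]_(y in Q i) (f y * (w y)%:E).
Proof.
apply: mule_ge0; last exact: integral_ge0.
by rewrite lee_fin invr_ge0 ltW// mass_gt0.
Qed.

Lemma maxop_ge i x : Q i x ->
  ((mass w i)^-1)%:E * \int[mu]_(y in Q i) (f y * (w y)%:E) <= maxop w f x.
Proof.
move=> Qx; apply: ereal_sup_ubound; exists i => //.
by rewrite indicE mem_set// mule1.
Qed.

Lemma maxop_le x y : 0 <= y -> (forall i, Q i x ->
  ((mass w i)^-1)%:E * \int[mu]_(y in Q i) (f y * (w y)%:E) <= y) ->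
  maxop w f x <= y.
Proof.
move=> y0 H; apply: ge_ereal_sup => _ [i _ <-].
rewrite indicE; case: (boolP (x \in Q i)) => [/set_mem/H|_]; first by rewrite mule1.
by rewrite mule0.
Qed.

Lemma maxop_ge0 x : 0 <= maxop w f x.
Proof.
have [j [Qj _]] := basis_directed BQ 0%N x.
exact: le_trans (avg_ge0 j) (maxop_ge Qj).
Qed.

Lemma maxop_gtP (a : \bar R) x : 0 <= a -> a < maxop w f x ->
  exists2 i, Q i x &
    a < ((mass w i)^-1)%:E * \int[mu]_(y in Q i) (f y * (w y)%:E).
Proof.
move=> a0; rewrite ltNge => H; apply: contrapT => nex; move/negP : H; apply.
apply: maxop_le => // i Qi; rewrite leNgt; apply/negP => ai.
by apply: nex; exists i.
Qed.

Lemma measurable_maxop : measurable_fun setT (maxop w f).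
Proof.
apply: measurable_fun_ereal_sup => i; apply: emeasurable_funM => //.
by apply/measurable_EFinP; exact: measurable_indic.
Qed.

Lemma maxop_superlevel (a : R) : (0 <= a)%R ->
  [set x | a%:E < maxop w f x] = \bigcup_(i in [set i | a%:E <
    ((mass w i)^-1)%:E * \int[mu]_(y in Q i) (f y * (w y)%:E)]) Q i.
Proof.
move=> a0; apply/seteqP; split => x /=.
  by move=> /(maxop_gtP _)[|i Qi ai]; [rewrite lee_fin|exists i].
by move=> [i /= ai Qi]; exact: lt_le_trans ai (maxop_ge Qi).
Qed.

Lemma maxop_weak_type (D a : R) :
  (forall i, \int[mu]_(x in Q (s i)) (w x)%:E <=
             D%:E * \int[mu]_(x in Q i) (w x)%:E) ->
  (0 < a)%R ->
  a%:E * \int[mu]_(x in [set x | a%:E < maxop w f x]) (w x)%:E <=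
  D%:E * \int[mu]_x (f x * (w x)%:E).
Proof.
move=> HD a0.
have D0 : (0 <= D)%R.
  have := le_trans (ltW (mass_gt0 (s 0%N))); rewrite -lee_fin.
  have /le_trans := HD 0%N; rewrite -!massE.
  have := HD 0%N; rewrite -!massE -EFinM lee_fin => /(le_trans (ltW (mass_gt0 _))).
  by rewrite pmulr_lge0// mass_gt0.
set good := fun i => a%:E < ((mass w i)^-1)%:E * \int[mu]_(y in Q i) (f y * (w y)%:E).
pose l n := [seq i <- iota 0 n | good i].
pose F n := \big[setU/set0]_(i <- l n) Q i.
have FP n x : F n x -> exists2 i, i \in l n & Q i x.
  by rewrite /F -bigcup_seq => -[i il Qi]; exists i.
have PF n x i : i \in l n -> Q i x -> F n x.
  by rewrite /F -bigcup_seq => il Qi; exists i.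
have mF n : measurable (F n) by apply: bigsetU_measurable.
have -> : [set x | a%:E < maxop w f x] = \bigcup_n F n.
  rewrite maxop_superlevel ?ltW//; apply/seteqP; split => x [i /= ai Qi].
    exists i.+1 => //; apply: (PF _ _ i) => //.
    by rewrite mem_filter /good ai mem_iota/=.
  have [j] := FP _ _ Qi; by rewrite mem_filter => /andP[gj _] Qj; exists j.
have ndF : nondecreasing_seq F.
  move=> m n mn; apply/subsetPset => x Fx.
  have [ i ] := FP m x Fx; rewrite mem_filter mem_iota /= add0n.
  move=> /andP[gi im] Qi; apply: (PF _ _ i) => //.
  by rewrite mem_filter gi mem_iota/= add0n (leq_trans im).
have mwF n : measurable_fun (F n) (EFin \o w) by exact: measurable_funS mw.
have := @ge0_nondecreasing_set_cvg_integral _ _ _ F (EFin \o w) mu ndF mF mwF.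
move=> /(_ (fun i x _ => w0 x)) cv.
have cva : a%:E * \int[mu]_(x in F n) (w x)%:E @[n --> \oo] -->
           a%:E * \int[mu]_(x in \bigcup_n F n) (w x)%:E.
  by apply: cvgeZl.
rewrite -(cvg_lim _ cva)//; apply: lime_le; first by apply/cvg_ex; eexists; exact: cva.
apply: nearW => n.
have [t [tl ut tt ct]] := vitali_selection (l n).
have subt : F n `<=` \big[setU/set0]_(j <- t) Q (s j).
  move=> x Fx; have [i /ct[j jt ij]] := FP n x Fx; move=> /ij Qj; rewrite -bigcup_seq; by exists j.
have : \int[mu]_(x in F n) (w x)%:E <= D%:E * \sum_(j <- t) \int[mu]_(x in Q j) (w x)%:E.
  apply: (@le_trans _ _ (\int[mu]_(x in \big[setU/set0]_(j <- t) Q (s j)) (w x)%:E)).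
    apply: ge0_subset_integral => //; first by apply: bigsetU_measurable.
    exact: measurable_funS mw.
  apply: (le_trans (ge0_integral_bigsetU_le _ _ _ _ _)) => //.
  rewrite ge0_sume_distrr; last by move=> j _; exact: integral_ge0.
  by apply: lee_sum => j _; exact: HD.
move=> /(@lee_wpmul2l _ a%:E); rewrite lee_fin (ltW a0) => /(_ isT) /le_trans; apply.
rewrite muleCA; apply: lee_wpmul2l; first by rewrite lee_fin.
rewrite ge0_sume_distrr; last by move=> j _; exact: integral_ge0.
apply: (@le_trans _ _ (\sum_(j <- t) \int[mu]_(x in Q j) (f x * (w x)%:E))).
  rewrite big_seq [leRHS]big_seq; apply: lee_sum => j /tl.
  rewrite mem_filter => /andP[+ _]; rewrite /good => /ltW.
  move=> /(@lee_wpmul2l _ (mass w j)%:E); rewrite lee_fin (ltW (mass_gt0 _)) => /(_ isT).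
  rewrite mulEFinVK ?gt_eqF ?mass_gt0//.
  by rewrite -massE muleC.
rewrite -ge0_integral_bigsetU//.
- by apply: ge0_subset_integral => //; apply: bigsetU_measurable.
- exact: measurable_funS mfw.
Qed.

End one_weight.
End maximal_operator.

Section dyadic_levels.
Context (R : realType).
Implicit Types (p b c rho : R).

Lemma geometric_sum_below rho c b J : 1 < rho -> 0 < c -> 0 <= b ->
  \sum_(j < J) (if c * rho ^+ j < b then c * rho ^+ j else 0) <=
  b * (rho / (rho - 1)).
Proof.
move=> rho1 c0 b0; have rho0 : 0 < rho by rewrite (lt_trans _ rho1).
have rhoB : 0 < rho - 1 by rewrite subr_gt0.
elim: J => [|J ih].
  by rewrite big_ord0 mulr_ge0// divr_ge0// ltW.
rewrite big_ord_recr/=; case: ifPn => [lt|_]; last by rewrite addr0.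
rewrite (@le_trans _ _ (\sum_(j < J.+1) c * rho ^+ j))//.
  rewrite big_ord_recr/= lerD2r; apply: ler_sum => j _; case: ifPn => // _.
  by rewrite ltW// mulr_gt0// exprn_gt0.
rewrite -mulr_sumr mulrA ler_pdivlMr// -mulrA [X in c * X]mulrC -subrX1.
rewrite (@le_trans _ _ (c * rho ^+ J.+1))//.
  by apply: ler_wpM2l; [exact: ltW|rewrite gerBl].
by rewrite exprSr mulrA ler_wpM2r ?ltW.
Qed.

Definition dyadic_const p : R := 2 `^ (p - 1) / (2 `^ (p - 1) - 1).

Lemma powR2_gt1 p : 1 < p -> 1 < 2 `^ (p - 1) :> R.
Proof.
move=> p1; have {1}-> : 1 = 1 `^ (p - 1) :> R by rewrite powR1.
apply: gt0_ltr_powR.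
- by rewrite subr_gt0.
- by rewrite nnegrE.
- by rewrite nnegrE.
- by rewrite ltr1n.
Qed.

Lemma dyadic_const_gt0 p : 1 < p -> 0 < dyadic_const p.
Proof.
by move=> /powR2_gt1 h; rewrite divr_gt0 ?powR_gt0// subr_gt0.
Qed.

Definition dyadic_level (up : bool) (j : nat) : R := if up then 2 ^+ j else 2 ^- j.

Lemma dyadic_level_gt0 up j : 0 < dyadic_level up j.
Proof. by case: up => /=; rewrite ?invr_gt0 exprn_gt0. Qed.

Lemma powR_exprn (a x : R) j : 0 <= a -> (a ^+ j) `^ x = (a `^ x) ^+ j.
Proof. by move=> a0; rewrite -powR_mulrn// powRAC powR_mulrn// powR_ge0. Qed.

Lemma sum_dyadic_level up p b J : 1 < p -> 0 <= b ->
  \sum_(j < J) (if dyadic_level up j < b then dyadic_level up j `^ (p - 1) else 0)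
  <= dyadic_const p * b `^ (p - 1).
Proof.
move=> p1 b0; rewrite mulrC; set rho := 2 `^ (p - 1).
have rho1 : 1 < rho by exact: powR2_gt1.
have rho0 : 0 < rho by rewrite (lt_trans _ rho1).
have level_lt j : dyadic_level up j < b ->
    dyadic_level up j `^ (p - 1) < b `^ (p - 1).
  move=> h; apply: gt0_ltr_powR => //; first by rewrite subr_gt0.
    by rewrite nnegrE ltW// dyadic_level_gt0.
pose c : R := if up then 1 else rho ^- J.-1.
have c0 : 0 < c by rewrite /c; case: ifP => // _; rewrite invr_gt0 exprn_gt0.
apply: (le_trans _ (geometric_sum_below J rho1 c0 (powR_ge0 b _))).
have E (j : 'I_J) : dyadic_level up (if up then j : nat else (J - j.+1)%N) `^ (p - 1) = c * rho ^+ j.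
  rewrite /dyadic_level /c; case: (up); first by rewrite mul1r powR_exprn.
  rewrite -exprVn powR_exprn ?invr_ge0// -powR_inv1// powRAC powR_inv1 ?powR_ge0// -/rho.
  have -> : J.-1 = (J - j.+1 + j)%N by rewrite addnC -subn1 -[j.+1]add1n subnDA addnC subnK// subn1 -ltnS prednK// (leq_ltn_trans _ (ltn_ord j)).
  by rewrite exprD invfM exprVn -mulrA mulVf ?mulr1// expf_neq0// gt_eqF.
have -> : \sum_(j < J) (if dyadic_level up j < b then dyadic_level up j `^ (p - 1) else 0) =
   \sum_(j < J) (if dyadic_level up (if up then j : nat else (J - j.+1)%N) < b
     then dyadic_level up (if up then j : nat else (J - j.+1)%N) `^ (p - 1) else 0).
  case: (up) => //; rewrite (reindex_inj rev_ord_inj)/=; exact: eq_bigr.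
apply: ler_sum => j _; case: ifPn => [/level_lt|_]; first by rewrite E => ->.
by case: ifPn => // _; rewrite ltW// mulr_gt0// exprn_gt0.
Qed.

Lemma dyadic_level_exists (a : R) : 0 < a ->
  exists up j, dyadic_level up j < a /\ a / 2 <= dyadic_level up j.
Proof.
move=> a0; have [a1|a1] := ltP 1 a.
  have [|j /= jP jmin] := @ex_minnP (fun j => a <= 2 ^+ j.+1).
    exists (Num.bound a); apply: ltW; apply: (lt_le_trans (upper_nthrootP (leqnn _))).
    by rewrite ler_weXn2l// ler1n.
  exists true, j => /=; split.
    case: j jP jmin => [|j] jP jmin; first by rewrite expr0.
    by rewrite ltNge; apply/negP => /jmin; rewrite ltnn.
  by rewrite ler_pdivrMr// -exprSr.
have [|j /= jP jmin] := @ex_minnP (fun j => 2 ^- j.+1 < a).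
  exists (Num.bound a^-1); rewrite invf_plt ?posrE ?exprn_gt0//.
  apply: (lt_le_trans (upper_nthrootP (leqnn _))).
  by rewrite ler_weXn2l// ler1n.
exists false, j.+1 => /=; split => //.
rewrite exprS invfM mulrC ler_wpM2l ?invr_ge0//.
case: j jP jmin => [|j] jP jmin; first by rewrite expr0 invr1.
by rewrite leNgt; apply/negP => /jmin; rewrite ltnn.
Qed.

End dyadic_levels.

Section maximal_strong_type.
Local Open Scope ereal_scope.
Context d (T : measurableType d) (R : realType) (mu : {measure set T -> \bar R}).
Variables (Q : nat -> set T) (s : nat -> nat) (r : nat -> R) (k : R).
Hypothesis BQ : dilation_basis mu Q s r k.
Variables (w : T -> R) (D p : R).
Hypothesis Pw : positive_weight mu Q w.
Hypothesis HD : forall i, \int[mu]_(x in Q (s i)) (w x)%:E <=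
                          D%:E * \int[mu]_(x in Q i) (w x)%:E.
Hypothesis p1 : (1 < p)%R.
Variable (f : T -> \bar R).
Hypotheses (mf : measurable_fun setT f) (f0 : forall x, 0 <= f x).

Let mQ i : measurable (Q i). Proof. exact: basis_measurable BQ i. Qed.

Let mw : measurable_fun setT (EFin \o w).
Proof. by apply/measurable_EFinP; exact: weight_measurable Pw. Qed.

Let w0 x : 0 <= (w x)%:E. Proof. by rewrite lee_fin ltW// (weight_gt0 Pw). Qed.

Let mfw : measurable_fun setT (fun x => f x * (w x)%:E).
Proof. exact: emeasurable_funM. Qed.

Let fw0 x : 0 <= f x * (w x)%:E. Proof. exact: mule_ge0. Qed.

Lemma doubling_const_gt0 : (0 < D)%R.
Proof.
have := HD 0%N; rewrite -!(massE Pw) -EFinM lee_fin.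
move=> /(lt_le_trans (mass_gt0 BQ Pw _)).
by rewrite pmulr_lgt0// (mass_gt0 BQ Pw).
Qed.

Let above (a : R) x : \bar R := if a%:E < f x then f x else 0.

Let mabove a : measurable_fun setT (above a).
Proof.
apply: measurable_fun_ifT => //.
apply: (@measurable_fun_lte _ _ _ setT (cst a%:E) f) => //.
Qed.

Let above_ge0 a x : 0 <= above a x.
Proof. by rewrite /above; case: ifP. Qed.

Lemma maxop_superlevel_above (a : R) : (0 < a)%R ->
  [set x | a%:E < maxop mu Q w f x] `<=`
  [set x | (a / 2)%:E < maxop mu Q w (above (a / 2)) x].
Proof.
move=> a0 x /= /(maxop_gtP _)[|i Qi]; first by rewrite lee_fin ltW.
move=> avg_gt; apply: (lt_le_trans _ (maxop_ge mu w _ Qi)).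
have m0 := mass_gt0 BQ Pw i.
have m0' : (mass mu Q w i != 0)%R by rewrite gt_eqF.
have -> : (a / 2)%:E = a%:E - (a / 2)%:E.
  by rewrite -EFinB; congr EFin; lra.
rewrite lteBlDr//; apply: (lt_le_trans avg_gt).
rewrite -[(a / 2)%:E](mulEFinKV _ m0') -ge0_muleDr; last 2 first.
- by apply: integral_ge0 => y _; exact: mule_ge0.
- by rewrite -EFinM lee_fin ltW// mulr_gt0// divr_gt0.
apply: lee_wpmul2l; first by rewrite lee_fin invr_ge0 ltW.
rewrite (massE Pw) muleC -ge0_integralZl//=; last 2 first.
- exact: measurable_funS mw.
- by rewrite lee_fin divr_ge0// ltW.
have mab : measurable_fun setT (fun y => above (a / 2) y * (w y)%:E).
  exact: emeasurable_funM.
rewrite -ge0_integralD//; last 4 first.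
- by move=> y _; exact: mule_ge0.
- exact: measurable_funS mab.
- by move=> y _; apply: mule_ge0 => //; rewrite lee_fin divr_ge0// ltW.
- apply: measurable_funTS; exact: measurable_funeM.
apply: ge0_le_integral => //.
- by apply: measurable_funS mfw.
- apply: emeasurable_funD; first exact: measurable_funS mab.
  apply: measurable_funTS; exact: measurable_funeM.
- move=> y _; rewrite -ge0_muleDl//; last by rewrite lee_fin divr_ge0// ltW.
  apply: lee_wpmul2r => //; rewrite /above; case: ltP => [_|//].
    by rewrite leeDl// lee_fin divr_ge0// ltW.
  by rewrite add0e.
Qed.

Lemma integral_level (a : R) : (0 < a)%R ->
  (a `^ p)%:E * \int[mu]_(x in [set x | a%:E < maxop mu Q w f x]) (w x)%:E <=
  (2 * D)%:E * ((a `^ (p - 1))%:E * \int[mu]_x (above (a / 2) x * (w x)%:E)).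
Proof.
move=> a0; have a20 : (0 < a / 2)%R by rewrite divr_gt0.
have mM : measurable_fun setT (maxop mu Q w f) by exact: measurable_maxop BQ w f.
have msup (b : R) (g : T -> \bar R) : measurable_fun setT g ->
    measurable [set x | b%:E < g x].
  by move=> mg; rewrite -[X in measurable X]setTI; exact: emeasurable_fun_o_infty.
have := maxop_weak_type BQ Pw (mabove (a / 2)) (above_ge0 _) HD a20.
move=> /(@lee_wpmul2l _ (2 * a `^ (p - 1))%:E).
rewrite lee_fin mulr_ge0 ?powR_ge0// => /(_ isT) H.
apply: (@le_trans _ _ ((2 * a `^ (p - 1))%:E * (D%:E * \int[mu]_x (above (a / 2) x * (w x)%:E)))).
  apply: (le_trans _ H); rewrite muleA -EFinM.
  have -> : (2 * a `^ (p - 1) * (a / 2) = a `^ p)%R.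
    rewrite -(mulr_powRB1 (ltW a0) (lt_trans ltr01 p1)); by field.
  apply: lee_wpmul2l; first by rewrite lee_fin powR_ge0.
  apply: ge0_subset_integral => //; [exact: msup| |exact: measurable_funS mw|].
    apply: msup; exact: (measurable_maxop BQ w _).
  exact: maxop_superlevel_above.
by rewrite !muleA -!EFinM mulrAC.
Qed.

Let levels up (a : \bar R) : \bar R :=
  \sum_(0 <= j <oo) (if (dyadic_level R up j)%:E < a then (dyadic_level R up j `^ p)%:E else 0).

Lemma integral_levels up :
  \int[mu]_x (levels up (maxop mu Q w f x) * (w x)%:E) <=
  (2 * D * (dyadic_const p * 2 `^ (p - 1)))%:E * \int[mu]_x (f x `^ p * (w x)%:E).
Proof.
have mM : measurable_fun setT (maxop mu Q w f) by exact: measurable_maxop BQ w f.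
have msup (b : R) (g : T -> \bar R) : measurable_fun setT g ->
    measurable [set x | b%:E < g x].
  by move=> mg; rewrite -[X in measurable X]setTI; exact: emeasurable_fun_o_infty.
have mfp : measurable_fun setT (fun x => f x `^ p).
  exact: measurableT_comp (measurable_poweR p) mf.
set c : R := (2 * D * _)%R.
have c0 : (0 < c)%R.
  have D0 := doubling_const_gt0; have C0 := dyadic_const_gt0 p1.
  have h0 : (0 < 2 `^ (p - 1) :> R)%R by exact: powR_gt0.
  by rewrite /c (mulr_gt0 (mulr_gt0 _ D0) (mulr_gt0 C0 h0)).
pose E j := [set x | (dyadic_level R up j)%:E < maxop mu Q w f x].
have mE j : measurable (E j) by exact: msup.
rewrite -ge0_integralZl//; last 3 first.
- exact: emeasurable_funM.
- by move=> x _; rewrite mule_ge0// poweR_ge0.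
- by rewrite lee_fin ltW.
pose F j x := (2 * D * dyadic_level R up j `^ (p - 1))%:E *
  (above (dyadic_level R up j / 2) x * (w x)%:E).
have D0 := ltW doubling_const_gt0.
have F0 j x : 0 <= F j x.
  by rewrite /F !mule_ge0// lee_fin !mulr_ge0// powR_ge0.
have mF j : measurable_fun setT (F j).
  by apply: measurable_funeM; exact: emeasurable_funM.
apply: (@le_trans _ _ (\int[mu]_x (\sum_(0 <= j <oo) F j x))); last first.
  apply: ge0_le_integral => //.
  - by move=> x _; exact: nneseries_ge0.
  - exact: measurable_fun_nneseries.
  - by apply: measurable_funeM; exact: emeasurable_funM.
  - move=> x _; rewrite /F; have := f0 x; case fx : (f x) => [a| |]// a0; last first.
      by rewrite poweRyr ?gt_eqF ?(lt_trans ltr01)// gt0_mulye ?gt0_muley ?leey ?lte_fin// (weight_gt0 Pw).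
    apply: lime_le; first by apply: is_cvg_nneseries => j _ _; exact: F0.
    apply: nearW => n; rewrite big_mkord.
    rewrite lee_fin in a0.
    apply: (@le_trans _ _ (2 * D * a * w x * \sum_(j < n)
       (if dyadic_level R up j < 2 * a then dyadic_level R up j `^ (p - 1) else 0))%:E).
      rewrite mulr_sumr -sumEFin; apply: lee_sum => j _.
      rewrite /above fx lte_fin ltr_pdivrMr// [(a * 2)%R]mulrC.
      by case: ifPn => _; [rewrite -!EFinM lee_fin; lra|rewrite mul0e mule0 mulr0].
    rewrite poweR_EFin -!EFinM lee_fin.
    have h0 : (0 <= 2 * D * a * w x)%R by rewrite !mulr_ge0// ltW// (weight_gt0 Pw).
    apply: (le_trans (ler_wpM2l h0
      (sum_dyadic_level up n p1 (mulr_ge0 (@ler0n R 2) a0)))).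
    rewrite powRM// /c -(mulr_powRB1 a0 (lt_trans ltr01 p1)).
    by rewrite le_eqVlt; apply/orP; left; apply/eqP; ring.
rewrite integral_nneseries//.
have -> : \int[mu]_x (levels up (maxop mu Q w f x) * (w x)%:E) =
  \int[mu]_x (\sum_(0 <= j <oo) ((dyadic_level R up j `^ p)%:E * ((w x)%:E * (\1_(E j) x)%:E))).
  apply: eq_integral => x _; rewrite muleC -nneseriesZl; last first.
    by move=> j _; case: ifP => // _; rewrite lee_fin powR_ge0.
  apply: eq_eseriesr => j _; rewrite muleCA; congr (_ * _).
  rewrite indicE; case: ifPn => h; first by rewrite mem_set ?mule1.
  by rewrite memNset ?mule0// => /=; exact/negP.
rewrite integral_nneseries//; last 2 first.
- move=> j; apply: measurable_funeM; apply: emeasurable_funM => //.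
  by apply/measurable_EFinP; exact: measurable_indic.
- by move=> j x _; rewrite !mule_ge0// lee_fin powR_ge0.
apply: lee_nneseries => [j _ _|j _].
  by apply: integral_ge0 => x _; rewrite !mule_ge0// lee_fin powR_ge0.
rewrite ge0_integralZl//; last 3 first.
- apply: emeasurable_funM => //.
  by apply/measurable_EFinP; exact: measurable_indic.
- by move=> x _; rewrite !mule_ge0// lee_fin.
- by rewrite lee_fin powR_ge0.
rewrite integral_indicM// /F ge0_integralZl//; last 3 first.
- exact: emeasurable_funM.
- by move=> x _; rewrite !mule_ge0// lee_fin.
- by rewrite lee_fin !mulr_ge0// powR_ge0.
by rewrite EFinM -muleA; apply: integral_level; exact: dyadic_level_gt0.
Qed.

Let levels_ge0 up (a : \bar R) : 0 <= levels up a.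
Proof.
by apply: nneseries_ge0 => j _ _; case: ifP => // _; rewrite lee_fin powR_ge0.
Qed.

Let le_levels (a : \bar R) : 0 <= a ->
  a `^ p <= (2 `^ p)%:E * (levels true a + levels false a).
Proof.
have pgt0 : (0 < p)%R by rewrite (lt_trans ltr01).
have lev0 up j : 0 <= (if (dyadic_level R up j)%:E < a then
    (dyadic_level R up j `^ p)%:E else 0).
  by case: ifP => // _; rewrite lee_fin powR_ge0.
have term up j : (dyadic_level R up j)%:E < a ->
    (dyadic_level R up j `^ p)%:E <= levels true a + levels false a.
  move=> ja; apply: (@le_trans _ _ (levels up a)).
    apply: (@le_trans _ _ (\sum_(0 <= i < j.+1) (if (dyadic_level R up i)%:E < a then
      (dyadic_level R up i `^ p)%:E else 0))).
      rewrite big_nat_recr//= ja leeDr//; apply: sume_ge0 => i _; exact: lev0.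
    by apply: nneseries_lim_ge => i _ _; exact: lev0.
  by case: (up); rewrite (leeDl, leeDr).
case: a lev0 term => [a| |] lev0 term // a0; last first.
  suff -> : levels true +oo + levels false +oo = +oo.
    by rewrite gt0_muley ?leey// lte_fin powR_gt0.
  apply/eqyP => A A0; apply: le_trans (term true (Num.bound A) (ltry _)).
  rewrite lee_fin /dyadic_level (le_trans (ltW (upper_nthrootP (leqnn _))))//.
  by apply: le1r_powR; [rewrite exprn_ege1// ler1n|exact: ltW].
move: (a0); rewrite lee_fin le_eqVlt => /predU1P[<-|agt0].
  by rewrite poweR0r ?gt_eqF// mule_ge0 ?lee_fin ?powR_ge0// adde_ge0.
have [up [j [ja aj]]] := dyadic_level_exists agt0.
apply: (@le_trans _ _ ((2 `^ p)%:E * (dyadic_level R up j `^ p)%:E)).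
  rewrite poweR_EFin -EFinM lee_fin -powRM//; last exact: ltW (dyadic_level_gt0 _ _ _).
  apply: ge0_ler_powR; rewrite ?nnegrE ?(ltW pgt0)//.
  - by rewrite mulr_ge0// ltW// dyadic_level_gt0.
  - by rewrite mulrC -ler_pdivrMr.
by apply: lee_wpmul2l; [rewrite lee_fin powR_ge0|apply: term; rewrite lte_fin].
Qed.

Definition maxop_const (D p : R) : R :=
  2 `^ p * (2 * (2 * D * (dyadic_const p * 2 `^ (p - 1)))).

Lemma maxop_const_ge0 : (0 <= maxop_const D p)%R.
Proof.
have D0 := doubling_const_gt0; have C0 := dyadic_const_gt0 p1.
rewrite /maxop_const; move: (dyadic_const p) C0 => c c0.
by rewrite !mulr_ge0 ?powR_ge0 ?(ltW D0) ?(ltW c0).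
Qed.

Lemma maxop_strong_type :
  \int[mu]_x (maxop mu Q w f x `^ p * (w x)%:E) <=
  (maxop_const D p)%:E * \int[mu]_x (f x `^ p * (w x)%:E).
Proof.
have mM : measurable_fun setT (maxop mu Q w f) by exact: measurable_maxop BQ w f.
have lev0 up (a : \bar R) j : 0 <= (if (dyadic_level R up j)%:E < a then
    (dyadic_level R up j `^ p)%:E else 0).
  by case: ifP => // _; rewrite lee_fin powR_ge0.
have mlev up : measurable_fun setT (fun x => levels up (maxop mu Q w f x) * (w x)%:E).
  apply: emeasurable_funM => //; apply: measurable_fun_nneseries => [j x|j]; first exact: lev0.
  apply: measurable_fun_ifT => //.
  exact: (@measurable_fun_lte _ _ _ setT (cst (dyadic_level R up j)%:E)).
have lev_ge0 up x : 0 <= levels up (maxop mu Q w f x) * (w x)%:E.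
  exact: mule_ge0.
apply: (@le_trans _ _ (\int[mu]_x ((2 `^ p)%:E *
  (levels true (maxop mu Q w f x) * (w x)%:E + levels false (maxop mu Q w f x) * (w x)%:E)))).
  apply: ge0_le_integral => //.
  - by move=> x _; rewrite mule_ge0// poweR_ge0.
  - apply: emeasurable_funM => //; exact: measurableT_comp (measurable_poweR p) mM.
  - by apply: measurable_funeM; exact: emeasurable_funD.
  - move=> x _; rewrite -ge0_muleDl//.
    rewrite muleA; apply: lee_wpmul2r => //; apply: le_levels.
    exact: (maxop_ge0 BQ Pw f0).
rewrite ge0_integralZl//; last 2 first.
- exact: emeasurable_funD.
- by move=> x _; exact: adde_ge0.
rewrite /maxop_const EFinM -muleA; apply: lee_wpmul2l; first by rewrite lee_fin powR_ge0.
rewrite ge0_integralD//.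
apply: (le_trans (leeD (integral_levels true) (integral_levels false))).
have c0 : (0 <= 2 * D * (dyadic_const p * 2 `^ (p - 1)))%R.
  rewrite mulr_ge0// mulr_ge0 ?powR_ge0//; last exact/ltW/dyadic_const_gt0.
  exact/ltW/doubling_const_gt0.
move: c0; set c := (2 * D * _)%R => c0.
by rewrite -(@ge0_muleDl _ _ c%:E c%:E) ?lee_fin// -EFinD mulr_natl -mulr2n.
Qed.

End maximal_strong_type.

(** * Muckenhoupt weights *)

Record muckenhoupt_pair d (T : measurableType d) (R : realType)
    (mu : {measure set T -> \bar R}) (Q : nat -> set T) (p K : R)
    (w sigma : T -> R) : Prop := MuckenhouptPair {
  muckenhoupt_weight : positive_weight mu Q w;
  muckenhoupt_dual_weight : positive_weight mu Q sigma;
  muckenhoupt_dualE : forall x, w x = sigma x `^ (1 - p);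
  muckenhoupt_le : forall i,
    mass mu Q w i * mass mu Q sigma i `^ (p - 1) <= K * fine (mu (Q i)) `^ p }.

Section muckenhoupt.
Context d (T : measurableType d) (R : realType) (mu : {measure set T -> \bar R}).
Variables (Q : nat -> set T) (s : nat -> nat) (r : nat -> R) (k : R).
Hypothesis BQ : dilation_basis mu Q s r k.

Let mQ i : measurable (Q i). Proof. exact: basis_measurable BQ i. Qed.

Let muQE i : (fine (mu (Q i)))%:E = mu (Q i).
Proof. by rewrite fineK// ge0_fin_numE// (basis_lty BQ). Qed.

Let muQ_gt0 i : 0 < fine (mu (Q i)).
Proof. by rewrite -lte_fin muQE (basis_gt0 BQ). Qed.

Lemma muckenhoupt_dual (p K : R) w sigma : 1 < p -> 0 <= K ->
  muckenhoupt_pair mu Q p K w sigma ->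
  muckenhoupt_pair mu Q (p / (p - 1)) (K `^ (p - 1)^-1) sigma w.
Proof.
move=> p1 K0 H; have [Pw Ps ws HK] := H.
have q0 : 0 < p - 1 by rewrite subr_gt0.
have q0' : p - 1 != 0 by rewrite gt_eqF.
have dual1 : p / (p - 1) - 1 = (p - 1)^-1 by field.
split => // [x|i].
  rewrite ws.
  have -> : 1 - p / (p - 1) = - (p - 1)^-1 by field.
  have -> : 1 - p = - (p - 1) by rewrite opprB.
  rewrite -powRrM mulrNN divff// powRr1//.
  by rewrite ltW// (weight_gt0 Ps).
have S0 := mass_gt0 BQ Ps i; have W0 := mass_gt0 BQ Pw i.
rewrite dual1 powRrM -powRM ?powR_ge0//.
rewrite -[X in X * _](powRK q0' (ltW S0)) -powRM ?powR_ge0 ?(ltW W0)//.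
apply: ler_powR_ge0; first by rewrite invr_ge0 ltW.
  by rewrite mulr_ge0 ?powR_ge0 ?(ltW W0).
by rewrite mulrC.
Qed.

Lemma muckenhoupt_reverse (p K : R) w sigma i : 1 < p ->
  muckenhoupt_pair mu Q p K w sigma ->
  fine (mu (Q i)) `^ p <=
  2 `^ p * (mass mu Q w i * mass mu Q sigma i `^ (p - 1)).
Proof.
move=> p1 [Pw Ps ws _].
have q0 : 0 < p - 1 by rewrite subr_gt0.
have q0' : p - 1 != 0 by rewrite gt_eqF.
set m := fine _; set W := mass _ _ w _; set S := mass _ _ sigma _.
have S0 : 0 < S by exact: (mass_gt0 BQ Ps i).
have W0 : 0 < W by exact: (mass_gt0 BQ Pw i).
have m0 : 0 < m by exact: muQ_gt0.
pose l := m / (2 * W).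
have l0 : 0 < l by rewrite divr_gt0// mulr_gt0.
pose l' := l `^ (- (p - 1)^-1).
have l'0 : 0 < l' by exact: powR_gt0.
have powR_dual_exponent : (l `^ (- (p - 1)^-1)) `^ (p - 1) = l^-1.
  by rewrite -powRrM mulNr mulVf// powRN powRr1 ?(ltW l0).
have pointwise x : 1 <= l * w x + l' * sigma x.
  have wx0 := weight_gt0 Pw x; have sx0 := weight_gt0 Ps x.
  have [lw|lw] := leP 1 (l * w x).
    by rewrite (le_trans lw)// lerDl mulr_ge0// ltW.
  rewrite (@le_trans _ _ (l' * sigma x))//; last by rewrite lerDr mulr_ge0// ltW.
  rewrite leNgt; apply/negP => /ltW ls; move: lw; apply/negP; rewrite -leNgt.
  have := ler_powR_ge0 (ltW q0) (mulr_ge0 (ltW l'0) (ltW sx0)) ls.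
  rewrite powR1 powRM ?(ltW l'0) ?(ltW sx0)// /l' powR_dual_exponent ws -[p - 1]opprB powRN.
  by rewrite -invfM invf_le1// mulr_gt0 ?powR_gt0.
have mS : measurable_fun setT (EFin \o sigma).
  by apply/measurable_EFinP; exact: weight_measurable Ps.
have mW : measurable_fun setT (EFin \o w).
  by apply/measurable_EFinP; exact: weight_measurable Pw.
have w0 x : (0 <= (w x)%:E)%E by rewrite lee_fin ltW// (weight_gt0 Pw).
have s0 x : (0 <= (sigma x)%:E)%E by rewrite lee_fin ltW// (weight_gt0 Ps).
have mlw c (v : T -> R) : measurable_fun setT (EFin \o v) ->
    measurable_fun (Q i) (fun x => c%:E * (v x)%:E)%E.
  by move=> mv; apply: measurable_funTS; exact: measurable_funeM.
have : m <= l * W + l' * S.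
  rewrite -lee_fin EFinD (EFinM l) (EFinM l') [m%:E]muQE !massE//.
  rewrite -!ge0_integralZl ?lee_fin ?(ltW l0) ?(ltW l'0)//; try exact: measurable_funTS.
  rewrite -ge0_integralD//; [|by move=> *; rewrite mule_ge0// lee_fin ltW|exact: mlw
    |by move=> *; rewrite mule_ge0// lee_fin ltW|exact: mlw].
  rewrite -[leLHS]mul1e -integral_cst//; apply: ge0_le_integral => //.
    by apply: emeasurable_funD; exact: mlw.
  by move=> x _; rewrite /= lee_fin pointwise.
have -> : l * W = m / 2 by rewrite /l; field; rewrite gt_eqF.
rewrite -lerBlDl (_ : m - m / 2 = m / 2); last by field.
move=> /(ler_powR_ge0 (ltW q0) (ltW (divr_gt0 m0 (ltr0n _ 2)))).
rewrite [leRHS]powRM ?(ltW l'0) ?(ltW S0)// /l' powR_dual_exponent /l invfM invrK => h.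
rewrite -(mulr_powRB1 (ltW m0) (lt_trans ltr01 p1)).
have -> : m `^ (p - 1) = 2 `^ (p - 1) * (m / 2) `^ (p - 1).
  rewrite -powRM ?divr_ge0 ?(ltW m0)//; congr (_ `^ _); by field.
rewrite -[2 `^ p](mulr_powRB1 _ (lt_trans ltr01 p1))//.
rewrite (le_trans (ler_wpM2l (ltW m0) (ler_wpM2l (powR_ge0 _ _) h)))//.
by rewrite le_eqVlt; apply/orP; left; apply/eqP; field; rewrite gt_eqF.
Qed.

Lemma basis_const_gt0 : 0 < k.
Proof.
have := basis_dilate_le BQ 0%N; rewrite -(muQE (s 0%N)) -(muQE 0%N) -EFinM lee_fin => h.
by rewrite -(pmulr_lgt0 _ (muQ_gt0 0%N)); exact: lt_le_trans h.
Qed.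

Definition doubling_const (p K : R) : R := K * (2 * k) `^ p.

Lemma muckenhoupt_doubling (p K : R) w sigma : 1 < p -> 0 <= K ->
  muckenhoupt_pair mu Q p K w sigma -> forall i,
  (\int[mu]_(x in Q (s i)) (w x)%:E <=
   (doubling_const p K)%:E * \int[mu]_(x in Q i) (w x)%:E)%E.
Proof.
move=> p1 K0 H i; have [Pw Ps ws HK] := H.
have k0 := basis_const_gt0.
rewrite -!massE// -EFinM lee_fin.
have S0 := mass_gt0 BQ Ps i; have W0 := mass_gt0 BQ Pw i.
have q0 : 0 < p - 1 by rewrite subr_gt0.
rewrite -(ler_pM2r (powR_gt0 (p - 1) S0)).
have Ss : mass mu Q sigma i <= mass mu Q sigma (s i).
  rewrite -lee_fin !massE//; apply: ge0_subset_integral => //.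
  - by apply: measurable_funTS; apply/measurable_EFinP; exact: weight_measurable Ps.
  - by move=> x _; rewrite lee_fin ltW// (weight_gt0 Ps).
  - exact: (basis_sub_dilate BQ).
apply: (@le_trans _ _ (mass mu Q w (s i) * mass mu Q sigma (s i) `^ (p - 1))).
  apply: ler_wpM2l; first exact/ltW/(mass_gt0 BQ Pw).
  exact: ler_powR_ge0 (ltW q0) (ltW S0) Ss.
apply: (le_trans (HK (s i))).
rewrite /doubling_const -!mulrA; apply: ler_wpM2l => //.
apply: (@le_trans _ _ ((k * fine (mu (Q i))) `^ p)).
  apply: ler_powR_ge0; rewrite ?(ltW (muQ_gt0 _)) ?(ltW (lt_trans ltr01 p1))//.
  by rewrite -lee_fin EFinM !muQE (basis_dilate_le BQ).
rewrite powRM ?(ltW k0) ?(ltW (muQ_gt0 _))// [(2 * k) `^ p]powRM ?(ltW k0)//.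
rewrite [2 `^ p * _]mulrC -mulrA; apply: ler_wpM2l; first exact: powR_ge0.
exact: (muckenhoupt_reverse i p1 H).
Qed.

Lemma one_weight : positive_weight mu Q (fun=> 1).
Proof.
split => // i; by rewrite integral_cst// mul1e (basis_lty BQ).
Qed.

Lemma mass1 i : mass mu Q (fun=> 1) i = fine (mu (Q i)).
Proof. by rewrite /mass integral_cst// mul1e. Qed.

Section lerner.
Variables (p K : R) (w sigma : T -> R).
Hypotheses (p1 : 1 < p) (K0 : 0 <= K).
Hypothesis Hws : muckenhoupt_pair mu Q p K w sigma.
Variable (f : T -> \bar R).
Hypotheses (mf : measurable_fun setT f) (f0 : forall x, (0 <= f x)%E).

Local Open Scope ereal_scope.

Let Pw := muckenhoupt_weight Hws.
Let Ps := muckenhoupt_dual_weight Hws.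
Let w0 x : (0 < w x)%R. Proof. exact: (weight_gt0 Pw). Qed.
Let s0 x : (0 < sigma x)%R. Proof. exact: (weight_gt0 Ps). Qed.
Let mw : measurable_fun setT w. Proof. exact: (weight_measurable Pw). Qed.
Let ms : measurable_fun setT sigma. Proof. exact: (weight_measurable Ps). Qed.
Let q0 : (0 < p - 1)%R. Proof. by rewrite subr_gt0. Qed.
Let q0' : (p - 1 != 0)%R. Proof. by rewrite gt_eqF. Qed.
Let pgt0 : (0 < p)%R. Proof. exact: lt_trans p1. Qed.

Let h x := f x * (sigma x)^-1%:E.
Let Ms := maxop mu Q sigma h.
Let g x := Ms x `^ (p - 1) * (w x)^-1%:E.

Let h0 x : 0 <= h x.
Proof. by rewrite mule_ge0// lee_fin invr_ge0 ltW. Qed.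

Let minv (v : T -> R) : (forall x, 0 < v x)%R -> measurable_fun setT v ->
  measurable_fun setT (fun x => (v x)^-1%:E).
Proof.
move=> v0 mv; apply/measurable_EFinP.
rewrite (_ : (fun x => _) = (fun x => v x `^ (-1))%R).
  exact: measurableT_comp (measurable_powR _) mv.
by apply/funext => x; rewrite powR_inv1// ltW.
Qed.

Let mh : measurable_fun setT h.
Proof. by apply: emeasurable_funM => //; exact: minv. Qed.

Let mMs : measurable_fun setT Ms. Proof. exact: (measurable_maxop BQ). Qed.

Let g0 x : 0 <= g x.
Proof. by rewrite mule_ge0 ?poweR_ge0// lee_fin invr_ge0 ltW. Qed.

Let mg : measurable_fun setT g.
Proof.
apply: emeasurable_funM; last exact: minv.
exact: measurableT_comp (measurable_poweR _) mMs.
Qed.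

Let hE x : h x * (sigma x)%:E = f x.
Proof. by rewrite /h -muleA -EFinM mulVf ?mule1// gt_eqF. Qed.

Let gE x : g x * (w x)%:E = Ms x `^ (p - 1).
Proof. by rewrite /g -muleA -EFinM mulVf ?mule1// gt_eqF. Qed.

Lemma lerner_pointwise x : maxop mu Q (fun=> 1%R) f x <=
  (K%:E * maxop mu Q w g x) `^ (p - 1)^-1.
Proof.
apply: maxop_le => [|i Qi]; first exact: poweR_ge0.
rewrite mass1; under eq_integral do rewrite mule1.
set A := \int[mu]_(y in Q i) f y.
have A0 : 0 <= A by exact: integral_ge0.
set m := fine (mu (Q i)); have m0 : (0 < m)%R by exact: muQ_gt0.
have S0 := mass_gt0 BQ Ps i; have W0 := mass_gt0 BQ Pw i.
set S := mass _ _ sigma i in S0 *; set W := mass _ _ w i in W0 *.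
set a := S^-1%:E * A.
have a0 : 0 <= a by rewrite mule_ge0// lee_fin invr_ge0 ltW.
have aMs y : Q i y -> a <= Ms y.
  move=> Qy; have := maxop_ge mu sigma h Qy; rewrite -/S.
  by under eq_integral do rewrite hE.
have am : a `^ (p - 1) * m%:E <= W%:E * maxop mu Q w g x.
  apply: (@le_trans _ _ (\int[mu]_(y in Q i) (g y * (w y)%:E))).
    rewrite [m%:E]muQE -integral_cst//; apply: ge0_le_integral => //.
    - by move=> y _; exact: poweR_ge0.
    - by apply: measurable_funTS; apply: emeasurable_funM => //; exact/measurable_EFinP.
    - by move=> y Qy; rewrite gE; apply: lee_poweR => //; [exact: ltW|exact: aMs].
  have := maxop_ge mu w g Qi; rewrite -/W => /(@lee_wpmul2l _ W%:E).
  rewrite lee_fin (ltW W0) => /(_ isT).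
  by rewrite mulEFinVK// gt_eqF.
rewrite -(poweRK q0' (mule_ge0 _ A0)); last by rewrite lee_fin invr_ge0 ltW.
apply: lee_poweR; [by rewrite invr_ge0 ltW|exact: poweR_ge0|].
have -> : m^-1%:E * A = (S / m)%:E * a.
  by rewrite /a muleA -EFinM; congr (_%:E * _); field; rewrite !gt_eqF.
rewrite poweRM//; last by rewrite lee_fin divr_ge0 ?ltW.
have -> : a `^ (p - 1) = m^-1%:E * (a `^ (p - 1) * m%:E).
  by rewrite [_ * m%:E]muleC mulEFinKV// gt_eqF.
apply: (@le_trans _ _ (((S / m) `^ (p - 1))%:E * (m^-1%:E * (W%:E * maxop mu Q w g x)))).
  rewrite poweR_EFin; apply: lee_wpmul2l; first by rewrite lee_fin powR_ge0.
  by apply: lee_wpmul2l => //; rewrite lee_fin invr_ge0 ltW.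
rewrite !muleA -!EFinM; apply: lee_wpmul2r; first exact: (maxop_ge0 BQ Pw g0).
rewrite lee_fin powRM ?(ltW S0) ?invr_ge0 ?(ltW m0)//.
have -> : (S `^ (p - 1) * m^-1 `^ (p - 1) / m * W =
    W * S `^ (p - 1) / m `^ p)%R.
  rewrite -invr_powR ?(ltW m0)//.
  have mi0 : (0 <= m^-1)%R by rewrite invr_ge0 ltW.
  by rewrite -(mulr_powRB1 mi0 pgt0); ring.
by rewrite ler_pdivrMr ?powR_gt0//; exact: muckenhoupt_le Hws i.
Qed.

Definition muckenhoupt_const : R :=
  K `^ (p / (p - 1)) * (maxop_const (doubling_const p K) (p / (p - 1)) *
    maxop_const (doubling_const (p / (p - 1)) (K `^ (p - 1)^-1)) p).

Lemma muckenhoupt_theorem :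
  \int[mu]_x (maxop mu Q (fun=> 1%R) f x `^ p * (w x)%:E) <=
  muckenhoupt_const%:E * \int[mu]_x (f x `^ p * (w x)%:E).
Proof.
pose p' := (p / (p - 1))%R.
have p'1 : (1 < p')%R by rewrite ltr_pdivlMr// mul1r gtrBl.
have p'0 : (0 < p')%R by exact: lt_trans p'1.
have Hsw : muckenhoupt_pair mu Q p' (K `^ (p - 1)^-1) sigma w.
  exact: muckenhoupt_dual.
have w0' x : 0 <= (w x)%:E by rewrite lee_fin ltW.
have s0' x : 0 <= (sigma x)%:E by rewrite lee_fin ltW.
have mWE : measurable_fun setT (EFin \o w) by exact/measurable_EFinP.
have mSE : measurable_fun setT (EFin \o sigma) by exact/measurable_EFinP.
have mpow (r' : R) (u : T -> \bar R) : measurable_fun setT u ->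
    measurable_fun setT (fun x => u x `^ r').
  by move=> mu'; exact: measurableT_comp (measurable_poweR _) mu'.
have sigmaE x : ((w x)^-1 `^ p' * w x = sigma x)%R.
  rewrite -{2}(powRr1 (ltW (w0 x))) invr_powR ?(ltW (w0 x))// -powRN -powRD.
    by rewrite addrC (muckenhoupt_dualE Hsw).
  by apply/implyP => _; rewrite gt_eqF.
have wE x : ((sigma x)^-1 `^ p * sigma x = w x)%R.
  rewrite -{2}(powRr1 (ltW (s0 x))) invr_powR ?(ltW (s0 x))// -powRN -powRD.
    by rewrite addrC (muckenhoupt_dualE Hws).
  by apply/implyP => _; rewrite gt_eqF.
have gpE x : g x `^ p' * (w x)%:E = Ms x `^ p * (sigma x)%:E.
  rewrite /g poweRM ?poweR_ge0 ?lee_fin ?invr_ge0 ?(ltW (w0 x))//.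
  rewrite -poweRrM /p' mulrCA divff// mulr1 -muleA; congr (_ * _).
  by rewrite poweR_EFin -EFinM sigmaE.
have hpE x : h x `^ p * (sigma x)%:E = f x `^ p * (w x)%:E.
  rewrite /h poweRM ?lee_fin ?invr_ge0 ?(ltW (s0 x))// -muleA; congr (_ * _).
  by rewrite poweR_EFin -EFinM wE.
have mM : measurable_fun setT (maxop mu Q (fun=> 1%R) f) by exact: (measurable_maxop BQ).
have mMw : measurable_fun setT (maxop mu Q w g) by exact: (measurable_maxop BQ).
have M0 x : 0 <= maxop mu Q (fun=> 1%R) f x by exact: (maxop_ge0 BQ one_weight f0).
have Mw0 x : 0 <= maxop mu Q w g x by exact: (maxop_ge0 BQ Pw g0).
apply: (@le_trans _ _ (\int[mu]_x ((K `^ p')%:E *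
    (maxop mu Q w g x `^ p' * (w x)%:E)))).
  apply: ge0_le_integral => //.
  - by move=> x _; rewrite mule_ge0// poweR_ge0.
  - by apply: emeasurable_funM => //; exact: mpow.
  - by apply: measurable_funeM; apply: emeasurable_funM => //; exact: mpow.
  - move=> x _; rewrite muleA; apply: lee_wpmul2r => //.
    rewrite -poweR_EFin -poweRM ?lee_fin//.
    apply: (le_trans (lee_poweR (ltW pgt0) (M0 x) (lerner_pointwise x))).
    by rewrite -poweRrM mulrC.
rewrite ge0_integralZl//; last 3 first.
- by apply: emeasurable_funM => //; exact: mpow.
- by move=> x _; rewrite mule_ge0// poweR_ge0.
- by rewrite lee_fin powR_ge0.
rewrite /muckenhoupt_const EFinM -muleA; apply: lee_wpmul2l.
  by rewrite lee_fin powR_ge0.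
apply: (le_trans (maxop_strong_type BQ Pw (muckenhoupt_doubling p1 K0 Hws) p'1 mg g0)).
rewrite (EFinM (maxop_const _ p')) -muleA; apply: lee_wpmul2l.
  by rewrite lee_fin (maxop_const_ge0 BQ Pw (muckenhoupt_doubling p1 K0 Hws)).
under eq_integral do rewrite gpE.
apply: (le_trans (maxop_strong_type BQ Ps
  (muckenhoupt_doubling p'1 (powR_ge0 _ _) Hsw) p1 mh h0)).
by under eq_integral do rewrite hpE.
Qed.

End lerner.

End muckenhoupt.

(** * Majorants of class A_1 *)

Record A1_majorant d (T : measurableType d) (R : realType)
    (mu : {measure set T -> \bar R}) (Q : nat -> set T) (C : R) (F : T -> R) :
    Prop := A1Majorant {
  A1_weight : positive_weight mu Q F;
  A1_le : {ae mu, forall x, forall i, Q i x ->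
    mass mu Q F i <= C * fine (mu (Q i)) * F x } }.

Section rubio_de_francia.
Local Open Scope ereal_scope.
Context d (T : measurableType d) (R : realType) (mu : {measure set T -> \bar R}).
Variables (Q : nat -> set T) (s : nat -> nat) (r : nat -> R) (k : R).
Hypothesis BQ : dilation_basis mu Q s r k.

Let mQ i : measurable (Q i). Proof. exact: (basis_measurable BQ). Qed.

Let muQE i : (fine (mu (Q i)))%:E = mu (Q i).
Proof. by rewrite fineK// ge0_fin_numE// (basis_lty BQ). Qed.

Let muQ_gt0 i : (0 < fine (mu (Q i)))%R.
Proof. by rewrite -lte_fin muQE (basis_gt0 BQ). Qed.

Let M := maxop mu Q (fun=> 1%R).

Let avgE i f : ((mass mu Q (fun=> 1%R) i)^-1)%:E * \int[mu]_(y in Q i) (f y * 1%:E) =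
  ((fine (mu (Q i)))^-1)%:E * \int[mu]_(y in Q i) f y.
Proof. by rewrite (mass1 BQ); under eq_integral do rewrite mule1. Qed.

Let M_ge0 f : (forall x, 0 <= f x) -> forall x, 0 <= M f x.
Proof. by move=> f0 x; exact: (maxop_ge0 BQ (one_weight BQ) f0). Qed.

Let mM f : measurable_fun setT (M f).
Proof. exact: (measurable_maxop BQ). Qed.

Lemma maxop_nneseries_le (c : nat -> R) (f : nat -> T -> \bar R) x :
  (forall n, (0 <= c n)%R) -> (forall n x, 0 <= f n x) ->
  (forall n, measurable_fun setT (f n)) ->
  M (fun x => \sum_(0 <= n <oo) (c n)%:E * f n x) x <=
  \sum_(0 <= n <oo) (c n)%:E * M (f n) x.
Proof.
move=> c0 f0 mf; apply: maxop_le => [|i Qi].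
  by apply: nneseries_ge0 => n _ _; rewrite mule_ge0// ?lee_fin// M_ge0.
rewrite avgE integral_nneseries//; last 2 first.
- by move=> n; apply: measurable_funTS; exact: measurable_funeM.
- by move=> n y _; rewrite mule_ge0// lee_fin.
rewrite -nneseriesZl; last by move=> n _; apply: integral_ge0 => y _; rewrite mule_ge0// lee_fin.
apply: lee_nneseries => [n _ _|n _].
  rewrite mule_ge0// ?lee_fin ?invr_ge0 ?(ltW (muQ_gt0 _))//.
  by apply: integral_ge0 => y _; rewrite mule_ge0// lee_fin.
rewrite ge0_integralZl// ?lee_fin//; last exact: measurable_funTS.
rewrite muleCA; apply: lee_wpmul2l; first by rewrite lee_fin.
by rewrite -avgE; exact: maxop_ge.
Qed.

Lemma sum_half_le2 n : (\sum_(0 <= j < n) 2 ^- j <= 2 :> R)%R.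
Proof.
suff -> : (\sum_(0 <= j < n) 2 ^- j = 2 - 2 * 2 ^- n :> R)%R.
  by rewrite gerBl mulr_ge0// invr_ge0 exprn_ge0.
elim: n => [|n ih]; first by rewrite big_nil expr0 invr1 mulr1 subrr.
rewrite big_nat_recr//= ih exprS invfM.
by field; rewrite expf_neq0.
Qed.

Lemma nneseries_half_le (x : \bar R) : 0 <= x ->
  \sum_(0 <= j <oo) (2 ^- j)%:E * x <= 2%:E * x.
Proof.
move=> x0; apply: lime_le.
  by apply: is_cvg_nneseries => j _ _; rewrite mule_ge0// lee_fin invr_ge0 exprn_ge0.
apply: nearW => n; rewrite -ge0_sume_distrl; last first.
  by move=> j _; rewrite lee_fin invr_ge0 exprn_ge0.
by apply: lee_wpmul2r => //; rewrite sumEFin lee_fin sum_half_le2.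
Qed.

Variables (p A : R) (u : T -> R).
Hypotheses (p1 : (1 < p)%R) (A1 : (1 <= A)%R).
Hypothesis Pu : positive_weight mu Q u.
Hypothesis bounded : forall f : T -> \bar R, measurable_fun setT f ->
  (forall x, 0 <= f x) ->
  \int[mu]_x (M f x `^ p * (u x)%:E) <= (A `^ p)%:E * \int[mu]_x (f x `^ p * (u x)%:E).

Let A0 : (0 < A)%R. Proof. exact: lt_le_trans A1. Qed.
Let pgt0 : (0 < p)%R. Proof. exact: lt_trans p1. Qed.
Let u0 x : 0 <= (u x)%:E. Proof. by rewrite lee_fin ltW// (weight_gt0 Pu). Qed.
Let mu_ : measurable_fun setT (EFin \o u).
Proof. by apply/measurable_EFinP; exact: (weight_measurable Pu). Qed.
Let mpow (f : T -> \bar R) : measurable_fun setT f ->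
  measurable_fun setT (fun x => f x `^ p * (u x)%:E).
Proof.
move=> mf; apply: emeasurable_funM => //.
exact: measurableT_comp (measurable_poweR _) mf.
Qed.

Definition maxop_series (f : T -> \bar R) (x : T) : \bar R :=
  \sum_(0 <= j <oo) ((4 * A) ^- j)%:E * iter j M f x.

Variable f : T -> \bar R.
Hypotheses (mf : measurable_fun setT f) (f0 : forall x, 0 <= f x).

Let Mf0 j x : 0 <= iter j M f x.
Proof. by elim: j x => // j ih x /=; exact: M_ge0. Qed.

Let mMf j : measurable_fun setT (iter j M f).
Proof. by case: j => // j; exact: mM. Qed.

Let c0 j : (0 <= (4 * A) ^- j)%R.
Proof. by rewrite invr_ge0 exprn_ge0// mulr_ge0// ltW. Qed.

Lemma measurable_maxop_series : measurable_fun setT (maxop_series f).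
Proof.
apply: measurable_fun_nneseries => [j x|j].
  by rewrite mule_ge0// lee_fin.
exact: measurable_funeM.
Qed.

Lemma maxop_series_ge n x :
  ((4 * A) ^- n)%:E * iter n M f x <= maxop_series f x.
Proof.
apply: (@le_trans _ _ (\sum_(0 <= j < n.+1) ((4 * A) ^- j)%:E * iter j M f x)).
  rewrite big_nat_recr//= leeDr//; apply: sume_ge0 => i _.
  by rewrite mule_ge0// lee_fin.
by apply: nneseries_lim_ge => i _ _; rewrite mule_ge0// lee_fin.
Qed.

Lemma maxop_series_ge0 x : 0 <= maxop_series f x.
Proof. by apply: nneseries_ge0 => j _ _; rewrite mule_ge0// lee_fin. Qed.

Lemma le_maxop_series x : f x <= maxop_series f x.
Proof. by have := maxop_series_ge 0 x; rewrite expr0 invr1 mul1e. Qed.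

Lemma maxop_maxop_series x :
  M (maxop_series f) x <= (4 * A)%:E * maxop_series f x.
Proof.
apply: (le_trans (maxop_nneseries_le x c0 Mf0 mMf)).
have AA : (0 < 4 * A)%R by rewrite mulr_gt0.
rewrite /maxop_series -nneseriesZl; last by move=> j _; rewrite mule_ge0// lee_fin.
rewrite [leRHS]nneseries_recl//; last by move=> j _; rewrite !mule_ge0// lee_fin// ltW.
rewrite -[X in _ <= _ + X](nneseries_addn (f := fun j => (4 * A)%:E *
   (((4 * A) ^- j)%:E * iter j M f x))); last first.
  by move=> j; rewrite !mule_ge0// lee_fin// ltW.
rewrite -[leLHS]add0e; apply: leeD; first by rewrite !mule_ge0// lee_fin// ltW.
apply: lee_nneseries => [j _ _|j _]; first by rewrite mule_ge0 ?lee_fin ?M_ge0.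
by rewrite addn1 iterS exprS invfM (EFinM (4 * A)^-1) -muleA mulEFinVK ?gt_eqF.
Qed.

Lemma integral_maxop_series :
  \int[mu]_x (maxop_series f x `^ p * (u x)%:E) <=
  (2 `^ p * 2)%:E * \int[mu]_x (f x `^ p * (u x)%:E).
Proof.
have half0 j : (0 <= (2 * A) ^- j :> R)%R.
  by rewrite invr_ge0 exprn_ge0// mulr_ge0// ltW.
pose b j x := ((2 * A) ^- j)%:E * iter j M f x.
have b0 j x : 0 <= b j x by rewrite mule_ge0// lee_fin.
have mb j : measurable_fun setT (b j) by exact: measurable_funeM.
pose S x := \sum_(0 <= j <oo) b j x `^ p.
have S0 x : 0 <= S x by apply: nneseries_ge0 => *; exact: poweR_ge0.
have mbp j : measurable_fun setT (fun x => b j x `^ p).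
  exact: measurableT_comp (measurable_poweR _) (mb j).
have mS : measurable_fun setT S.
  by apply: measurable_fun_nneseries => // j x; exact: poweR_ge0.
have series_le x : maxop_series f x `^ p <= (2 `^ p)%:E * S x.
  have bS j : b j x <= S x `^ p^-1.
    rewrite -(poweRK (lt0r_neq0 pgt0) (b0 j x)).
    apply: lee_poweR; [by rewrite invr_ge0 ltW|exact: poweR_ge0|].
    apply: (@le_trans _ _ (\sum_(0 <= i < j.+1) b i x `^ p)).
      by rewrite big_nat_recr//= leeDr//; apply: sume_ge0 => i _; exact: poweR_ge0.
    by apply: nneseries_lim_ge => i _ _; exact: poweR_ge0.
  have : maxop_series f x <= 2%:E * S x `^ p^-1.
    apply: (le_trans _ (nneseries_half_le (poweR_ge0 _ _))).
    apply: lee_nneseries => [j _ _|j _]; first by rewrite mule_ge0// lee_fin.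
    have -> : ((4 * A) ^- j = 2 ^- j * (2 * A) ^- j :> R)%R.
      rewrite -invfM -exprMn; congr (_ ^+ _)^-1%R; ring.
    rewrite EFinM -muleA; apply: lee_wpmul2l; last exact: bS.
    by rewrite lee_fin invr_ge0 exprn_ge0.
  move=> /(lee_poweR (ltW pgt0) (maxop_series_ge0 x)).
  by rewrite poweRM ?poweR_ge0// poweRVK// gt_eqF.
pose I := \int[mu]_x (f x `^ p * (u x)%:E).
have I0 : 0 <= I by apply: integral_ge0 => x _; rewrite mule_ge0// poweR_ge0.
have iterI j : \int[mu]_x (iter j M f x `^ p * (u x)%:E) <= ((A ^+ j) `^ p)%:E * I.
  elim: j => [|j ih]; first by rewrite expr0 powR1 mul1e.
  apply: (le_trans (bounded (mMf j) (Mf0 j))).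
  rewrite exprS powRM ?exprn_ge0 ?(ltW A0)// EFinM -muleA.
  by apply: lee_wpmul2l => //; rewrite lee_fin powR_ge0.
apply: (@le_trans _ _ (\int[mu]_x ((2 `^ p)%:E * \sum_(0 <= j <oo) (u x)%:E * b j x `^ p))).
  apply: ge0_le_integral => //.
  - by move=> x _; rewrite mule_ge0// poweR_ge0.
  - exact: mpow measurable_maxop_series.
  - apply: measurable_funeM; apply: measurable_fun_nneseries => [j x|j].
      by rewrite mule_ge0// poweR_ge0.
    exact: emeasurable_funM.
  - move=> x _; rewrite nneseriesZl; last by move=> *; exact: poweR_ge0.
    by rewrite muleCA muleC -/(S x) lee_wpmul2l.
rewrite ge0_integralZl//; last 2 first.
- apply: measurable_fun_nneseries => [j x|j].
    by rewrite mule_ge0// poweR_ge0.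
  exact: emeasurable_funM.
- by move=> x _; apply: nneseries_ge0 => *; rewrite mule_ge0// poweR_ge0.
rewrite EFinM -muleA; apply: lee_wpmul2l; first by rewrite lee_fin powR_ge0.
rewrite integral_nneseries//; last 2 first.
- by move=> j; exact: emeasurable_funM.
- by move=> j x _; rewrite mule_ge0// poweR_ge0.
apply: (le_trans _ (nneseries_half_le I0)).
apply: lee_nneseries => [j _ _|j _].
  by apply: integral_ge0 => x _; rewrite mule_ge0// poweR_ge0.
have -> : \int[mu]_x ((u x)%:E * b j x `^ p) =
    (((2 * A) ^- j) `^ p)%:E * \int[mu]_x (iter j M f x `^ p * (u x)%:E).
  rewrite -ge0_integralZl//; last 3 first.
  - exact: mpow.
  - by move=> x _; rewrite mule_ge0// poweR_ge0.
  - by rewrite lee_fin powR_ge0.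
  by apply: eq_integral => x _; rewrite /b poweRM ?lee_fin// poweR_EFin muleC muleA.
apply: (le_trans (lee_wpmul2l _ (iterI j))); first by rewrite lee_fin powR_ge0.
rewrite muleA -EFinM; apply: lee_wpmul2r => //; rewrite lee_fin.
rewrite -powRM ?exprn_ge0 ?(ltW A0)//.
have -> : ((2 * A) ^- j * A ^+ j = 2 ^- j)%R.
  rewrite exprMn invfM -mulrA mulVf ?mulr1//.
  by rewrite expf_neq0// gt_eqF.
apply: ge1r_powR; last exact: ltW.
by rewrite invr_gt0 exprn_gt0//= invf_le1 ?exprn_gt0// exprn_ege1// ler1n.
Qed.

End rubio_de_francia.

Section A1_majorants.
Local Open Scope ereal_scope.
Context d (T : measurableType d) (R : realType) (mu : {measure set T -> \bar R}).
Variables (Q : nat -> set T) (s : nat -> nat) (r : nat -> R) (k : R).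
Hypothesis BQ : dilation_basis mu Q s r k.

Let mQ i : measurable (Q i). Proof. exact: (basis_measurable BQ). Qed.

Let muQE i : (fine (mu (Q i)))%:E = mu (Q i).
Proof. by rewrite fineK// ge0_fin_numE// (basis_lty BQ). Qed.

Let muQ_gt0 i : (0 < fine (mu (Q i)))%R.
Proof. by rewrite -lte_fin muQE (basis_gt0 BQ). Qed.

Variables (p A : R) (u : T -> R).
Hypotheses (p1 : (1 < p)%R) (A1 : (1 <= A)%R).
Hypothesis Pu : positive_weight mu Q u.
Hypothesis bounded : forall f : T -> \bar R, measurable_fun setT f ->
  (forall x, 0 <= f x) ->
  \int[mu]_x (maxop mu Q (fun=> 1%R) f x `^ p * (u x)%:E) <=
  (A `^ p)%:E * \int[mu]_x (f x `^ p * (u x)%:E).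

Let A0 : (0 < A)%R. Proof. exact: lt_le_trans A1. Qed.
Let pgt0 : (0 < p)%R. Proof. exact: lt_trans p1. Qed.
Let u0 x : 0 <= (u x)%:E. Proof. by rewrite lee_fin ltW// (weight_gt0 Pu). Qed.
Let mu_ : measurable_fun setT (EFin \o u).
Proof. by apply/measurable_EFinP; exact: (weight_measurable Pu). Qed.
Let mpow (f : T -> \bar R) : measurable_fun setT f ->
  measurable_fun setT (fun x => f x `^ p * (u x)%:E).
Proof.
move=> mf; apply: emeasurable_funM => //.
exact: measurableT_comp (measurable_poweR _) mf.
Qed.

Lemma maxop_series_gt0 (f : T -> \bar R) (c : R) i : measurable_fun setT f ->
  (forall x, 0 <= f x) -> (0 < c)%R -> (forall x, Q i x -> c%:E <= f x) ->
  forall x, 0 < maxop_series mu Q A f x.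
Proof.
move=> mf f0 c0 cf x; apply: (lt_le_trans _ (maxop_series_ge BQ A1 f0 1%N x)).
rewrite /= expr1 mule_gt0 ?lte_fin ?invr_gt0 ?mulr_gt0//.
have [j [Qj ij]] := basis_directed BQ i x.
apply: (lt_le_trans _ (maxop_ge mu (fun=> 1%R) f Qj)).
rewrite (mass1 BQ) mule_gt0 ?lte_fin ?invr_gt0//.
under eq_integral do rewrite mule1.
apply: (@lt_le_trans _ _ (\int[mu]_(y in Q i) f y)).
  apply: (@lt_le_trans _ _ (\int[mu]_(y in Q i) (cst c%:E y))).
    by rewrite integral_cst// mule_gt0// (basis_gt0 BQ).
  apply: ge0_le_integral => //; first by move=> y _; rewrite lee_fin ltW.
  exact: measurable_funTS.
apply: ge0_subset_integral => //; exact: measurable_funTS.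
Qed.

Lemma A1_majorant_exists (f : T -> \bar R) (Phi : R) : measurable_fun setT f ->
  (forall x, 0 <= f x) -> (0 < Phi)%R ->
  \int[mu]_x (f x `^ p * (u x)%:E) <= Phi%:E ->
  exists F : T -> R, [/\ A1_majorant mu Q (4 * A) F,
    {ae mu, forall x, f x <= (F x)%:E} &
    \int[mu]_x (F x `^ p * u x)%:E <= (2 `^ p * 4 * Phi)%:E].
Proof.
move=> mf f0 Phi0 fPhi.
have W0 := mass_gt0 BQ Pu 0.
pose c : R := ((Phi / mass mu Q u 0) `^ p^-1)%R.
have c0 : (0 < c)%R by rewrite powR_gt0// divr_gt0.
have cp : (c `^ p * mass mu Q u 0 = Phi)%R.
  by rewrite powRVK ?gt_eqF ?divr_ge0 ?ltW// divfK// gt_eqF.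
pose g x : \bar R := c%:E * (\1_(Q 0%N) x)%:E.
have g0 x : 0 <= g x by rewrite mule_ge0// lee_fin// ltW.
have mg : measurable_fun setT g.
  by apply: measurable_funeM; apply/measurable_EFinP; exact: measurable_indic.
pose f1 x := maxe (f x) (g x).
have f10 x : 0 <= f1 x by rewrite le_max f0.
have mf1 : measurable_fun setT f1 by exact: measurable_maxe.
have intf1 : \int[mu]_x (f1 x `^ p * (u x)%:E) <= (2 * Phi)%:E.
  apply: (@le_trans _ _ (\int[mu]_x (f x `^ p * (u x)%:E + g x `^ p * (u x)%:E))).
    apply: ge0_le_integral => //.
    - by move=> x _; rewrite mule_ge0// poweR_ge0.
    - exact: mpow.
    - by apply: emeasurable_funD; exact: mpow.
    - move=> x _; rewrite /f1; case: (leP (f x) (g x)) => _.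
        by rewrite leeDr// mule_ge0// poweR_ge0.
      by rewrite leeDl// mule_ge0// poweR_ge0.
  rewrite ge0_integralD//; last 4 first.
  - by move=> x _; rewrite mule_ge0// poweR_ge0.
  - exact: mpow.
  - by move=> x _; rewrite mule_ge0// poweR_ge0.
  - exact: mpow.
  rewrite mulr_natl mulr2n EFinD; apply: leeD => //.
  have -> : \int[mu]_x (g x `^ p * (u x)%:E) =
      \int[mu]_x ((c `^ p)%:E * ((u x)%:E * (\1_(Q 0%N) x)%:E)).
    apply: eq_integral => x _; rewrite /g indicE; case: (x \in Q 0%N).
      by rewrite !mule1.
    by rewrite !mule0 poweR0r ?mul0e// gt_eqF.
  rewrite ge0_integralZl//; last 3 first.
  - by apply: emeasurable_funM => //; apply/measurable_EFinP; exact: measurable_indic.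
  - by move=> x _; rewrite mule_ge0// lee_fin.
  - by rewrite lee_fin powR_ge0.
  by rewrite integral_indicM// -massE// -EFinM cp.
pose G := maxop_series mu Q A f1.
have G0 x : 0 < G x.
  apply: (@maxop_series_gt0 _ c 0%N) => // y Qy.
  by rewrite /f1 le_max; apply/orP; right; rewrite /g indicE mem_set// mule1.
have G0' x : 0 <= G x by exact: ltW.
have mG : measurable_fun setT G by exact: (measurable_maxop_series BQ A1 mf1 f10).
have intG : \int[mu]_x (G x `^ p * (u x)%:E) <= (2 `^ p * 4 * Phi)%:E.
  apply: (le_trans (integral_maxop_series BQ p1 A1 Pu bounded mf1 f10)).
  apply: (le_trans (lee_wpmul2l _ intf1)); first by rewrite lee_fin mulr_ge0// powR_ge0.
  by rewrite -EFinM lee_fin le_eqVlt; apply/orP; left; apply/eqP; ring.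
have Gfin : {ae mu, forall x, G x \is a fin_num}.
  have Gint : mu.-integrable setT (fun x => G x `^ p * (u x)%:E).
    apply/integrableP; split; first exact: mpow.
    under eq_integral do rewrite gee0_abs ?mule_ge0 ?poweR_ge0//.
    exact: le_lt_trans intG (ltry _).
  have := integrable_ae measurableT Gint.
  apply: filterS => x /(_ Logic.I); have := G0 x.
  case: (G x) => // _; rewrite poweRyr ?gt_eqF//.
  by rewrite gt0_mulye// lte_fin (weight_gt0 Pu).
pose F x : R := if G x == +oo then 1%R else fine (G x).
have FG x : G x \is a fin_num -> (F x)%:E = G x.
  by move=> Gx; rewrite /F; case: eqP => [GE|_]; [rewrite GE in Gx|rewrite fineK].
have F0 x : (0 < F x)%R.
  rewrite /F; have := G0 x; case: (G x) => //= r0; by rewrite lte_fin.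
have mF : measurable_fun setT F.
  apply: measurable_fun_ifT => //.
    rewrite (_ : (fun x => G x == +oo) = (fun x => +oo <= G x)).
      exact: (@measurable_fun_lee _ _ _ setT (cst +oo)).
    by apply/funext => x; rewrite leye_eq.
  exact: measurableT_comp.
have mFE : measurable_fun setT (EFin \o F) by exact/measurable_EFinP.
have FGae : ae_eq mu setT G (EFin \o F).
  by apply: filterS Gfin => x Gx _; rewrite /= FG.
have GQ i x : Q i x -> \int[mu]_(y in Q i) G y <= (4 * A * fine (mu (Q i)))%:E * G x.
  move=> Qx; have := le_trans (maxop_ge mu (fun=> 1%R) G Qx) (maxop_maxop_series BQ A1 mf1 f10 x).
  rewrite (mass1 BQ); under eq_integral do rewrite mule1.
  move=> /(@lee_wpmul2l _ (fine (mu (Q i)))%:E).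
  rewrite lee_fin (ltW (muQ_gt0 i)) => /(_ isT).
  by rewrite mulEFinVK ?gt_eqF// muleA -EFinM mulrC.
have intFG i : \int[mu]_(y in Q i) (F y)%:E = \int[mu]_(y in Q i) G y.
  apply: ge0_ae_eq_integral => //.
  - exact: measurable_funTS.
  - exact: measurable_funTS.
  - by move=> x _; rewrite lee_fin ltW.
  - by apply: filterS FGae => x h _; rewrite h.
have PF : positive_weight mu Q F.
  split => // i; rewrite intFG.
  have [x [Qx Gx]] : exists x, Q i x /\ G x \is a fin_num.
    apply: contrapT => nex.
    move: Gfin => [N [mN N0 sub]].
    have : mu (Q i) <= mu N.
      apply: le_measure; rewrite ?inE// => x Qx; apply: sub => /= Gx.
      by apply: nex; exists x.
    by rewrite N0 leNgt (basis_gt0 BQ).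
  apply: (le_lt_trans (GQ i x Qx)); rewrite -(fineK Gx) -EFinM; exact: ltry.
exists F; split.
- split => //; apply: filterS Gfin => x Gx i Qx.
  rewrite -lee_fin massE// intFG (le_trans (GQ i x Qx))// -(FG x Gx) -EFinM.
  by rewrite lee_fin.
- apply: filterS Gfin => x Gx; rewrite FG//.
  apply: (@le_trans _ _ (f1 x)); first by rewrite le_max lexx.
  exact: (le_maxop_series BQ A1 f10).
- apply: le_trans intG; rewrite le_eqVlt; apply/orP; left; apply/eqP.
  apply: ge0_ae_eq_integral => //.
  - apply/measurable_EFinP; apply: measurable_funM; last exact: (weight_measurable Pu).
    exact: measurableT_comp (measurable_powR _) mF.
  - exact: mpow.
  - by move=> x _; rewrite lee_fin mulr_ge0 ?powR_ge0// ltW// (weight_gt0 Pu).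
  - by move=> x _; rewrite mule_ge0// poweR_ge0.
  - by apply: filterS Gfin => x Gx _; rewrite -FG// EFinM poweR_EFin.
Qed.

End A1_majorants.

Section A1_factorization.
Context d (T : measurableType d) (R : realType) (mu : {measure set T -> \bar R}).
Variables (Q : nat -> set T) (s : nat -> nat) (r : nat -> R) (k : R).
Hypothesis BQ : dilation_basis mu Q s r k.

Let mQ i : measurable (Q i). Proof. exact: (basis_measurable BQ). Qed.

Let muQE i : (fine (mu (Q i)))%:E = mu (Q i).
Proof. by rewrite fineK// ge0_fin_numE// (basis_lty BQ). Qed.

Let muQ_gt0 i : 0 < fine (mu (Q i)).
Proof. by rewrite -lte_fin muQE (basis_gt0 BQ). Qed.

Lemma le0_ler_powR (a x e : R) : e <= 0 -> 0 < a -> a <= x -> x `^ e <= a `^ e.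
Proof.
move=> e0 a0 ax; have x0 := lt_le_trans a0 ax.
rewrite -[e]opprK (powRN x) (powRN a) lef_pV2 ?posrE ?powR_gt0//.
by apply: ler_powR_ge0; rewrite ?oppr_ge0 ?(ltW a0).
Qed.

Lemma A1_integral_le (C e : R) (F H : T -> R) i : 0 < C -> e <= 0 ->
  A1_majorant mu Q C F -> positive_weight mu Q H ->
  (\int[mu]_(x in Q i) (F x `^ e * H x)%:E <=
   ((mass mu Q F i / (C * fine (mu (Q i)))) `^ e * mass mu Q H i)%:E)%E.
Proof.
move=> C0 e0 [PF FA1] PH.
set a := _ / _; have a0 : 0 < a.
  by rewrite divr_gt0 ?mulr_gt0 ?(mass_gt0 BQ PF).
have mH := weight_measurable PH; have mF := weight_measurable PF.
have mHE : measurable_fun setT (EFin \o H) by exact/measurable_EFinP.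
have H0 x : (0 <= (H x)%:E)%E by rewrite lee_fin ltW// (weight_gt0 PH).
rewrite (EFinM (a `^ e)) massE// -ge0_integralZl//; last 2 first.
- exact: measurable_funTS.
- by rewrite lee_fin powR_ge0.
apply: ae_ge0_le_integral => //.
- by move=> x _; rewrite EFinM mule_ge0// lee_fin powR_ge0.
- apply: measurable_funTS; apply/measurable_EFinP; apply: measurable_funM => //.
  exact: measurableT_comp (measurable_powR _) mF.
- by move=> x _; rewrite mule_ge0// lee_fin powR_ge0.
- by apply: measurable_funTS; exact: measurable_funeM.
- apply: filterS FA1 => x FA1 Qx; rewrite EFinM; apply: lee_wpmul2r => //.
  rewrite lee_fin; apply: le0_ler_powR => //.
  by rewrite ler_pdivrMr ?mulr_gt0// mulrC FA1.
Qed.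

Lemma A1_muckenhoupt (C D p : R) (F H : T -> R) : 1 < p -> 0 < C -> 0 < D ->
  A1_majorant mu Q C F -> A1_majorant mu Q D H ->
  muckenhoupt_pair mu Q p (C `^ (p - 1) * D)
    (fun x => F x `^ (1 - p) * H x) (fun x => H x `^ (1 - p / (p - 1)) * F x).
Proof.
move=> p1 C0 D0 AF AH; have [PF _] := AF; have [PH _] := AH.
have q0 : 0 < p - 1 by rewrite subr_gt0.
have q0' : p - 1 != 0 by rewrite gt_eqF.
have e0 : 1 - p <= 0 by rewrite subr_le0 ltW.
have dualE : 1 - p / (p - 1) = - (p - 1)^-1 by field.
have e0' : 1 - p / (p - 1) <= 0 by rewrite dualE oppr_le0 invr_ge0 ltW.
have F0 := weight_gt0 PF; have H0 := weight_gt0 PH.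
have mF := weight_measurable PF; have mH := weight_measurable PH.
have mass_le (e : R) (X Y : T -> R) i (y : R) : 
    (\int[mu]_(x in Q i) (X x `^ e * Y x)%:E <= y%:E)%E -> 
    (forall x, 0 < Y x) -> mass mu Q (fun x => X x `^ e * Y x) i <= y.
  move=> le_y Y0; rewrite -lee_fin /mass fineK// ge0_fin_numE.
    exact: le_lt_trans le_y (ltry _).
  by apply: integral_ge0 => x _; rewrite lee_fin mulr_ge0 ?powR_ge0// ltW.
split.
- split => [|x|i].
  + by apply: measurable_funM => //; exact: measurableT_comp (measurable_powR _) mF.
  + by rewrite mulr_gt0 ?powR_gt0.
  + exact: le_lt_trans (A1_integral_le i C0 e0 AF PH) (ltry _).
- split => [|x|i].
  + by apply: measurable_funM => //; exact: measurableT_comp (measurable_powR _) mH.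
  + by rewrite mulr_gt0 ?powR_gt0.
  + exact: le_lt_trans (A1_integral_le i D0 e0' AH PF) (ltry _).
- move=> x; rewrite powRM ?powR_ge0 ?(ltW (F0 x))// -powRrM dualE.
  have -> : - (p - 1)^-1 * (1 - p) = 1 by field.
  by rewrite powRr1 ?(ltW (H0 x))// mulrC.
- move=> i; have IF0 := mass_gt0 BQ PF i; have IH0 := mass_gt0 BQ PH i.
  have h1 := mass_le _ _ _ _ _ (A1_integral_le i C0 e0 AF PH) H0.
  have h2 := mass_le _ _ _ _ _ (A1_integral_le i D0 e0' AH PF) F0.
  have m0 := muQ_gt0 i.
  have W0 : 0 <= mass mu Q (fun x => F x `^ (1 - p) * H x) i.
    apply: fine_ge0; apply: integral_ge0 => x _.
    by rewrite lee_fin mulr_ge0 ?powR_ge0// ltW.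
  have S0 : 0 <= mass mu Q (fun x => H x `^ (1 - p / (p - 1)) * F x) i.
    apply: fine_ge0; apply: integral_ge0 => x _.
    by rewrite lee_fin mulr_ge0 ?powR_ge0// ltW.
  apply: (le_trans (ler_pM W0 (powR_ge0 _ _) h1 (ler_powR_ge0 (ltW q0) S0 h2))).
  move: h1 h2 W0 S0 => _ _ _ _.
  move: (mass mu Q F i) (mass mu Q H i) (fine (mu (Q i))) IF0 IH0 m0 => IF IH m IF0 IH0 m0.
  rewrite [(_ * IF) `^ _]powRM ?powR_ge0 ?(ltW IF0)// -powRrM dualE mulNr mulVf//.
  have b0 : 0 < IH / (D * m) by rewrite divr_gt0// mulr_gt0.
  rewrite powR_inv1 ?(ltW b0)// -opprB powRN -invr_powR; last first.
    by rewrite ltW// divr_gt0// mulr_gt0.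
  rewrite invf_div powRM ?invr_ge0 ?(ltW IF0)//; last by rewrite ltW// mulr_gt0.
  rewrite invr_powR ?(ltW IF0)// powRM ?(ltW C0) ?(ltW m0)//.
  rewrite -(mulr_powRB1 (ltW m0) (lt_trans ltr01 p1)).
  rewrite le_eqVlt; apply/orP; left; apply/eqP; field.
  by rewrite !gt_eqF// powR_gt0.
Qed.

End A1_factorization.

Section pointwise_inequalities.
Context (R : realType).

(* Young's inequality up to a constant, by comparing [H] with [l * F `^ (p - 1) * u]. *)
Lemma le_mul_powR (l F H u v p : R) : 1 < p -> 0 < l -> 0 < F -> 0 < H -> 0 < v ->
  u = v `^ (1 - p) ->
  F * H <= l * (F `^ p * u) + l `^ (1 - p / (p - 1)) * (H `^ (p / (p - 1)) * v).
Proof.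
move=> p1 l0 F0 H0 v0 uE.
have q0 : 0 < p - 1 by rewrite subr_gt0.
have q0' : p - 1 != 0 by rewrite gt_eqF.
have u0 : 0 < u by rewrite uE powR_gt0.
have [le|lt] := leP H (l * (F `^ (p - 1) * u)).
  apply: (@le_trans _ _ (l * (F `^ p * u))).
    rewrite -(mulr_powRB1 (ltW F0) (lt_trans ltr01 p1)).
    by apply: (le_trans (ler_wpM2l (ltW F0) le)); rewrite le_eqVlt; apply/orP; left; apply/eqP; ring.
  by rewrite lerDl !mulr_ge0 ?powR_ge0 ?(ltW v0).
apply: (@le_trans _ _ (l `^ (1 - p / (p - 1)) * (H `^ (p / (p - 1)) * v))); last first.
  by rewrite lerDr !mulr_ge0 ?powR_ge0 ?(ltW u0) ?(ltW l0).
have -> : 1 - p / (p - 1) = - (p - 1)^-1 by field.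
have -> : p / (p - 1) = 1 + (p - 1)^-1 by field.
rewrite powRD; last by apply/implyP => _; rewrite gt_eqF.
rewrite powRr1 ?(ltW H0)// powRN -invr_powR ?(ltW l0)//.
have -> : v = u^-1 `^ (p - 1)^-1.
  by rewrite uE -powRN opprB powRK// ltW.
suff : F <= l^-1 `^ (p - 1)^-1 * H `^ (p - 1)^-1 * u^-1 `^ (p - 1)^-1.
  move=> /(ler_wpM2r (ltW H0)) /le_trans; apply.
  by rewrite le_eqVlt; apply/orP; left; apply/eqP; ring.
rewrite -!powRM ?mulr_ge0 ?invr_ge0 ?(ltW l0) ?(ltW H0) ?(ltW u0)//.
rewrite -[leLHS](powRK q0' (ltW F0)); apply: ler_powR_ge0.
- by rewrite invr_ge0 ltW.
- exact: powR_ge0.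
- by rewrite ler_pdivlMr// ler_pdivlMl// ltW.
Qed.

Lemma le_poweR_split (g : \bar R) (F a p : R) : 1 < p -> (0 <= g)%E -> 0 < F -> 0 < a ->
  (g <= (a `^ (1 - p))%:E * (g `^ p * (F `^ (1 - p))%:E) + (a * F)%:E)%E.
Proof.
move=> p1; have pgt0 : 0 < p by rewrite (lt_trans ltr01).
case: g => [g| |]// g0 F0 a0; last first.
  rewrite poweRyr ?gt_eqF// gt0_mulye ?lte_fin ?powR_gt0//.
  by rewrite gt0_muley ?lte_fin ?powR_gt0.
rewrite poweR_EFin -!EFinM -EFinD lee_fin; rewrite lee_fin in g0.
have aF0 : 0 < a * F by rewrite mulr_gt0.
have [le|lt] := leP g (a * F).
  by rewrite (le_trans le)// lerDr !mulr_ge0 ?powR_ge0.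
have gt0 : 0 < g by exact: lt_trans lt.
rewrite (@le_trans _ _ (a `^ (1 - p) * (g `^ p * F `^ (1 - p))))//; last first.
  by rewrite lerDl ltW.
have -> : a `^ (1 - p) * (g `^ p * F `^ (1 - p)) = g `^ p * (a * F) `^ (1 - p).
  by rewrite [(a * F) `^ _]powRM ?(ltW a0) ?(ltW F0)//; ring.
rewrite -{1}(powRr1 g0) -{1}[1](subrKC p) powRD; last first.
  by apply/implyP => _; rewrite gt_eqF.
apply: ler_wpM2l; first exact: powR_ge0.
apply: le0_ler_powR => //; first by rewrite subr_le0 ltW.
exact: ltW.
Qed.

End pointwise_inequalities.

(** * Extrapolation *)

Section extrapolation.
Context d (T : measurableType d) (R : realType) (mu : {measure set T -> \bar R}).
Variables (Q : nat -> set T) (s : nat -> nat) (r : nat -> R) (k : R).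
Hypothesis BQ : dilation_basis mu Q s r k.

Let mQ i : measurable (Q i). Proof. exact: (basis_measurable BQ). Qed.

Definition maxop_norm (p K : R) : R := Num.max 1 (muckenhoupt_const k p K).

Lemma maxop_norm_ge1 p K : 1 <= maxop_norm p K.
Proof. by rewrite le_max lexx. Qed.

Lemma maxop_bounded p K u v : 1 < p -> 0 <= K -> muckenhoupt_pair mu Q p K u v ->
  forall f : T -> \bar R, measurable_fun setT f -> (forall x, 0 <= f x)%E ->
  (\int[mu]_x (maxop mu Q (fun=> 1%R) f x `^ p * (u x)%:E) <=
   (maxop_norm p K `^ p)%:E * \int[mu]_x (f x `^ p * (u x)%:E))%E.
Proof.
move=> p1 K0 H f mf f0.
apply: (le_trans (muckenhoupt_theorem BQ p1 K0 H mf f0)); apply: lee_wpmul2r.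
  apply: integral_ge0 => x _; rewrite mule_ge0 ?poweR_ge0// lee_fin ltW//.
  exact: (weight_gt0 (muckenhoupt_weight H)).
rewrite lee_fin (@le_trans _ _ (maxop_norm p K))//.
  by rewrite le_max lexx orbT.
exact: le1r_powR (maxop_norm_ge1 _ _) (ltW p1).
Qed.

Variables (p p0 K : R) (u v : T -> R).
Hypotheses (p1 : 1 < p) (p01 : 1 < p0) (K0 : 0 <= K).
Hypothesis Huv : muckenhoupt_pair mu Q p K u v.

Let p' := p / (p - 1).

Definition extrapolation_level : R :=
  (4 * maxop_norm p K) `^ (p0 - 1) *
  (4 * maxop_norm p' (K `^ (p - 1)^-1)).

Let pgt0 : 0 < p. Proof. exact: lt_trans p1. Qed.
Let q0 : 0 < p - 1. Proof. by rewrite subr_gt0. Qed.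
Let q0' : p - 1 != 0. Proof. by rewrite gt_eqF. Qed.
Let p0gt0 : 0 < p0. Proof. exact: lt_trans p01. Qed.
Let p'1 : 1 < p'. Proof. by rewrite ltr_pdivlMr// mul1r gtrBl. Qed.
Let p'gt0 : 0 < p'. Proof. exact: lt_trans p'1. Qed.
Let Pu := muckenhoupt_weight Huv.
Let Pv := muckenhoupt_dual_weight Huv.
Let u0 x : 0 < u x. Proof. exact: (weight_gt0 Pu). Qed.
Let v0 x : 0 < v x. Proof. exact: (weight_gt0 Pv). Qed.
Let mu_ : measurable_fun setT u. Proof. exact: (weight_measurable Pu). Qed.
Let mv : measurable_fun setT v. Proof. exact: (weight_measurable Pv). Qed.
Let Hvu : muckenhoupt_pair mu Q p' (K `^ (p - 1)^-1) v u.
Proof. exact: (muckenhoupt_dual BQ p1 K0 Huv). Qed.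

Local Open Scope ereal_scope.

Let mpow (e : R) (g : T -> \bar R) (w : T -> R) : measurable_fun setT g ->
  measurable_fun setT w -> measurable_fun setT (fun x => g x `^ e * (w x)%:E).
Proof.
move=> mg mw; apply: emeasurable_funM; last exact/measurable_EFinP.
exact: measurableT_comp (measurable_poweR _) mg.
Qed.

Lemma extrapolation_core (f h : T -> \bar R) (Phi Psi : R) :
  measurable_fun setT f -> (forall x, 0 <= f x) ->
  measurable_fun setT h -> (forall x, 0 <= h x) ->
  (0 < Phi)%R -> \int[mu]_x (f x `^ p * (u x)%:E) <= Phi%:E ->
  (0 < Psi)%R -> \int[mu]_x (h x `^ p' * (v x)%:E) <= Psi%:E ->
  exists w sigma, [/\ muckenhoupt_pair mu Q p0 extrapolation_level w sigma,
    \int[mu]_x (f x `^ p0 * (w x)%:E) < +oo &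
    forall (g : T -> \bar R) (a l : R), measurable_fun setT g ->
      (forall x, 0 <= g x) -> (0 < a)%R -> (0 < l)%R ->
      \int[mu]_x (g x `^ p0 * (w x)%:E) <=
        (a `^ p0)%:E * \int[mu]_x (f x `^ p0 * (w x)%:E) ->
      \int[mu]_x (g x * h x) <=
        (2 * a * (l * (2 `^ p * 4 * Phi) + l `^ (1 - p') * (2 `^ p' * 4 * Psi)))%:E].
Proof.
move=> mf f0 mh h0 Phi0 fPhi Psi0 hPsi.
have [F [AF fF intF]] := A1_majorant_exists BQ p1 (maxop_norm_ge1 p K) Pu
  (maxop_bounded p1 K0 Huv) mf f0 Phi0 fPhi.
have [H [AH hH intH]] := A1_majorant_exists BQ p'1 (maxop_norm_ge1 p' _) Pv
  (maxop_bounded p'1 (powR_ge0 _ _) Hvu) mh h0 Psi0 hPsi.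
have C0 q L : (0 < 4 * maxop_norm q L)%R.
  by rewrite mulr_gt0// (lt_le_trans _ (maxop_norm_ge1 _ _)).
have HW := A1_muckenhoupt BQ p01 (C0 _ _) (C0 _ _) AF AH.
have F0 := weight_gt0 (A1_weight AF); have H0 := weight_gt0 (A1_weight AH).
have mF := weight_measurable (A1_weight AF); have mH := weight_measurable (A1_weight AH).
set w := fun x => _ in HW; set sigma := fun x => _ in HW.
have mw := weight_measurable (muckenhoupt_weight HW).
have w0 := weight_gt0 (muckenhoupt_weight HW).
have wFH x : ((F x) `^ p0 * w x = F x * H x)%R.
  rewrite /w mulrA -powRD ?subrKC ?powRr1 ?(ltW (F0 x))//.
  by rewrite oner_eq0.
have mFH : measurable_fun setT (fun x => (F x * H x)%:E).
  by apply/measurable_EFinP; exact: measurable_funM.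
have FH0 x : 0 <= (F x * H x)%:E by rewrite lee_fin mulr_ge0// ltW.
have fw_le : \int[mu]_x (f x `^ p0 * (w x)%:E) <= \int[mu]_x (F x * H x)%:E.
  apply: ae_ge0_le_integral => //.
  - by move=> x _; rewrite mule_ge0 ?poweR_ge0// lee_fin ltW.
  - exact: mpow.
  - apply: filterS fF => x fF _; rewrite -wFH (EFinM (F x `^ p0)); apply: lee_wpmul2r.
      by rewrite lee_fin ltW.
    by rewrite -poweR_EFin; apply: lee_poweR => //; exact: ltW.
have FH_le (l : R) : (0 < l)%R -> \int[mu]_x (F x * H x)%:E <=
    (l * (2 `^ p * 4 * Phi) + l `^ (1 - p') * (2 `^ p' * 4 * Psi))%:E.
  move=> l0.
  have mFp : measurable_fun setT (fun x => (F x `^ p * u x)%:E).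
    apply/measurable_EFinP; apply: measurable_funM => //.
    exact: measurableT_comp (measurable_powR _) mF.
  have mHp : measurable_fun setT (fun x => (H x `^ p' * v x)%:E).
    apply/measurable_EFinP; apply: measurable_funM => //.
    exact: measurableT_comp (measurable_powR _) mH.
  have Fp0 x : 0 <= (F x `^ p * u x)%:E by rewrite lee_fin mulr_ge0 ?powR_ge0 ?(ltW (u0 x)).
  have Hp0 x : 0 <= (H x `^ p' * v x)%:E by rewrite lee_fin mulr_ge0 ?powR_ge0 ?(ltW (v0 x)).
  have l'0 : (0 <= l `^ (1 - p'))%R by exact: powR_ge0.
  apply: (@le_trans _ _ (\int[mu]_x (l%:E * (F x `^ p * u x)%:E +
      (l `^ (1 - p'))%:E * (H x `^ p' * v x)%:E))).
    apply: ge0_le_integral => //.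
      by apply: emeasurable_funD; exact: measurable_funeM.
    move=> x _; rewrite -!EFinM -EFinD lee_fin.
    exact: le_mul_powR (muckenhoupt_dualE Huv x).
  rewrite ge0_integralD//; last 4 first.
  - by move=> x _; rewrite mule_ge0// lee_fin ltW.
  - exact: measurable_funeM.
  - by move=> x _; rewrite mule_ge0.
  - exact: measurable_funeM.
  rewrite !ge0_integralZl ?lee_fin ?(ltW l0)//.
  rewrite EFinD !(EFinM l) (EFinM (l `^ _)); apply: leeD; apply: lee_wpmul2l => //.
  by rewrite lee_fin ltW.
exists w, sigma; split => //.
  by apply: (le_lt_trans fw_le); apply: (le_lt_trans (FH_le 1%R ltr01)); exact: ltry.
move=> g a l mg g0 a0 l0 gf.
have mgw := mpow p0 mg mw.
have gw0 x : 0 <= g x `^ p0 * (w x)%:E by rewrite mule_ge0 ?poweR_ge0// lee_fin ltW.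
have a'0 : (0 <= a `^ (1 - p0))%R by exact: powR_ge0.
apply: (@le_trans _ _ (\int[mu]_x ((a `^ (1 - p0))%:E * (g x `^ p0 * (w x)%:E) +
    a%:E * (F x * H x)%:E))).
  apply: ae_ge0_le_integral => //.
  - by move=> x _; rewrite mule_ge0.
  - exact: emeasurable_funM.
  - by move=> x _; rewrite adde_ge0// mule_ge0// lee_fin ltW.
  - by apply: emeasurable_funD; exact: measurable_funeM.
  - apply: filterS hH => x hH _.
    apply: (le_trans (lee_wpmul2l (g0 x) hH)).
    have H0' : 0 <= (H x)%:E by rewrite lee_fin ltW.
    apply: (le_trans (lee_wpmul2r H0' (le_poweR_split p01 (g0 x) (F0 x) a0))).
    rewrite ge0_muleDl//; last 2 first.
    - by rewrite !mule_ge0 ?poweR_ge0// lee_fin powR_ge0.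
    - by rewrite lee_fin mulr_ge0// ltW.
    by rewrite /w -!muleA -!EFinM -!mulrA.
rewrite ge0_integralD//; last 4 first.
- by move=> x _; rewrite mule_ge0.
- exact: measurable_funeM.
- by move=> x _; rewrite mule_ge0// lee_fin ltW.
- exact: measurable_funeM.
rewrite !ge0_integralZl ?lee_fin ?(ltW a0)//.
apply: (@le_trans _ _ ((2 * a)%:E * \int[mu]_x (F x * H x)%:E)); last first.
  rewrite (EFinM (2 * a)); apply: lee_wpmul2l; last exact: FH_le.
  by rewrite lee_fin mulr_ge0// ltW.
have -> : ((2 * a) = a + a)%R by ring.
rewrite EFinD ge0_muleDl ?lee_fin ?(ltW a0)//; apply: leeD => //.
apply: (le_trans (lee_wpmul2l _ gf)) => //.
rewrite muleA -EFinM -powRD; last by apply/implyP => _; rewrite gt_eqF.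
rewrite subrK powRr1 ?(ltW a0)//; apply: lee_wpmul2l => //; by rewrite lee_fin ltW.
Qed.

Lemma extrapolation_weight (f : T -> \bar R) (Phi : R) :
  measurable_fun setT f -> (forall x, 0 <= f x) ->
  (0 < Phi)%R -> \int[mu]_x (f x `^ p * (u x)%:E) <= Phi%:E ->
  exists w sigma, muckenhoupt_pair mu Q p0 extrapolation_level w sigma /\
    \int[mu]_x (f x `^ p0 * (w x)%:E) < +oo.
Proof.
move=> mf f0 Phi0 fPhi.
have int0 : \int[mu]_x ((cst 0 : T -> \bar R) x `^ p' * (v x)%:E) <= 1%:E.
  under eq_integral do rewrite /= powR0 ?gt_eqF// mul0e.
  by rewrite integral0 lee_fin.
have [w [sigma [Hw fw _]]] := extrapolation_core mf f0 (measurable_cst _)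
  (fun x => lexx 0) Phi0 fPhi ltr01 int0.
by exists w, sigma.
Qed.

Definition extrapolation_const : R :=
  4 * (2 `^ p * 4) * (4 * (2 `^ p' * 4)) `^ (p - 1).

Lemma extrapolation_bound_lty (f g : T -> \bar R) (Phi a : R) :
  measurable_fun setT f -> (forall x, 0 <= f x) ->
  measurable_fun setT g -> (forall x, 0 <= g x) ->
  (0 < Phi)%R -> \int[mu]_x (f x `^ p * (u x)%:E) <= Phi%:E -> (0 < a)%R ->
  (forall w sigma, muckenhoupt_pair mu Q p0 extrapolation_level w sigma ->
    \int[mu]_x (g x `^ p0 * (w x)%:E) <=
    (a `^ p0)%:E * \int[mu]_x (f x `^ p0 * (w x)%:E)) ->
  \int[mu]_x (g x `^ p * (u x)%:E) < +oo ->
  \int[mu]_x (g x `^ p * (u x)%:E) <= (extrapolation_const * a `^ p * Phi)%:E.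
Proof.
move=> mf f0 mg g0 Phi0 fPhi a0 gf goo.
set c1 := (2 `^ p * 4)%R; set c2 := (2 `^ p' * 4)%R.
have c10 : (0 < c1)%R by rewrite mulr_gt0// powR_gt0.
have c20 : (0 < c2)%R by rewrite mulr_gt0// powR_gt0.
have gpu0 x : 0 <= g x `^ p * (u x)%:E.
  by rewrite mule_ge0 ?poweR_ge0// lee_fin ltW.
have gE : \int[mu]_x (g x `^ p * (u x)%:E) =
    (fine (\int[mu]_x (g x `^ p * (u x)%:E)))%:E.
  by rewrite fineK// ge0_fin_numE// integral_ge0.
rewrite gE; have : (0 <= fine (\int[mu]_x (g x `^ p * (u x)%:E)))%R.
  by apply: fine_ge0; exact: integral_ge0.
rewrite le_eqVlt => /predU1P[<-|].
  rewrite lee_fin /extrapolation_const !mulr_ge0 ?powR_ge0 ?(ltW Phi0)//.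
move: gE; set G := fine _ => gE G0.
pose h x := g x `^ (p - 1) * (u x)%:E.
have h0 x : 0 <= h x by rewrite mule_ge0 ?poweR_ge0// lee_fin ltW.
have mh : measurable_fun setT h by exact: mpow.
have ghE x : g x * h x = g x `^ p * (u x)%:E.
  rewrite /h muleA -{1}(poweRe1 (g0 x)) -poweRD ?subrKC//.
  by rewrite poweRD_defE subrKC gt_eqF.
have hpE x : h x `^ p' * (v x)%:E = g x `^ p * (u x)%:E.
  rewrite /h poweRM ?poweR_ge0 ?lee_fin ?(ltW (u0 x))//.
  rewrite -poweRrM /p' mulrCA divff// mulr1 -muleA; congr (_ * _).
  rewrite poweR_EFin -EFinM; congr EFin.
  rewrite (muckenhoupt_dualE Hvu) -powRD ?subrKC ?powRr1 ?(ltW (u0 x))//.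
  by rewrite oner_eq0.
have hG : \int[mu]_x (h x `^ p' * (v x)%:E) <= G%:E.
  by under eq_integral do rewrite hpE; rewrite gE.
have [w [sigma [Hw fw H]]] := extrapolation_core mf f0 mh h0 Phi0 fPhi G0 hG.
pose l := ((4 * a * c2) `^ (p - 1))%R.
have l0 : (0 < l)%R by rewrite powR_gt0// !mulr_gt0.
have := H g a l mg g0 a0 l0 (gf _ _ Hw).
under eq_integral do rewrite ghE.
rewrite gE !lee_fin.
have -> : (l `^ (1 - p') = (4 * a * c2)^-1)%R.
  rewrite /l -powRrM (_ : ((p - 1) * (1 - p') = -1)%R); last by rewrite /p'; field.
  by rewrite powR_inv1// !mulr_ge0// ltW.
have -> : (2 * a * (l * (c1 * Phi) + (4 * a * c2)^-1 * (c2 * G)) =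
    2 * a * l * c1 * Phi + G / 2)%R by field; rewrite !gt_eqF.
have -> : (extrapolation_const * a `^ p * Phi = 2 * (2 * a * l * c1 * Phi))%R.
  rewrite /extrapolation_const /l -/c1 -/c2 -(mulr_powRB1 (ltW a0) pgt0).
  have -> : (4 * a * c2 = (4 * c2) * a)%R by ring.
  by rewrite [((4 * c2 * a) `^ _)%R]powRM ?mulr_ge0 ?(ltW a0) ?(ltW c20)//; ring.
lra.
Qed.

Lemma extrapolation_bound (f g : T -> \bar R) (Phi a : R) :
  measurable_fun setT f -> (forall x, 0 <= f x) ->
  measurable_fun setT g -> (forall x, 0 <= g x) ->
  (0 < Phi)%R -> \int[mu]_x (f x `^ p * (u x)%:E) <= Phi%:E -> (0 < a)%R ->
  (forall w sigma, muckenhoupt_pair mu Q p0 extrapolation_level w sigma ->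
    \int[mu]_x (g x `^ p0 * (w x)%:E) <=
    (a `^ p0)%:E * \int[mu]_x (f x `^ p0 * (w x)%:E)) ->
  \int[mu]_x (g x `^ p * (u x)%:E) <= (extrapolation_const * a `^ p * Phi)%:E.
Proof.
move=> mf f0 mg g0 Phi0 fPhi a0 gf.
pose E n := \big[setU/set0]_(i <- iota 0 n) Q i.
have mE n : measurable (E n) by apply: bigsetU_measurable.
pose gn n x := mine (g x) n%:R%:E * (\1_(E n) x)%:E.
have min0 n x : 0 <= mine (g x) n%:R%:E by rewrite le_min g0 lee_fin ler0n.
have gn0 n x : 0 <= gn n x by rewrite mule_ge0// lee_fin.
have mind n : measurable_fun setT (fun x => (\1_(E n) x)%:E : \bar R).
  by apply/measurable_EFinP; exact: measurable_indic.
have mgn n : measurable_fun setT (gn n).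
  by apply: emeasurable_funM => //; exact: measurable_mine.
have gng n x : gn n x <= g x.
  rewrite /gn indicE; case: (_ \in _); rewrite ?mule1 ?mule0//.
  by rewrite ge_min lexx.
have uE0 x : 0 <= (u x)%:E by rewrite lee_fin ltW.
have muE : measurable_fun setT (EFin \o u) by exact/measurable_EFinP.
have gn_bound n : \int[mu]_x (gn n x `^ p * (u x)%:E) <=
    (extrapolation_const * a `^ p * Phi)%:E.
  apply: (extrapolation_bound_lty mf f0 (mgn n) (gn0 n) Phi0 fPhi a0).
    move=> w sigma Hw; apply: le_trans (gf _ _ Hw).
    have mw := weight_measurable (muckenhoupt_weight Hw).
    have w0 := weight_gt0 (muckenhoupt_weight Hw).
    apply: ge0_le_integral => //.
    - by move=> x _; rewrite mule_ge0 ?poweR_ge0// lee_fin ltW.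
    - exact: mpow.
    - exact: mpow.
    - move=> x _; apply: lee_wpmul2r; first by rewrite lee_fin ltW.
      exact: lee_poweR (ltW p0gt0) (gn0 n x) (gng n x).
  apply: (@le_lt_trans _ _ (\int[mu]_x ((n%:R `^ p)%:E * ((u x)%:E * (\1_(E n) x)%:E)))).
    apply: ge0_le_integral => //.
    - by move=> x _; rewrite mule_ge0 ?poweR_ge0.
    - exact: mpow.
    - by apply: measurable_funeM; exact: emeasurable_funM.
    - move=> x _; rewrite /gn indicE; case: (_ \in _); last first.
        by rewrite !mule0 poweR0r ?gt_eqF// mul0e.
      rewrite !mule1; apply: lee_wpmul2r => //; rewrite -poweR_EFin.
      apply: lee_poweR; first exact: ltW.
        exact: min0.
      by rewrite ge_min lexx orbT.
  rewrite ge0_integralZl//; last 2 first.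
  - exact: emeasurable_funM.
  - by move=> x _; rewrite mule_ge0// lee_fin.
  rewrite integral_indicM// lte_mul_pinfty ?lee_fin ?powR_ge0//.
  apply: (le_lt_trans (ge0_integral_bigsetU_le mu (iota 0 n) mQ muE uE0)).
  by apply: lte_sum_pinfty => i _; exact: (weight_lty Pu).
have nd x : nondecreasing_seq (fun n => gn n x `^ p * (u x)%:E).
  move=> i j ij; apply: lee_wpmul2r => //; apply: lee_poweR => //; first exact: ltW.
  have Eij : E i `<=` E j.
    move=> y; rewrite /E -!bigcup_seq => -[l /=]; rewrite mem_iota /= add0n => li Ql.
    by exists l => //=; rewrite mem_iota/= add0n (leq_trans li).
  rewrite /gn !indicE; case: (boolP (x \in E i)) => [/set_mem/Eij xj|_].
    rewrite mem_set// !mule1; case: (leP (g x) i%:R%:E) => gi.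
      by rewrite le_min lexx (le_trans gi)// lee_fin ler_nat.
    by rewrite le_min (ltW gi) lee_fin ler_nat.
  by rewrite mule0 mule_ge0// lee_fin.
have mgnp n : measurable_fun setT (fun x => gn n x `^ p * (u x)%:E) by exact: mpow.
have gnp0 n x : setT x -> 0 <= gn n x `^ p * (u x)%:E.
  by move=> _; rewrite mule_ge0// poweR_ge0.
have cv x : cvgn (fun n => gn n x `^ p * (u x)%:E) by exact: ereal_nondecreasing_is_cvgn.
have mlim : measurable_fun setT (fun x => limn (fun n => gn n x `^ p * (u x)%:E)).
  by apply: (@emeasurable_fun_cvg _ _ _ _ (fun n x => gn n x `^ p * (u x)%:E)) => // x _; exact: cv.
have le_lim n x : gn n x `^ p * (u x)%:E <= limn (fun n => gn n x `^ p * (u x)%:E).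
  rewrite (cvg_lim _ (ereal_nondecreasing_cvgn (nd x)))//.
  by apply: ereal_sup_ubound; exists n.
apply: (@le_trans _ _ (\int[mu]_x limn (fun n => gn n x `^ p * (u x)%:E))).
  apply: ge0_le_integral => //.
  - by move=> x _; rewrite mule_ge0 ?poweR_ge0.
  - exact: mpow.
  - move=> x _.
    set L := limn _; have L0 : 0 <= L by exact: le_trans (gnp0 0%N x Logic.I) (le_lim _ _).
    have ui0 : 0 <= (u x)^-1%:E by rewrite lee_fin invr_ge0 ltW.
    have Lu : L = (L * (u x)^-1%:E) * (u x)%:E.
      by rewrite -muleA -EFinM mulVf ?mule1// gt_eqF.
    set t := (L * (u x)^-1%:E) `^ p^-1.
    have gnt n : gn n x <= t.
      rewrite -(poweRK (lt0r_neq0 pgt0) (gn0 n x)); apply: lee_poweR.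
      - by rewrite invr_ge0 ltW.
      - exact: poweR_ge0.
      - have := lee_wpmul2r ui0 (le_lim n x).
        by rewrite -muleA -EFinM divff ?mule1// gt_eqF.
    have [j [Qj _]] := basis_directed BQ 0%N x.
    have gt n : (j < n)%N -> mine (g x) n%:R%:E <= t.
      move=> jn; have := gnt n; rewrite /gn indicE mem_set ?mule1//.
      by rewrite /E -bigcup_seq; exists j => //=; rewrite mem_iota.
    have gxt : g x <= t.
      have := g0 x; case gx : (g x) => [y| |]// y0.
        have := gt (maxn j.+1 (Num.bound y)); rewrite leq_maxl gx => /(_ isT).
        rewrite min_l// lee_fin ltW// (lt_le_trans (archi_boundP _))//.
        by rewrite ler_nat leq_maxr.
      rewrite leye_eq; apply/eqP/eqyP => B B0.
      have := gt (maxn j.+1 (Num.bound B)); rewrite leq_maxl gx => /(_ isT).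
      rewrite min_r ?leey//; apply: le_trans; rewrite lee_fin ltW//.
      by rewrite (lt_le_trans (archi_boundP (ltW B0)))// ler_nat leq_maxr.
    rewrite Lu; apply: lee_wpmul2r => //.
    rewrite -(poweRVK (lt0r_neq0 pgt0) (mule_ge0 L0 ui0)).
    exact: lee_poweR (ltW pgt0) (g0 x) gxt.
rewrite monotone_convergence//.
apply: lime_le.
  apply: ereal_nondecreasing_is_cvgn => i j ij.
  by apply: ge0_le_integral => // [x|x _]; [exact: gnp0|exact: (nd x _ _ ij)].
by apply: nearW.
Qed.

End extrapolation.

(** * Cubes with rational data *)

Section rational_cubes.
Context (R : realType) (d : nat).
Implicit Types (a x : 'rV[R]_d) (l : R).

Local Notation mu := (lebesgue_row R d).

Lemma measurable_cube a l : measurable (cube a l).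
Proof.
rewrite (_ : cube a l = \bigcap_(i in [set: 'I_d])
    (@row_coord R d i @^-1` `[a ord0 i, a ord0 i + l])).
  apply: fin_bigcap_measurable => // i _.
  by rewrite -[X in measurable X]setTI; apply: measurable_row_coord.
apply/seteqP; split => x /=.
  by move=> h i _ /=; rewrite in_itv/=; exact: h.
by move=> h i; have := h i Logic.I; rewrite /= in_itv.
Qed.

Lemma lebesgue_cube a l : 0 <= l -> mu (cube a l) = (l ^+ d)%:E.
Proof.
move=> l0; have := lebesgue_row_box a (\row_i (a ord0 i + l)).
have -> : [set x : 'rV[R]_d | forall i, a ord0 i <= x ord0 i <= (\row_i (a ord0 i + l)) ord0 i]
    = cube a l.
  by apply/seteqP; split => x /= h i; have := h i; rewrite mxE.
move=> ->; congr EFin.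
under eq_bigr do rewrite mxE addrAC subrr add0r (max_r l0).
by rewrite prodr_const card_ord.
Qed.

Definition rat_side (l : rat) : rat := if 0 < l then l else 1.

Lemma rat_side_gt0 (l : rat) : 0 < rat_side l.
Proof. by rewrite /rat_side; case: ifP. Qed.

Definition rat_cube_index (n : nat) : 'rV[rat]_d * rat := odflt (0, 1) (unpickle n).

Definition rat_cube_side (n : nat) : R := ratr (rat_side (rat_cube_index n).2).

Definition rat_cube (n : nat) : set 'rV[R]_d :=
  cube (map_mx ratr (rat_cube_index n).1) (rat_cube_side n).

Definition rat_cube_dilate (n : nat) : nat :=
  let l := rat_side (rat_cube_index n).2 in
  pickle ((rat_cube_index n).1 - const_mx l, 3 * l).

Lemma rat_cube_side_gt0 n : 0 < rat_cube_side n.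
Proof. by rewrite ltr0q rat_side_gt0. Qed.

Lemma rat_cube_pickle (a : 'rV[rat]_d) (l : rat) : 0 < l ->
  rat_cube (pickle (a, l)) = cube (map_mx ratr a) (ratr l).
Proof.
by move=> l0; rewrite /rat_cube /rat_cube_side /rat_cube_index pickleK /= /rat_side l0.
Qed.

Lemma rat_cube_dilateE n : rat_cube (rat_cube_dilate n) =
  cube (\row_i (ratr ((rat_cube_index n).1 ord0 i) - rat_cube_side n))
    (3 * rat_cube_side n).
Proof.
rewrite rat_cube_pickle; last by rewrite mulr_gt0// rat_side_gt0.
congr cube; last by rewrite rmorphM/= ratr_nat.
by apply/rowP => i; rewrite !mxE rmorphB.
Qed.

Lemma lebesgue_rat_cube n : mu (rat_cube n) = (rat_cube_side n ^+ d)%:E.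
Proof. by rewrite lebesgue_cube// ltW// rat_cube_side_gt0. Qed.

Lemma bounded_sub_rat_cube (c : 'I_d -> R) : exists n,
  [set x : 'rV[R]_d | forall i, `|x ord0 i| <= c i] `<=` rat_cube n.
Proof.
pose b := (Num.bound (\sum_i `|c i|)).+1.
have cb i : c i <= b%:R.
  apply: (le_trans (ler_norm _)); apply: (@le_trans _ _ (\sum_i `|c i|)).
    by rewrite (bigD1 i)//= lerDl sumr_ge0.
  have s0 : 0 <= \sum_i `|c i| by exact: sumr_ge0.
  by rewrite (le_trans (ltW (archi_boundP s0)))// ler_nat.
exists (pickle (const_mx (- b%:R : rat) : 'rV[rat]_d, 2 * b%:R : rat)) => x /= xc.
rewrite rat_cube_pickle ?mulr_gt0 ?ltr0n// => i; rewrite !mxE.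
rewrite rmorphM rmorphN/= !ratr_nat.
have := le_trans (xc i) (cb i); rewrite ler_norml => /andP[h1 h2].
by rewrite h1/= mulr_natl mulr2n addrA addNr add0r.
Qed.

Lemma cube_sub_rat_cube a l : 0 < l -> exists n,
  cube a l `<=` rat_cube n /\ rat_cube_side n <= 3 * l.
Proof.
move=> l0.
have ltl : 2 * l < 3 * l by rewrite ltr_pM2r// ltr_nat.
have [l' ll'] := rat_in_itvoo ltl; rewrite in_itv/= in ll'.
have /andP[l'1 l'2] := ll'.
have l'0 : 0 < l'.
  by rewrite -(ltr0q R) (lt_trans _ l'1)// mulr_gt0.
have ha i : exists y : rat, a ord0 i - l < ratr y < a ord0 i.
  have h : a ord0 i - l < a ord0 i by rewrite gtrBl.
  by have [y] := rat_in_itvoo h; rewrite in_itv/= => ?; exists y.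
have [y yP] := choice ha.
exists (pickle (\row_i y i, l')); split; last first.
  by rewrite /rat_cube_side /rat_cube_index pickleK/= /rat_side l'0 ltW.
rewrite rat_cube_pickle// => x /= xQ i; rewrite !mxE.
have /andP[x1 x2] := xQ i; have /andP[y1 y2] := yP i.
apply/andP; split; lra.
Qed.

Lemma rat_cube_basis :
  dilation_basis mu rat_cube rat_cube_dilate rat_cube_side (3 ^+ d).
Proof.
have side_gt0 := rat_cube_side_gt0.
have muE i : (mu : {measure set 'rV[R]_d -> \bar R}) (rat_cube i) = (rat_cube_side i ^+ d)%:E.
  exact: lebesgue_rat_cube.
split.
- by move=> i; exact: measurable_cube.
- by move=> i; rewrite muE lte_fin exprn_gt0.
- by move=> i; rewrite muE ltry.
- move=> i j [x [xi xj]] ij y yi; rewrite rat_cube_dilateE => t.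
  have /andP[] := xi t; have /andP[] := xj t; have /andP[] := yi t.
  rewrite !mxE -!/(rat_cube_side _).
  have := ij; have := side_gt0 i => i0 ij1 y1 y2 xj1 xj2 xi1 xi2.
  by apply/andP; split; lra.
- move=> i; rewrite !muE -EFinM -exprMn /rat_cube_side /rat_cube_index /rat_cube_dilate.
  rewrite pickleK/= /rat_side mulr_gt0//; last by case: ifP.
  by rewrite rmorphM/= ratr_nat.
- move=> i x.
  have [n nP] := bounded_sub_rat_cube (fun t => `|x ord0 t| +
    `|(ratr ((rat_cube_index i).1 ord0 t) : R)| + rat_cube_side i).
  exists n; split.
    by apply: nP => t; rewrite -addrA lerDl addr_ge0// ltW.
  move=> y yi; apply: nP => t.
  have /andP[] := yi t; rewrite mxE => y1 y2.
  set aa := ratr _ in y1 y2 *.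
  have h := ler_normD (y ord0 t - aa) aa; rewrite subrK in h; apply: (le_trans h).
  have : `|y ord0 t - aa| <= rat_cube_side i.
    rewrite ger0_norm ?subr_ge0//; rewrite -/(rat_cube_side i) in y2; lra.
  have := normr_ge0 (x ord0 t); lra.
Qed.

End rational_cubes.

Lemma ge0_subset_integral_any d (T : measurableType d) (R : realType)
    (mu : {measure set T -> \bar R}) (A B : set T) (f : T -> \bar R) :
  (forall x, (0 <= f x)%E) -> A `<=` B ->
  (\int[mu]_(x in A) f x <= \int[mu]_(x in B) f x)%E.
Proof.
move=> f0 AB; rewrite !ge0_integralE//.
apply: le_ereal_sup => _ [h /= hA <-]; exists h => // x.
apply: (le_trans (hA x)); rewrite !patchE.
case: ifPn => [/set_mem/AB xB|_]; first by rewrite mem_set.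
by case: ifP.
Qed.

Section Ap_bridge.
Context (R : realType) (d : nat).
Implicit Types (a x : 'rV[R]_d) (l : R).

Local Notation mu := (lebesgue_row R d : {measure set 'rV[R]_d -> \bar R}).

Lemma compact_cube a l : compact (cube a l).
Proof.
have := @rV_compact R d (fun i => `[a ord0 i, a ord0 i + l]%classic)
  (fun i => @segment_compact _ _ _).
by rewrite (_ : [set v : 'rV[R]_d | _] = cube a l).
Qed.

Lemma compact_sub_rat_cube (K : set 'rV[R]_d) : compact K ->
  exists n, K `<=` @rat_cube R d n.
Proof.
move=> cK.
have H (i : 'I_d) : exists c : R, forall x, K x -> `|x ord0 i| <= c.
  have cfK : compact [set (x : 'rV[R]_d) ord0 i | x in K].
    apply: continuous_compact => //; apply: continuous_subspaceT.
    exact: coord_continuous.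
  have [M [_ MP]] := compact_bounded cfK.
  exists (M + 1) => x Kx; apply: (MP (M + 1)); first by rewrite ltrDl.
  by exists x.
have [c cP] := choice H.
have [n nP] := bounded_sub_rat_cube c.
by exists n => x Kx; apply: nP => i; exact: cP.
Qed.

Lemma average_cube a l (f : 'rV[R]_d -> \bar R) : 0 < l ->
  average (cube a l) f = (((l ^+ d)^-1)%:E * \int[mu]_(x in cube a l) f x)%E.
Proof.
move=> l0; rewrite /average lebesgue_cube ?(ltW l0)// inver.
by rewrite gt_eqF// exprn_gt0.
Qed.

Lemma rat_cubeE n : exists a l, 0 < l /\ @rat_cube R d n = cube a l.
Proof. by exists (map_mx ratr (rat_cube_index d n).1), (rat_cube_side R d n); split => //; exact: rat_cube_side_gt0. Qed.

Lemma muckenhoupt_Ap p L w sigma : 1 < p -> 0 <= L ->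
  muckenhoupt_pair mu (@rat_cube R d) p L w sigma ->
  Ap p w /\ (Ap_constant p w <= (L * (3 ^+ d) `^ p)%:E)%E.
Proof.
move=> p1 L0 H; have [Pw Ps ws HL] := H.
have q0 : 0 < p - 1 by rewrite subr_gt0.
have w0 := weight_gt0 Pw; have s0 := weight_gt0 Ps.
have mw := weight_measurable Pw; have ms := weight_measurable Ps.
have pgt0 : 0 < p by exact: lt_trans p1.
have wE0 x : (0 <= (w x)%:E)%E by rewrite lee_fin ltW.
have BQ := rat_cube_basis R d.
suff HK : (Ap_constant p w <= (L * (3 ^+ d) `^ p)%:E)%E.
  split => //; split; last exact: le_lt_trans HK (ltry _).
  split => //.
  - move=> K cK; have [n Kn] := compact_sub_rat_cube cK.
    apply: (le_lt_trans (ge0_subset_integral_any mu wE0 Kn)).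
    exact: (weight_lty Pw).
  - move=> [N [mN N0 sub]].
    have := basis_gt0 BQ 0%N; apply/negP; rewrite -leNgt -N0.
    apply: le_measure; rewrite ?inE//; first exact: (basis_measurable BQ).
    move=> x _; apply: sub => /= wx0; have := w0 x; by rewrite wx0 ltxx.
apply: ge_ereal_sup => _ [a [l [l0 ->]]].
rewrite !average_cube//.
have [n [Qn side_le]] := cube_sub_rat_cube a l0.
have dualE x : dual_weight p w x = (sigma x)%:E.
  rewrite /dual_weight gt_eqF//; congr EFin.
  by rewrite (muckenhoupt_dualE (muckenhoupt_dual BQ p1 L0 H)).
under [X in (_ * (_ * X) `^ _)%E]eq_integral do rewrite dualE.
have ld0 : 0 < l ^+ d by rewrite exprn_gt0.
have ldi0 : (0 <= ((l ^+ d)^-1)%:E :> \bar R)%E by rewrite lee_fin invr_ge0 ltW.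
have sE0 x : (0 <= (sigma x)%:E)%E by rewrite lee_fin ltW.
have le_mass (v : 'rV[R]_d -> R) : positive_weight mu (@rat_cube R d) v ->
    (((l ^+ d)^-1)%:E * \int[mu]_(x in cube a l) (v x)%:E <=
    ((l ^+ d)^-1 * mass mu (@rat_cube R d) v n)%:E)%E.
  move=> Pv; rewrite EFinM massE//; apply: lee_wpmul2l => //.
  apply: ge0_subset_integral_any => // x.
  by rewrite lee_fin ltW// (weight_gt0 Pv).
apply: (@le_trans _ _ (((l ^+ d)^-1 * mass mu (@rat_cube R d) w n)%:E *
   (((l ^+ d)^-1 * mass mu (@rat_cube R d) sigma n)%:E `^ (p - 1)))%E).
  apply: lee_pmul; [|exact: poweR_ge0|exact: le_mass|].
    by rewrite mule_ge0// integral_ge0.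
  apply: lee_poweR; [exact: ltW| |exact: le_mass].
  by rewrite mule_ge0// integral_ge0.
rewrite poweR_EFin -EFinM lee_fin.
have S0 := mass_gt0 BQ Ps n; have W0 := mass_gt0 BQ Pw n.
rewrite [X in _ * X]powRM ?invr_ge0 ?(ltW ld0) ?(ltW S0)//.
have -> : (l ^+ d)^-1 * mass mu (@rat_cube R d) w n *
    ((l ^+ d)^-1 `^ (p - 1) * mass mu (@rat_cube R d) sigma n `^ (p - 1)) =
    (mass mu (@rat_cube R d) w n * mass mu (@rat_cube R d) sigma n `^ (p - 1)) *
    ((l ^+ d)^-1 * (l ^+ d)^-1 `^ (p - 1)) by ring.
have ldi : 0 <= (l ^+ d)^-1 by rewrite invr_ge0 ltW.
rewrite mulr_powRB1// invr_powR ?(ltW ld0)// ler_pdivrMr ?powR_gt0//.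
apply: (le_trans (HL n)); rewrite -mulrA; apply: ler_wpM2l => //.
have -> : fine (mu (@rat_cube R d n)) = rat_cube_side R d n ^+ d.
  exact: (congr1 fine (lebesgue_rat_cube R d n)).
have sd0 := rat_cube_side_gt0 R d n.
rewrite -powRM ?exprn_ge0 ?(ltW l0)//; apply: ler_powR_ge0.
- exact: ltW.
- by rewrite exprn_ge0// ltW.
- rewrite -exprMn lerXn2r ?nnegrE ?(ltW sd0)// mulr_ge0 ?(ltW l0)//.
Qed.

End Ap_bridge.

Section Ap_positive.
Context (R : realType) (d : nat).
Variables (p : R) (u : 'rV[R]_d -> R).
Hypotheses (p1 : 1 < p) (Au : Ap p u).

Local Notation mu := (lebesgue_row R d : {measure set 'rV[R]_d -> \bar R}).
Local Open Scope ereal_scope.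

Let mu_ : measurable_fun setT u. Proof. by have [[]] := Au. Qed.
Let u0 x : (0 <= u x)%R. Proof. by have [[]] := Au. Qed.
Let uE0 x : 0 <= (u x)%:E. Proof. by rewrite lee_fin. Qed.
Let muE : measurable_fun setT (EFin \o u). Proof. exact/measurable_EFinP. Qed.
Let q0 : (0 < p - 1)%R. Proof. by rewrite subr_gt0. Qed.
Let BQ := rat_cube_basis R d.

Lemma Ap_cube_le a (l : R) : (0 < l)%R ->
  average (cube a l) (fun x => (u x)%:E) *
  average (cube a l) (dual_weight p u) `^ (p - 1) <= Ap_constant p u.
Proof. by move=> l0; apply: ereal_sup_ubound; exists a, l. Qed.

Lemma dual_weight_ge0 x : 0 <= dual_weight p u x.
Proof. by rewrite /dual_weight; case: ifP => // _; rewrite lee_fin powR_ge0. Qed.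

Lemma measurable_fiber0 : measurable [set x | u x = 0%R].
Proof.
rewrite (_ : [set x | _] = u @^-1` [set 0%R])//.
by rewrite -[X in measurable X]setTI; exact: mu_.
Qed.

Lemma Ap_ae_gt0 : {ae mu, forall x, (0 < u x)%R}.
Proof.
set Z := [set x | u x = 0%R]; have mZ : measurable Z := measurable_fiber0.
have mQ i : measurable (@rat_cube R d i) := basis_measurable BQ i.
suff H i : mu (Z `&` @rat_cube R d i) = 0.
  have : mu.-negligible (\bigcup_i (Z `&` @rat_cube R d i)).
    apply: negligible_bigcup => i; exists (Z `&` @rat_cube R d i); split => //.
    exact: measurableI.
  move=> [N [mN N0 sub]]; exists N; split => // x /= ux; apply: sub.
  have [j [Qj _]] := basis_directed BQ 0%N x.
  exists j => //; split => //; apply/eqP; rewrite eq_le u0 andbT leNgt; exact/negP.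
apply/eqP/negPn/negP => Zi.
have [[_ _ _ unz] Apfin] := Au; apply: unz.
have uQ j : @rat_cube R d i `<=` @rat_cube R d j ->
    mu.-negligible [set x | @rat_cube R d j x /\ u x <> 0%R].
  move=> ij; have [a [l [l0 QE]]] := rat_cubeE R d j.
  have dual_oo : \int[mu]_(x in cube a l) dual_weight p u x = +oo.
    apply/eqP; rewrite -leye_eq.
    apply: (@le_trans _ _ (\int[mu]_(x in Z `&` @rat_cube R d i) (cst +oo x))).
      rewrite integral_cst; last exact: measurableI.
      by rewrite gt0_mulye// lt0e Zi measure_ge0.
    apply: (@le_trans _ _ (\int[mu]_(x in Z `&` @rat_cube R d i) dual_weight p u x)).
      rewrite le_eqVlt; apply/orP; left; apply/eqP; apply: eq_integral => x /set_mem[Zx _].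
      by rewrite /dual_weight Zx eqxx.
    apply: ge0_subset_integral_any; first exact: dual_weight_ge0.
    by move=> x [_ /ij]; rewrite QE.
  have := le_lt_trans (Ap_cube_le a l0) Apfin.
  have ld0 : (0 < (l ^+ d)^-1)%R by rewrite invr_gt0 exprn_gt0.
  rewrite !average_cube// dual_oo gt0_muley ?lte_fin// poweRyr ?gt_eqF//.
  have : 0 <= \int[mu]_(x in cube a l) (u x)%:E by exact: integral_ge0.
  rewrite le_eqVlt => /predU1P[I0 _|Igt0].
    have : ae_eq mu (cube a l) (EFin \o u) (cst 0).
      apply/(ae_eq_integral_abs mu (measurable_cube a l)).
        exact: measurable_funTS.
      by rewrite [RHS]I0; apply: eq_integral => x _; rewrite /= ger0_norm.
    move=> [N [mN N0 sub]]; exists N; split => // x [Qx ux]; apply: sub => /= h.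
    by apply: ux; have [] : (u x)%:E = 0 by apply: h; rewrite -QE.
  by rewrite gt0_muley ?mule_gt0// ltxx.
have : mu.-negligible (\bigcup_j [set x | @rat_cube R d i `<=` @rat_cube R d j /\
    (@rat_cube R d j x /\ u x <> 0%R)]).
  apply: negligible_bigcup => j.
  have [ij|nij] := pselect (@rat_cube R d i `<=` @rat_cube R d j).
    by apply: negligibleS (uQ j ij) => x [].
  by apply: negligibleS (negligible_set0 mu) => x [].
move=> [N [mN N0 sub]]; exists N; split => // x ux; apply: sub.
by have [j [Qj ij]] := basis_directed BQ i x; exists j.
Qed.

Lemma Ap_muckenhoupt (K : R) : Ap_constant p u <= K%:E ->
  exists u' v' : 'rV[R]_d -> R, muckenhoupt_pair mu (@rat_cube R d) p K u' v' /\
    {ae mu, forall x, u x = u' x}.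
Proof.
move=> uK.
have mQ i : measurable (@rat_cube R d i) := basis_measurable BQ i.
have mZ := measurable_fiber0.
pose u' x := if u x == 0%R then 1%R else u x.
pose v' x := (u' x `^ (1 - p / (p - 1)))%R.
have uu' : {ae mu, forall x, u x = u' x}.
  by apply: filterS Ap_ae_gt0 => x ux; rewrite /u' gt_eqF.
have u'0 x : (0 < u' x)%R.
  by rewrite /u'; case: eqP => // /eqP ux; rewrite lt0r ux u0.
have v'0 x : (0 < v' x)%R by exact: powR_gt0.
have mu' : measurable_fun setT u'.
  apply: measurable_fun_ifT => //.
  rewrite (_ : (fun x => u x == 0%R) = (fun x => (u x <= 0)%R)).
    exact: measurable_fun_ler.
  by apply/funext => x; rewrite eq_le u0 andbT.
have mv' : measurable_fun setT v'.
  exact: measurableT_comp (measurable_powR _) mu'.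
have intu i : \int[mu]_(x in @rat_cube R d i) (u' x)%:E =
    \int[mu]_(x in @rat_cube R d i) (u x)%:E.
  apply: ge0_ae_eq_integral => //.
  - by apply: measurable_funTS; exact/measurable_EFinP.
  - exact: measurable_funTS.
  - by move=> x _; rewrite lee_fin ltW.
  - by apply: filterS uu' => x -> _.
have intv i : \int[mu]_(x in @rat_cube R d i) dual_weight p u x =
    \int[mu]_(x in @rat_cube R d i) (v' x)%:E.
  apply: ge0_ae_eq_integral => //.
  - apply: measurable_funTS; apply: measurable_fun_ifT => //.
      rewrite (_ : (fun x => u x == 0%R) = (fun x => (u x <= 0)%R)).
        exact: measurable_fun_ler.
      by apply/funext => x; rewrite eq_le u0 andbT.
    apply/measurable_EFinP; exact: measurableT_comp (measurable_powR _) mu_.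
  - by apply: measurable_funTS; exact/measurable_EFinP.
  - by move=> x _; exact: dual_weight_ge0.
  - by move=> x _; rewrite lee_fin ltW.
  - by apply: filterS Ap_ae_gt0 => x ux _; rewrite /dual_weight /v' /u' gt_eqF.
have u'lty i : \int[mu]_(x in @rat_cube R d i) (u' x)%:E < +oo.
  rewrite intu; have [a [l [_ ->]]] := rat_cubeE R d i.
  by have [[_ _ + _] _] := Au; apply; exact: compact_cube.
have Pu' : positive_weight mu (@rat_cube R d) u' by split.
have bound i : ((fine (mu (@rat_cube R d i)))^-1 * mass mu (@rat_cube R d) u' i)%:E *
    ((fine (mu (@rat_cube R d i)))^-1%:E * \int[mu]_(x in @rat_cube R d i) (v' x)%:E) `^ (p - 1)
    <= K%:E.
  apply: le_trans uK; have [a [l [l0 QE]]] := rat_cubeE R d i.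
  apply: le_trans (Ap_cube_le a l0).
  have mE : fine (mu (@rat_cube R d i)) = (l ^+ d)%R.
    by rewrite QE; exact: (congr1 fine (lebesgue_cube a (ltW l0))).
  by rewrite !average_cube// mE (EFinM (l ^+ d)^-1) massE// intu -intv QE.
have fine_gt0 i : (0 < fine (mu (@rat_cube R d i)))%R.
  rewrite (congr1 fine (lebesgue_rat_cube R d i)) exprn_gt0//.
  exact: rat_cube_side_gt0.
have v'lty i : \int[mu]_(x in @rat_cube R d i) (v' x)%:E < +oo.
  rewrite ltNge leye_eq; apply/negP => /eqP v'oo.
  have := bound i; rewrite v'oo gt0_muley ?lte_fin ?invr_gt0//.
  rewrite poweRyr ?gt_eqF// gt0_muley ?lte_fin ?mulr_gt0 ?invr_gt0//.
  exact: (mass_gt0 BQ Pu').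
have Pv' : positive_weight mu (@rat_cube R d) v' by split.
exists u', v'; split => //; split => //.
- move=> x; rewrite /v' -powRrM (_ : (_ * _ = 1)%R) ?powRr1 ?(ltW (u'0 x))//.
  by field; rewrite gt_eqF.
- move=> i; have := bound i.
  have S0 := mass_gt0 BQ Pv' i.
  rewrite -massE// -(EFinM _ (mass _ _ v' i)) poweR_EFin -EFinM lee_fin.
  move: (fine_gt0 i); set m := fine _ => m0.
  rewrite powRM ?invr_ge0 ?(ltW m0) ?(ltW S0)//.
  set W := mass _ _ u' i; set S := mass _ _ v' i.
  have -> : (m^-1 * W * (m^-1 `^ (p - 1) * S `^ (p - 1)) =
    (W * S `^ (p - 1)) * (m^-1 * m^-1 `^ (p - 1)))%R by ring.
  rewrite mulr_powRB1 ?invr_ge0 ?(ltW m0) ?(lt_trans ltr01)//.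
  by rewrite invr_powR ?(ltW m0)// ler_pdivrMr ?powR_gt0.
Qed.

End Ap_positive.

(** * Product weights and mixed norms *)

Lemma extrapolation_row (R : realType) (d : nat) (p p0 K : R) :
  1 < p -> 1 < p0 -> 0 <= K -> exists L C : R, [/\ 0 <= L, 0 < C &
  forall u : 'rV[R]_d -> R, Ap p u -> (Ap_constant p u <= K%:E)%E ->
  forall f : 'rV[R]_d -> \bar R, measurable_fun setT f -> (forall x, 0 <= f x)%E ->
  (\int[lebesgue_row R d]_x (f x `^ p * (u x)%:E) < +oo)%E ->
  (exists w, [/\ Ap p0 w, (Ap_constant p0 w <= L%:E)%E &
    (\int[lebesgue_row R d]_x (f x `^ p0 * (w x)%:E) < +oo)%E]) /\
  forall (g : 'rV[R]_d -> \bar R) (a : R), measurable_fun setT g ->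
    (forall x, 0 <= g x)%E -> 0 < a ->
    (forall w, Ap p0 w -> (Ap_constant p0 w <= L%:E)%E ->
      (\int[lebesgue_row R d]_x (g x `^ p0 * (w x)%:E) <=
       (a `^ p0)%:E * \int[lebesgue_row R d]_x (f x `^ p0 * (w x)%:E))%E) ->
    (\int[lebesgue_row R d]_x (g x `^ p * (u x)%:E) <=
     (C * a `^ p)%:E * \int[lebesgue_row R d]_x (f x `^ p * (u x)%:E))%E].
Proof.
move=> p1 p01 K0; pose mu := (lebesgue_row R d : {measure set 'rV[R]_d -> \bar R}).
pose k : R := 3 ^+ d.
have L0 : 0 <= extrapolation_level k p p0 K.
  by rewrite mulr_ge0 ?powR_ge0// mulr_ge0// (le_trans ler01)// maxop_norm_ge1.
exists (extrapolation_level k p p0 K * (3 ^+ d) `^ p0), (extrapolation_const p).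
split; first by rewrite mulr_ge0 ?powR_ge0.
  by rewrite /extrapolation_const !mulr_gt0// !powR_gt0// mulr_gt0// mulr_gt0// powR_gt0.
move=> u Au uK f mf f0 fu.
have [u' [v' [Huv uu']]] := Ap_muckenhoupt p1 Au uK.
have mu_ : measurable_fun setT u by have [[]] := Au.
have u0 x : 0 <= u x by have [[]] := Au.
have mu' := weight_measurable (muckenhoupt_weight Huv).
have u'0 := weight_gt0 (muckenhoupt_weight Huv).
have intE (h : 'rV[R]_d -> \bar R) : measurable_fun setT h -> (forall x, 0 <= h x)%E ->
    (\int[mu]_x (h x `^ p * (u x)%:E) = \int[mu]_x (h x `^ p * (u' x)%:E))%E.
  move=> mh h0; have mhp : measurable_fun setT (fun x => h x `^ p)%E.
    exact: measurableT_comp (measurable_poweR _) mh.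
  apply: ge0_ae_eq_integral => //.
  - by apply: emeasurable_funM => //; exact/measurable_EFinP.
  - by apply: emeasurable_funM => //; exact/measurable_EFinP.
  - by move=> x _; rewrite mule_ge0 ?poweR_ge0// lee_fin.
  - by move=> x _; rewrite mule_ge0 ?poweR_ge0// lee_fin ltW.
  - by apply: filterS uu' => x -> _.
have fpu0 : (0 <= \int[mu]_x (f x `^ p * (u' x)%:E))%E.
  by apply: integral_ge0 => x _; rewrite mule_ge0 ?poweR_ge0// lee_fin ltW.
have fE : (\int[mu]_x (f x `^ p * (u' x)%:E) =
    (fine (\int[mu]_x (f x `^ p * (u' x)%:E)))%:E)%E.
  by rewrite fineK// ge0_fin_numE// -intE.
have := fine_ge0 fpu0; move: fE; set I := fine _ => fE I0.
have BQ := rat_cube_basis R d.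
split.
  have [||w [sigma [Hw fw]]] := extrapolation_weight BQ p1 p01 K0 Huv mf f0 (Phi := I + 1).
  - by rewrite ltr_wpDl.
  - by rewrite fE lee_fin lerDl.
  have [Aw wL] := muckenhoupt_Ap p01 L0 Hw.
  by exists w; split.
move=> g a mg g0 a0 H.
rewrite !intE// -/mu fE -EFinM; apply/lee_addgt0Pr => e e0.
have Ca0 : 0 < extrapolation_const p * a `^ p.
  rewrite mulr_gt0 ?powR_gt0//.
  by rewrite /extrapolation_const !mulr_gt0// !powR_gt0// mulr_gt0// mulr_gt0// powR_gt0.
have Phi0 : 0 < I + e / (extrapolation_const p * a `^ p).
  by rewrite ltr_wpDl// divr_gt0.
apply: (le_trans (extrapolation_bound BQ p1 p01 K0 Huv mf f0 mg g0 Phi0 _ a0 _)).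
- by rewrite fE lee_fin lerDl ltW// divr_gt0.
- move=> w sigma Hw; have [Aw wL] := muckenhoupt_Ap p01 L0 Hw.
  exact: H.
- by rewrite -EFinD lee_fin mulrDr mulrCA divff ?mulr1// gt_eqF.
Qed.

Section tonelli_row.
Context (R : realType).
Local Notation mu d := (lebesgue_row R d).
Local Open Scope ereal_scope.

Lemma measurable_row_mx n m : measurable_fun setT
  (fun z : 'rV[R]_n * 'rV[R]_m => row_mx z.1 z.2).
Proof.
apply: measurable_row => i; rewrite /row_coord; case: (split_ordP i) => j ->.
  under eq_fun do rewrite row_mxEl.
  exact: measurableT_comp (measurable_row_coord j) measurable_fst.
under eq_fun do rewrite row_mxEr.
exact: measurableT_comp (measurable_row_coord j) measurable_snd.
Qed.

Lemma measurable_lsubmx n m : measurable_fun setT (fun z : 'rV[R]_(n + m) => lsubmx z).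
Proof.
apply: measurable_row => i; rewrite /row_coord; under eq_fun do rewrite mxE.
exact: measurable_row_coord.
Qed.

Lemma measurable_rsubmx n m : measurable_fun setT (fun z : 'rV[R]_(n + m) => rsubmx z).
Proof.
apply: measurable_row => i; rewrite /row_coord; under eq_fun do rewrite mxE.
exact: measurable_row_coord.
Qed.

Lemma measurable_section_integral n m (f : 'rV[R]_(n + m) -> \bar R) :
  measurable_fun setT f -> (forall z, 0 <= f z) ->
  measurable_fun setT (fun x : 'rV[R]_n => \int[mu m]_y f (row_mx x y)).
Proof.
move=> mf f0.
apply: (@measurable_fun_fubini_tonelli_F _ _ _ _ _ (mu m) (fun z => f (row_mx z.1 z.2))) => //.
exact: measurableT_comp mf (@measurable_row_mx n m).
Qed.

Lemma measurable_section n m (f : 'rV[R]_(n + m) -> \bar R) (x : 'rV[R]_n) :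
  measurable_fun setT f -> measurable_fun setT (fun y : 'rV[R]_m => f (row_mx x y)).
Proof.
move=> mf.
have := measurableT_comp (measurableT_comp mf (@measurable_row_mx n m)) (measurable_pair1 x).
exact.
Qed.

Lemma cons_row_mx n m (t : measurableTypeR R) (x : 'rV[R]_n) (y : 'rV[R]_m) :
  row_mx (cons_row (t, x)) y = cons_row (t, row_mx x y) :> 'rV[R]_(n + m).+1.
Proof.
apply/rowP => i; have [j ->|->] := unliftP ord0 i.
  rewrite cons_rowS /=; case: (split_ordP j) => k ->.
    rewrite row_mxEl (_ : lift ord0 (lshift m k) = lshift m (lift ord0 k)); last exact: val_inj.
    by rewrite [LHS](@row_mxEl _ 1 n.+1 m) cons_rowS.
  rewrite row_mxEr (_ : lift ord0 (rshift n k) = rshift n.+1 k); last exact: val_inj.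
  by rewrite [LHS](@row_mxEr _ 1 n.+1 m).
rewrite cons_row0 (_ : ord0 = lshift m (ord0 : 'I_n.+1)); last exact: val_inj.
by rewrite [LHS](@row_mxEl _ 1 n.+1 m) cons_row0.
Qed.

Lemma integral_cons_row d (f : 'rV[R]_d.+1 -> \bar R) :
  measurable_fun setT f -> (forall z, 0 <= f z) ->
  \int[mu d.+1]_z f z =
  \int[@lebesgue_measure R]_t \int[mu d]_x f (cons_row (t, x)).
Proof.
move=> mf f0.
have -> : \int[mu d.+1]_z f z =
    \int[(@lebesgue_measure R \x mu d)%E]_z (f \o @cons_row R d) z.
  exact: (@ge0_integral_pushforward _ _ _ _ R (@cons_row R d)
    (@measurable_cons_row R d) (@lebesgue_measure R \x mu d)%E setT f
    measurableT mf (fun x _ => f0 x)).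
rewrite fubini_tonelli1//; first by apply: measurableT_comp => //; exact: measurable_cons_row.
by move=> z; exact: f0.
Qed.

Lemma integral_row_mx n m (f : 'rV[R]_(n + m) -> \bar R) :
  measurable_fun setT f -> (forall z, 0 <= f z) ->
  \int[mu (n + m)]_z f z = \int[mu n]_x \int[mu m]_y f (row_mx x y).
Proof.
elim: n f => [|n ih] f mf f0.
  have row0 (x : 'rV[R]_0) (y : 'rV[R]_m) : row_mx x y = y :> 'rV[R]_(0 + m).
    apply/rowP => i; have iE : i = rshift 0 i by exact: val_inj.
    by rewrite [in LHS]iE row_mxEr.
  rewrite /= integral_dirac//=; last exact: measurable_section_integral.
  by rewrite diracE in_setT mul1e; apply: eq_integral => y _; rewrite row0.
rewrite [LHS](integral_cons_row mf f0) integral_cons_row//; last 2 first.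
- exact: measurable_section_integral.
- by move=> x; exact: integral_ge0.
apply: eq_integral => t _.
have mft : measurable_fun setT (fun z : 'rV[R]_(n + m) => f (cons_row (t, z))).
  have := measurableT_comp (measurableT_comp mf (@measurable_cons_row R (n + m)))
    (measurable_pair1 t).
  exact.
rewrite (ih _ mft) => [|z]; last exact: f0.
apply: eq_integral => x _; apply: eq_integral => y _.
by rewrite -cons_row_mx.
Qed.

End tonelli_row.

Section tensor_weights.
Context (R : realType) (n m : nat).
Local Notation mu d := (lebesgue_row R d : {measure set 'rV[R]_d -> \bar R}).
Local Open Scope ereal_scope.

Definition tensor (f : 'rV[R]_n -> R) (g : 'rV[R]_m -> R) (z : 'rV[R]_(n + m)) : R :=
  (f (lsubmx z) * g (rsubmx z))%R.

Lemma measurable_tensor (f : 'rV[R]_n -> R) (g : 'rV[R]_m -> R) : measurable_fun setT f -> measurable_fun setT g ->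
  measurable_fun setT (tensor f g).
Proof.
move=> mf mg; apply: measurable_funM.
- exact: measurableT_comp mf (@measurable_lsubmx R n m).
- exact: measurableT_comp mg (@measurable_rsubmx R n m).
Qed.

Lemma tensor_row_mx f g x y : tensor f g (row_mx x y) = (f x * g y)%R.
Proof. by rewrite /tensor row_mxKl row_mxKr. Qed.

Lemma integral_tensor (h : 'rV[R]_(n + m) -> \bar R) (f : 'rV[R]_n -> R)
    (g : 'rV[R]_m -> R) :
  measurable_fun setT h -> (forall z, 0 <= h z) ->
  measurable_fun setT f -> (forall x, 0 <= f x)%R ->
  measurable_fun setT g -> (forall x, 0 <= g x)%R ->
  \int[mu (n + m)]_z (h z * (tensor f g z)%:E) =
  \int[mu n]_x (\int[mu m]_y (h (row_mx x y) * (g y)%:E) * (f x)%:E).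
Proof.
move=> mh h0 mf f0 mg g0.
rewrite [LHS]integral_row_mx; last 2 first.
- by apply: emeasurable_funM => //; apply/measurable_EFinP; exact: measurable_tensor.
- by move=> z; rewrite mule_ge0// lee_fin mulr_ge0.
apply: eq_integral => x _.
rewrite -ge0_integralZr//; last 3 first.
- apply: emeasurable_funM; last exact/measurable_EFinP.
  exact: measurable_section.
- by move=> y _; rewrite mule_ge0// lee_fin.
- by rewrite lee_fin.
by apply: eq_integral => y _; rewrite tensor_row_mx mulrC EFinM muleA.
Qed.

Lemma rat_cube_split i : exists j1 j2 : nat,
  [/\ forall x y, @rat_cube R (n + m) i (row_mx x y) <->
        @rat_cube R n j1 x /\ @rat_cube R m j2 y,
      rat_cube_side R n j1 = rat_cube_side R (n + m) i &
      rat_cube_side R m j2 = rat_cube_side R (n + m) i].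
Proof.
pose a := (rat_cube_index (n + m) i).1; pose l := rat_side (rat_cube_index (n + m) i).2.
have l0 : (0 < l)%R by exact: rat_side_gt0.
have side_pickle e (b : 'rV[rat]_e) : rat_cube_side R e (pickle (b, l)) = ratr l.
  by rewrite /rat_cube_side /rat_cube_index pickleK/= /rat_side l0.
exists (pickle (lsubmx a, l)), (pickle (rsubmx a, l)); split; rewrite ?side_pickle//.
move=> x y; rewrite !rat_cube_pickle//; split.
  move=> H; split => t.
    by have := H (lshift m t); rewrite row_mxEl !mxE.
  by have := H (rshift n t); rewrite row_mxEr !mxE.
move=> [H1 H2] t; case: (split_ordP t) => k ->.
  by have := H1 k; rewrite row_mxEl !mxE.
by have := H2 k; rewrite row_mxEr !mxE.
Qed.

Lemma integral_tensor_cube (f : 'rV[R]_n -> R) (g : 'rV[R]_m -> R) i j1 j2 :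
  measurable_fun setT f -> (forall x, 0 <= f x)%R ->
  measurable_fun setT g -> (forall x, 0 <= g x)%R ->
  (forall x y, @rat_cube R (n + m) i (row_mx x y) <->
     @rat_cube R n j1 x /\ @rat_cube R m j2 y) ->
  \int[mu (n + m)]_(z in @rat_cube R (n + m) i) (tensor f g z)%:E =
  \int[mu n]_(x in @rat_cube R n j1) (f x)%:E *
  \int[mu m]_(y in @rat_cube R m j2) (g y)%:E.
Proof.
move=> mf f0 mg g0 H.
have mQ d j : measurable (@rat_cube R d j) := basis_measurable (rat_cube_basis R d) j.
have mI d (A : set 'rV[R]_d) : measurable A ->
    measurable_fun setT (fun x => (\1_A x)%:E : \bar R).
  by move=> mA; apply/measurable_EFinP; exact: measurable_indic.
have mgE : measurable_fun setT (EFin \o g) by exact/measurable_EFinP.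
have mfE : measurable_fun setT (EFin \o f) by exact/measurable_EFinP.
rewrite -(integral_indicM (mu (n + m)) (fun z => (tensor f g z)%:E) (mQ _ i)).
under eq_integral do rewrite muleC.
rewrite integral_tensor//; last exact: mI.
rewrite -(integral_indicM (mu n) (EFin \o f) (mQ _ j1)).
set G := \int[mu m]_(y in _) _.
have G0 : 0 <= G by apply: integral_ge0 => y _; rewrite lee_fin.
rewrite -ge0_integralZr//; last 2 first.
- by apply: emeasurable_funM => //; exact: mI.
- by move=> x _; rewrite mule_ge0 ?lee_fin.
apply: eq_integral => x _; rewrite muleC -muleA; congr (_ * _).
rewrite indicE; case: (boolP (x \in _)) => [/set_mem xQ|xQ].
  rewrite mul1e /G -(integral_indicM (mu m) (EFin \o g) (mQ _ j2)); apply: eq_integral => y _.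
  rewrite muleC !indicE; congr (_ * (_%:R)%:E); apply: congr1.
  apply/idP/idP => /set_mem; rewrite inE; first by move=> /H[].
  by move=> yQ; apply/H.
rewrite mul0e integral0_eq// => y _.
by rewrite indicE memNset ?mul0e// => /H[xQ' _]; move/negP: xQ; apply; rewrite inE.
Qed.

Lemma muckenhoupt_tensor (q K1 K2 : R) w1 s1 w2 s2 : (1 < q)%R ->
  muckenhoupt_pair (mu n) (@rat_cube R n) q K1 w1 s1 ->
  muckenhoupt_pair (mu m) (@rat_cube R m) q K2 w2 s2 ->
  muckenhoupt_pair (mu (n + m)) (@rat_cube R (n + m)) q (K1 * K2)
    (tensor w1 w2) (tensor s1 s2).
Proof.
move=> q1 [Pw1 Ps1 ws1 H1] [Pw2 Ps2 ws2 H2].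
have cube_split (f1 : 'rV[R]_n -> R) (f2 : 'rV[R]_m -> R) i j1 j2 :
    positive_weight (mu n) (@rat_cube R n) f1 ->
    positive_weight (mu m) (@rat_cube R m) f2 ->
    (forall x y, @rat_cube R (n + m) i (row_mx x y) <->
      @rat_cube R n j1 x /\ @rat_cube R m j2 y) ->
    \int[mu (n + m)]_(z in @rat_cube R (n + m) i) (tensor f1 f2 z)%:E =
    (mass (mu n) (@rat_cube R n) f1 j1 * mass (mu m) (@rat_cube R m) f2 j2)%:E.
  move=> P1 P2 H; rewrite EFinM !massE//; apply: integral_tensor_cube => //.
  - exact: (weight_measurable P1).
  - by move=> x; rewrite ltW// (weight_gt0 P1).
  - exact: (weight_measurable P2).
  - by move=> x; rewrite ltW// (weight_gt0 P2).
have Ptensor (f1 : 'rV[R]_n -> R) (f2 : 'rV[R]_m -> R) :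
    positive_weight (mu n) (@rat_cube R n) f1 ->
    positive_weight (mu m) (@rat_cube R m) f2 ->
    positive_weight (mu (n + m)) (@rat_cube R (n + m)) (tensor f1 f2).
  move=> P1 P2; split.
  - apply: measurable_tensor; [exact: (weight_measurable P1)|exact: (weight_measurable P2)].
  - by move=> z; rewrite mulr_gt0 ?(weight_gt0 P1) ?(weight_gt0 P2).
  - move=> i; have [j1 [j2 [H _ _]]] := rat_cube_split i.
    by rewrite (cube_split _ _ _ j1 j2)// ltry.
split; [exact: Ptensor|exact: Ptensor| |].
- move=> z; rewrite /tensor powRM ?ws1 ?ws2// ltW//.
    exact: (weight_gt0 Ps1).
  exact: (weight_gt0 Ps2).
- move=> i; have [j1 [j2 [H side1 side2]]] := rat_cube_split i.
  have massT f1 f2 P1 P2 := congr1 fine (cube_split f1 f2 i j1 j2 P1 P2 H).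
  rewrite /mass !massT// -!/(mass _ _ _ _).
  have muE d e : fine (mu d (@rat_cube R d e)) = (rat_cube_side R d e ^+ d)%R.
    exact: (congr1 fine (lebesgue_rat_cube R d e)).
  have h1 := H1 j1; have h2 := H2 j2.
  have s10 := mass_gt0 (rat_cube_basis R n) Ps1 j1.
  have s20 := mass_gt0 (rat_cube_basis R m) Ps2 j2.
  have w10 := mass_gt0 (rat_cube_basis R n) Pw1 j1.
  have w20 := mass_gt0 (rat_cube_basis R m) Pw2 j2.
  have side0 := rat_cube_side_gt0 R (n + m) i.
  move: h1 h2; rewrite !muE side1 side2 exprD => h1 h2.
  rewrite [X in (_ * X)%R]powRM ?(ltW s10) ?(ltW s20)//.
  rewrite [X in (_ <= _ * X)%R]powRM ?exprn_ge0 ?(ltW side0)//.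
  have := ler_pM _ _ h1 h2; rewrite !mulr_ge0 ?powR_ge0 ?(ltW w10) ?(ltW w20)//.
  by move=> /(_ isT isT); rewrite mulrACA [X in (_ <= X)%R -> _]mulrACA.
Qed.

End tensor_weights.

Section complex_measurability.
Context (R : realType) (d : nat).
Implicit Types f g : 'rV[R]_d -> complex R.

Lemma normcE (z : complex R) :
  Normc.normc z = Num.sqrt (complex.Re z ^+ 2 + complex.Im z ^+ 2).
Proof. by case: z. Qed.

Lemma measurable_normc f : measurable_complex f ->
  measurable_fun setT (fun x => Normc.normc (f x)).
Proof.
move=> [mre mim].
have -> : (fun x => Normc.normc (f x)) =
    (fun x => (complex.Re (f x) ^+ 2 + complex.Im (f x) ^+ 2) `^ 2^-1).
  by apply/funext => x; rewrite normcE powR12_sqrt// addr_ge0 ?sqr_ge0.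
apply: (measurableT_comp (measurable_powR _)).
by apply: measurable_funD; exact: measurable_funX.
Qed.

Lemma normc_ge0 (z : complex R) : 0 <= Normc.normc z.
Proof. by rewrite normcE sqrtr_ge0. Qed.

End complex_measurability.

Section mixed_extrapolation.
Context (R : realType) (n m : nat).
Local Notation mu d := (lebesgue_row R d : {measure set 'rV[R]_d -> \bar R}).
Local Open Scope ereal_scope.

Definition slice_norm (q : R) (v : 'rV[R]_m -> R) (f : 'rV[R]_(n + m) -> complex R)
    (x : 'rV[R]_n) : \bar R :=
  (\int[mu m]_y (Normc.normc (f (row_mx x y)) `^ q * v y)%:E) `^ q^-1.

Lemma measurable_slice_norm (q : R) (v : 'rV[R]_m -> R) f : measurable_fun setT v ->
  (forall y, 0 <= v y)%R -> measurable_complex f ->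
  measurable_fun setT (slice_norm q v f).
Proof.
move=> mv v0 mf.
apply: (measurableT_comp (measurable_poweR _)).
have mh : measurable_fun setT (fun z : 'rV[R]_(n + m) =>
    (Normc.normc (f z) `^ q * v (rsubmx z))%:E).
  apply/measurable_EFinP; apply: measurable_funM.
    by apply: measurableT_comp (measurable_powR _) _; exact: measurable_normc.
  exact: measurableT_comp mv (@measurable_rsubmx R n m).
have h0 z : 0 <= (Normc.normc (f z) `^ q * v (rsubmx z))%:E.
  by rewrite lee_fin mulr_ge0 ?powR_ge0.
have := measurable_section_integral mh h0.
by under eq_fun do under eq_integral do rewrite row_mxKr.
Qed.

Lemma mixed_normE p q u v f : (0 < p)%R -> (0 < q)%R ->
  mixed_norm p q u v f = (\int[mu n]_x (slice_norm q v f x `^ p * (u x)%:E)) `^ p^-1.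
Proof.
move=> p0 q0; rewrite /mixed_norm; congr (_ `^ _).
apply: eq_integral => x _; congr (_ * _).
by rewrite /slice_norm -poweRrM mulrC.
Qed.

Lemma integral_slice_norm (q K1 K2 : R) (w1 w1' : 'rV[R]_n -> R) (v v' : 'rV[R]_m -> R)
    s1 s2 f :
  (0 < q)%R -> measurable_complex f ->
  measurable_fun setT w1 -> (forall x, 0 <= w1 x)%R ->
  measurable_fun setT v -> (forall x, 0 <= v x)%R ->
  muckenhoupt_pair (mu n) (@rat_cube R n) q K1 w1' s1 ->
  muckenhoupt_pair (mu m) (@rat_cube R m) q K2 v' s2 ->
  {ae mu n, forall x, w1 x = w1' x} -> {ae mu m, forall x, v x = v' x} ->
  \int[mu n]_x (slice_norm q v f x `^ q * (w1 x)%:E) =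
  \int[mu (n + m)]_z ((Normc.normc (f z))%:E `^ q * (tensor w1' v' z)%:E).
Proof.
move=> q0 mf mw1 w10 mv v0 [Pw1' _ _ _] [Pv' _ _ _] ww vv.
have w1'0 := weight_gt0 Pw1'; have v'0 := weight_gt0 Pv'.
have mw1' := weight_measurable Pw1'; have mv' := weight_measurable Pv'.
have mN : measurable_fun setT (fun z : 'rV[R]_(n + m) => (Normc.normc (f z))%:E `^ q).
  apply: (measurableT_comp (measurable_poweR _)).
  by apply/measurable_EFinP; exact: measurable_normc.
have N0 z : 0 <= (Normc.normc (f z))%:E `^ q by exact: poweR_ge0.
rewrite integral_tensor//; last 2 first.
- by move=> x; exact: ltW.
- by move=> x; exact: ltW.
have mvE : measurable_fun setT (EFin \o v) by exact/measurable_EFinP.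
have mv'E : measurable_fun setT (EFin \o v') by exact/measurable_EFinP.
have sliceE x : slice_norm q v f x `^ q =
    \int[mu m]_y ((Normc.normc (f (row_mx x y)))%:E `^ q * (v' y)%:E).
  rewrite /slice_norm poweRVK ?gt_eqF//; last first.
    by apply: integral_ge0 => y _; rewrite lee_fin mulr_ge0 ?powR_ge0.
  have mNx : measurable_fun setT (fun y : 'rV[R]_m => (Normc.normc (f (row_mx x y)))%:E `^ q).
    exact: (measurable_section x mN).
  apply: ge0_ae_eq_integral => //.
  - exact: (emeasurable_funM mNx mvE).
  - exact: (emeasurable_funM mNx mv'E).
  - by move=> y _; rewrite lee_fin mulr_ge0 ?powR_ge0.
  - by move=> y _; rewrite mule_ge0// lee_fin ltW.
  - by apply: filterS vv => y <- _.
have mslice := measurable_slice_norm q mv v0 mf.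
have mslice' : measurable_fun setT (fun x => slice_norm q v f x `^ q).
  exact: (measurableT_comp (measurable_poweR _)).
under [RHS]eq_integral do rewrite -sliceE.
apply: ge0_ae_eq_integral => //.
- by apply: emeasurable_funM => //; exact/measurable_EFinP.
- by apply: emeasurable_funM => //; exact/measurable_EFinP.
- by move=> x _; rewrite mule_ge0 ?poweR_ge0// lee_fin.
- by move=> x _; rewrite mule_ge0 ?poweR_ge0// lee_fin ltW.
- by apply: filterS ww => x -> _.
Qed.

Theorem mixed_extrapolation (p q p0 K : R) :
  (1 < p)%R -> (1 < q)%R -> (1 < p0)%R -> (0 <= K)%R ->
  exists L C : R, [/\ (0 <= L)%R, (0 < C)%R &
  forall u v, Ap p u -> Ap q v -> Ap_constant p u <= K%:E -> Ap_constant q v <= K%:E ->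
  forall f : 'rV[R]_(n + m) -> complex R, measurable_complex f ->
  mixed_norm p q u v f < +oo ->
  (exists w, [/\ Ap p0 w, Ap_constant p0 w <= L%:E & Lp_norm p0 w f < +oo]) /\
  forall (g : 'rV[R]_(n + m) -> complex R) (a : R), measurable_complex g -> (0 < a)%R ->
    (forall w, Ap p0 w -> Ap_constant p0 w <= L%:E ->
      Lp_norm p0 w g <= a%:E * Lp_norm p0 w f) ->
    mixed_norm p q u v g <= (C * a)%:E * mixed_norm p q u v f].
Proof.
move=> p1 q1 p01 K0.
have pgt0 : (0 < p)%R by exact: lt_trans p1.
have qgt0 : (0 < q)%R by exact: lt_trans q1.
have p0gt0 : (0 < p0)%R by exact: lt_trans p01.
have [L1 [C1 [L10 C10 H1]]] := extrapolation_row n p1 q1 K0.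
have LK0 : (0 <= L1 * K)%R by exact: mulr_ge0.
have K20 : (0 <= L1 * K * (3 ^+ (n + m)) `^ q)%R by rewrite mulr_ge0 ?powR_ge0.
have [L2 [C2 [L20 C20 H2]]] := extrapolation_row (n + m) q1 p01 K20.
exists L2, (C1 `^ p^-1 * C2 `^ q^-1)%R; split => //.
  by rewrite mulr_gt0// powR_gt0.
move=> u v Au Av uK vK f mf fN.
have mv : measurable_fun setT v by have [[]] := Av.
have v0 x : (0 <= v x)%R by have [[]] := Av.
have mu_ : measurable_fun setT u by have [[]] := Au.
have u0 x : (0 <= u x)%R by have [[]] := Au.
have [v' [s2 [Hv vv]]] := Ap_muckenhoupt q1 Av vK.
have slice_fin : \int[mu n]_x (slice_norm q v f x `^ p * (u x)%:E) < +oo.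
  move: fN; rewrite mixed_normE//; apply: lty_poweRy; rewrite gt_eqF// invr_gt0.
  by [].
have mhE (h : 'rV[R]_(n + m) -> complex R) : measurable_complex h ->
    measurable_fun setT (fun z => (Normc.normc (h z))%:E).
  by move=> mh; apply/measurable_EFinP; exact: measurable_normc.
have n0 (h : 'rV[R]_(n + m) -> complex R) z : 0 <= (Normc.normc (h z))%:E.
  by rewrite lee_fin normc_ge0.
have s0 (h : 'rV[R]_(n + m) -> complex R) x : 0 <= slice_norm q v h x.
  exact: poweR_ge0.
have [[w1 [Aw1 w1L fw1]] H1'] := H1 u Au uK _ (measurable_slice_norm q mv v0 mf) (s0 f) slice_fin.
have tensorP (w : 'rV[R]_n -> R) : Ap q w -> Ap_constant q w <= L1%:E -> exists W,
    [/\ Ap q W, Ap_constant q W <= (L1 * K * (3 ^+ (n + m)) `^ q)%:E &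
     forall h, measurable_complex h ->
       \int[mu n]_x (slice_norm q v h x `^ q * (w x)%:E) =
       \int[mu (n + m)]_z ((Normc.normc (h z))%:E `^ q * (W z)%:E)].
  move=> Aw wL; have [w' [s1 [Hw ww]]] := Ap_muckenhoupt q1 Aw wL.
  have mw : measurable_fun setT w by have [[]] := Aw.
  have w0 x : (0 <= w x)%R by have [[]] := Aw.
  have [AW WL] := muckenhoupt_Ap q1 LK0 (muckenhoupt_tensor q1 Hw Hv).
  exists (tensor w' v'); split => // h mh.
  exact: integral_slice_norm Hw Hv ww vv.
split.
  have [W [AW WL WE]] := tensorP w1 Aw1 w1L.
  rewrite WE// in fw1.
  have [[w [Aw wL fw]] _] := H2 W AW WL _ (mhE _ mf) (n0 f) fw1.
  exists w; split => //; exact: poweR_lty.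
move=> g a mg a0 H.
pose a1 := (C2 `^ q^-1 * a)%R.
have a10 : (0 < a1)%R by rewrite mulr_gt0// powR_gt0.
have : \int[mu n]_x (slice_norm q v g x `^ p * (u x)%:E) <=
    (C1 * a1 `^ p)%:E * \int[mu n]_x (slice_norm q v f x `^ p * (u x)%:E).
  apply: H1' => //; first exact: measurable_slice_norm.
  move=> w Aw wL; have [W [AW WL WE]] := tensorP w Aw wL.
  rewrite !WE//.
  have a1q : (a1 `^ q = C2 * a `^ q)%R.
    by rewrite powRM ?powR_ge0 ?(ltW a0)// powRVK ?(ltW C20) ?gt_eqF.
  have [fW|] := ltP (\int[mu (n + m)]_z ((Normc.normc (f z))%:E `^ q * (W z)%:E)) +oo; last first.
    by rewrite leye_eq => /eqP ->; rewrite gt0_muley ?leey// lte_fin powR_gt0.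
  have [_ H2'] := H2 W AW WL _ (mhE _ mf) (n0 f) fW.
  rewrite a1q; apply: H2' => //; first exact: mhE.
  move=> w2 Aw2 w2L; have := H w2 Aw2 w2L.
  rewrite /Lp_norm => /(lee_poweR (ltW p0gt0) (poweR_ge0 _ _)).
  have w20 x : (0 <= w2 x)%R by have [[]] := Aw2.
  have i0 (h : 'rV[R]_(n + m) -> complex R) :
      0 <= \int[mu (n + m)]_x (Normc.normc (h x) `^ p0 * w2 x)%:E.
    by apply: integral_ge0 => x _; rewrite lee_fin mulr_ge0 ?powR_ge0.
  by rewrite poweRM ?poweR_ge0 ?lee_fin ?(ltW a0)// !poweRVK ?gt_eqF.
have i0 (h : 'rV[R]_(n + m) -> complex R) :
    0 <= \int[mu n]_x (slice_norm q v h x `^ p * (u x)%:E).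
  by apply: integral_ge0 => x _; rewrite mule_ge0 ?poweR_ge0// lee_fin.
have pi0 : (0 <= p^-1)%R by rewrite invr_ge0 ltW.
rewrite !mixed_normE// => /(lee_poweR pi0 (i0 g)) /le_trans; apply.
rewrite poweRM//; last by rewrite lee_fin mulr_ge0 ?powR_ge0 ?(ltW C10).
rewrite poweR_EFin powRM ?powR_ge0 ?(ltW C10)// powRK ?(ltW a10) ?gt_eqF//.
by rewrite /a1 mulrA.
Qed.

End mixed_extrapolation.

(** * Scaling, truncation and translation *)

Section weight_scaling.
Context (R : realType) (d : nat).
Local Notation mu := (lebesgue_row R d : {measure set 'rV[R]_d -> \bar R}).
Variables (p c : R) (w : 'rV[R]_d -> R).
Hypotheses (p1 : 1 < p) (c0 : 0 < c) (Aw : Ap p w).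
Local Open Scope ereal_scope.

Let mw : measurable_fun setT w. Proof. by have [[]] := Aw. Qed.
Let w0 x : (0 <= w x)%R. Proof. by have [[]] := Aw. Qed.
Let mwE : measurable_fun setT (EFin \o w). Proof. exact/measurable_EFinP. Qed.

Lemma integral_scale (A : set 'rV[R]_d) : measurable A ->
  \int[mu]_(x in A) (c * w x)%:E = c%:E * \int[mu]_(x in A) (w x)%:E.
Proof.
move=> mA; rewrite -ge0_integralZl//.
- exact: measurable_funTS.
- by move=> x _; rewrite lee_fin.
- by rewrite lee_fin ltW.
Qed.

Lemma dual_weight_scale x :
  dual_weight p (fun x => c * w x)%R x =
  (c `^ (1 - conjugate_exponent p))%:E * dual_weight p w x.
Proof.
rewrite /dual_weight mulf_eq0 (gt_eqF c0)/=; case: ifP => _.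
  by rewrite gt0_muley// lte_fin powR_gt0.
by rewrite -EFinM powRM// ltW.
Qed.

Lemma Ap_constant_scale : Ap_constant p (fun x => c * w x)%R <= Ap_constant p w.
Proof.
apply: ge_ereal_sup => _ [a [l [l0 ->]]].
apply: le_trans (Ap_cube_le p w a l0).
have mQ := measurable_cube a l.
rewrite !(average_cube _ _ l0) (integral_scale mQ).
under [X in (_ * (_ * X) `^ _)%E]eq_integral do rewrite dual_weight_scale.
have mdual : measurable_fun setT (dual_weight p w).
  apply: measurable_fun_ifT => //.
    rewrite (_ : (fun x => w x == 0%R) = (fun x => (w x <= 0)%R)).
      exact: measurable_fun_ler.
    by apply/funext => x; rewrite eq_le w0 andbT.
  by apply/measurable_EFinP; exact: measurableT_comp (measurable_powR _) mw.
have dual0 x : 0 <= dual_weight p w x by exact: dual_weight_ge0.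
rewrite ge0_integralZl//; last 2 first.
- exact: measurable_funTS.
- by rewrite lee_fin powR_ge0.
set I := \int[_]_(x in _) (w x)%:E; set J := \int[_]_(x in _) dual_weight p w x.
have J0 : 0 <= J by exact: integral_ge0.
have ld0 : 0 <= ((l ^+ d)^-1)%:E :> \bar R by rewrite lee_fin invr_ge0 exprn_ge0// ltW.
have lJ : 0 <= ((l ^+ d)^-1)%:E * J by exact: mule_ge0.
set b := (c `^ _)%R; have b0 : 0 <= b%:E by rewrite lee_fin powR_ge0.
rewrite (muleCA _ b%:E J) (poweRM _ b0 lJ) poweR_EFin /b -powRrM.
have -> : ((1 - conjugate_exponent p) * (p - 1) = -1)%R.
  by rewrite /conjugate_exponent; field; rewrite subr_eq0 gt_eqF.
rewrite powR_inv1 ?(ltW c0)// [X in X * _]muleCA -muleA [X in c%:E * X]muleCA.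
by rewrite mulEFinVK// gt_eqF.
Qed.

Lemma Ap_scale : Ap p (fun x => c * w x)%R.
Proof.
split; last by apply: le_lt_trans Ap_constant_scale _; have [] := Aw.
have [[_ _ wK wn0] _] := Aw.
split.
- exact: measurable_funM.
- by move=> x; rewrite mulr_ge0// ltW.
- move=> K cK; have [n Kn] := compact_sub_rat_cube cK.
  have cw0 x : 0 <= (c * w x)%:E by rewrite lee_fin mulr_ge0// ltW.
  apply: (le_lt_trans (ge0_subset_integral_any mu cw0 Kn)).
  have [a [l [l0 QE]]] := rat_cubeE R d n.
  rewrite QE integral_scale; last exact: measurable_cube.
  rewrite lte_mul_pinfty ?lee_fin ?(ltW c0)//; apply: wK; exact: compact_cube.
- move=> cw; apply: wn0; apply: filterS cw => x /eqP.
  by rewrite mulf_eq0 (gt_eqF c0)/= => /eqP.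
Qed.

Lemma Lp_norm_scale (f : 'rV[R]_d -> complex R) : measurable_complex f ->
  Lp_norm p (fun x => c * w x)%R f = (c `^ p^-1)%:E * Lp_norm p w f.
Proof.
move=> mf; rewrite /Lp_norm.
have m : measurable_fun setT (fun x => (Normc.normc (f x) `^ p * w x)%:E).
  apply/measurable_EFinP; apply: measurable_funM => //.
  by apply: (measurableT_comp (measurable_powR _)); exact: measurable_normc.
have -> : \int[mu]_x (Normc.normc (f x) `^ p * (c * w x))%:E =
    c%:E * \int[mu]_x (Normc.normc (f x) `^ p * w x)%:E.
  rewrite -ge0_integralZl//; last 2 first.
  - by move=> x _; rewrite lee_fin mulr_ge0 ?powR_ge0.
  - by rewrite lee_fin ltW.
  by apply: eq_integral => x _; rewrite mulrCA EFinM.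
rewrite poweRM ?lee_fin ?(ltW c0)//.
by apply: integral_ge0 => x _; rewrite lee_fin mulr_ge0 ?powR_ge0.
Qed.

End weight_scaling.

(* The operator is not assumed homogeneous; rescaling the weight, which leaves
   its A_p constant unchanged, replaces rescaling the function. *)
Lemma Lp_bound_homogeneous (R : realType) (d : nat) (p L B : R)
    (f g : 'rV[R]_d -> complex R) : 1 < p -> 0 < B ->
  measurable_complex f -> measurable_complex g ->
  (forall N, Lp_norms p L N -> (N f <= 1)%E -> (N g <= B%:E)%E) ->
  forall w, Ap p w -> (Ap_constant p w <= L%:E)%E ->
  (Lp_norm p w g <= B%:E * Lp_norm p w f)%E.
Proof.
move=> p1 B0 mf mg H w Aw wL.
have pgt0 : 0 < p by exact: lt_trans p1.
have f0 : (0 <= Lp_norm p w f)%E by exact: poweR_ge0.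
have key (t : R) : 0 < t -> (Lp_norm p w f <= t%:E)%E -> (Lp_norm p w g <= (B * t)%:E)%E.
  move=> t0 ft; pose c := t^-1 `^ p.
  have c0 : 0 < c by rewrite powR_gt0// invr_gt0.
  have cE : c `^ p^-1 = t^-1 by rewrite powRK ?gt_eqF// invr_ge0 ltW.
  have := H (Lp_norm p (fun x => c * w x)).
  rewrite !Lp_norm_scale// cE => Hc.
  have : (t^-1%:E * Lp_norm p w g <= B%:E)%E.
    apply: Hc.
      exists (fun x => c * w x); split; [exact: Ap_scale| |exact: erefl].
      exact: le_trans (Ap_constant_scale p1 c0 Aw) wL.
    have /(@lee_wpmul2l _ t^-1%:E) := ft; rewrite lee_fin invr_ge0 (ltW t0) => /(_ isT).
    by rewrite -EFinM mulVf// gt_eqF.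
  move=> /(@lee_wpmul2l _ t%:E); rewrite lee_fin (ltW t0) => /(_ isT).
  by rewrite mulEFinVK ?gt_eqF// -EFinM mulrC.
move: f0 key; case: (Lp_norm p w f) => [r| |]// r0 key; last first.
  by rewrite gt0_muley ?lte_fin// leey.
rewrite lee_fin in r0.
rewrite -EFinM; apply/lee_addgt0Pr => e e0.
have := key (r + e / B); rewrite ltr_wpDl ?divr_gt0// => /(_ isT).
rewrite lee_fin lerDl (ltW (divr_gt0 e0 B0)) => /(_ isT) /le_trans; apply.
by rewrite -EFinD lee_fin mulrDr mulrCA divff ?mulr1// gt_eqF.
Qed.

Section truncation_translation.
Context (R : realType) (d : nat).
Implicit Types f g : 'rV[R]_d -> complex R.

Lemma measurable_euclidean_norm : measurable_fun setT (@euclidean_norm R d).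
Proof.
rewrite /euclidean_norm.
have -> : (fun x : 'rV[R]_d => Num.sqrt (\sum_(i < d) x ord0 i ^+ 2)) =
    (fun x => (\sum_(i < d) x ord0 i ^+ 2) `^ 2^-1).
  apply/funext => x; rewrite powR12_sqrt//.
  by apply: sumr_ge0 => i _; exact: sqr_ge0.
apply: (measurableT_comp (measurable_powR _)).
apply: measurable_sum => i; apply: measurable_funX; exact: measurable_row_coord.
Qed.

Lemma measurable_complex_outside (r : R) f : measurable_complex f ->
  measurable_complex (fun x => if (euclidean_norm x < r)%R then 0%R else f x).
Proof.
move=> [mre mim].
have mE : measurable_fun setT (fun x : 'rV[R]_d => euclidean_norm x < r).
  exact: measurable_fun_ltr measurable_euclidean_norm (measurable_cst _).
split.
- rewrite (_ : (fun x => _) = (fun x => if euclidean_norm x < r then 0 else complex.Re (f x))).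
    exact: measurable_fun_ifT.
  by apply/funext => x; case: ifP.
- rewrite (_ : (fun x => _) = (fun x => if euclidean_norm x < r then 0 else complex.Im (f x))).
    exact: measurable_fun_ifT.
  by apply/funext => x; case: ifP.
Qed.

Lemma measurable_complex_difference (h : 'rV[R]_d) f : measurable_complex f ->
  measurable_complex (fun x => f x - f (x + h))%R.
Proof.
move=> [mre mim].
have mh : measurable_fun setT (fun x : 'rV[R]_d => x + h).
  apply: measurable_row => i; rewrite /row_coord; under eq_fun do rewrite mxE.
  by apply: measurable_funD => //; exact: measurable_row_coord.
split.
- rewrite (_ : (fun x => _) = (fun x => complex.Re (f x) - complex.Re (f (x + h)))).
    by apply: measurable_funB => //; exact: measurableT_comp mre mh.
  by apply/funext => x; case: (f x) => a b; case: (f (x + h)).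
- rewrite (_ : (fun x => _) = (fun x => complex.Im (f x) - complex.Im (f (x + h)))).
    by apply: measurable_funB => //; exact: measurableT_comp mim mh.
  by apply/funext => x; case: (f x) => a b; case: (f (x + h)).
Qed.

End truncation_translation.

Theorem theorem3p6 (R : realType) (n m : nat) (hn : (1 <= n)%N) (hm : (1 <= m)%N)
    (T : ('rV[R]_(n + m) -> complex R) -> ('rV[R]_(n + m) -> complex R))
    (p0 : R) (hp0 : 1 < p0) (hT : is_operator p0 T)
    (hcompact : uniformly_compact_Lp p0 T) :
  forall p q : R, 1 < p -> 1 < q -> uniformly_compact_mixed p q T.
Proof.
move=> p q p1 q1.
have [mapT [phi [phi0 phi_mono normT outsideT differenceT]]] := hcompact.
have LC (k : nat) := mixed_extrapolation n m p1 q1 hp0 (ler0n R k).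
have /choice[c Hc] : forall k : nat, exists c : R * R,
    [/\ 0 <= c.1, 0 < c.2 & forall u v, Ap p u -> Ap q v ->
    (Ap_constant p u <= k%:R%:E)%E -> (Ap_constant q v <= k%:R%:E)%E ->
    forall f : 'rV[R]_(n + m) -> complex R, measurable_complex f ->
    (mixed_norm p q u v f < +oo)%E ->
    (exists w, [/\ Ap p0 w, (Ap_constant p0 w <= c.1%:E)%E & (Lp_norm p0 w f < +oo)%E]) /\
    forall (g : 'rV[R]_(n + m) -> complex R) (a : R), measurable_complex g -> 0 < a ->
      (forall w, Ap p0 w -> (Ap_constant p0 w <= c.1%:E)%E ->
        (Lp_norm p0 w g <= a%:E * Lp_norm p0 w f)%E) ->
      (mixed_norm p q u v g <= (c.2 * a)%:E * mixed_norm p q u v f)%E].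
  by move=> k; have [L [C H]] := LC k; exists (L, C).
pose L k := Num.max 1 (c k).1.
have L1 k : 1 <= L k by rewrite le_max lexx.
have L0 k : 0 < L k by rewrite (lt_le_trans ltr01).
have Ap_L k w : (Ap_constant p0 w <= (c k).1%:E)%E -> (Ap_constant p0 w <= (L k)%:E)%E.
  by move=> /le_trans; apply; rewrite lee_fin le_max lexx orbT.
have norms_L k N : Lp_norms p0 (c k).1 N -> Lp_norms p0 (L k) N.
  by move=> [w [Aw wc ->]]; exists w; split => //; exact: Ap_L.
pose B k := (c k).2 * phi (L k).
have B0 k : 0 < B k by have [_ c0 _] := Hc k; rewrite mulr_gt0// phi0.
pose psi (t : R) := \sum_(k < (Num.truncn t).+2) B k.
have psi_gt0 t : 0 < psi t.
  rewrite /psi (bigD1 ord0)//= ltr_wpDr//.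
  by apply: sumr_ge0 => k _; exact: ltW.
have psi_mono s t : s <= t -> psi s <= psi t.
  move=> /le_truncn st; rewrite /psi.
  rewrite -!(big_mkord xpredT) [leRHS](@big_cat_nat _ _ _ (Num.truncn s).+2)//=.
  by rewrite lerDl sumr_ge0// => k _; exact: ltW.
pose level (K : R) := (Num.truncn K).+1.
have level_ge K : 1 <= K -> K <= (level K)%:R.
  move=> K1; have /truncn_itv/andP[_ /ltW//] : 0 <= K by exact: le_trans K1.
have B_psi K : B (level K) <= psi K.
  rewrite /psi /level big_ord_recr/= lerDr.
  by apply: sumr_ge0 => k _; exact: ltW.
have measT k N f : @mixed_norms R n m p q k%:R N -> in_space N f -> measurable_complex (T f).
  move=> [u [v [Au Av]]]; rewrite ge_max => /andP[uk vk] ->{N} [mf fN].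
  have [_ _ H] := Hc k; have [[w [Aw wc fw]] _] := H u v Au Av uk vk f mf fN.
  have Xw : Lp_norms p0 (c k).1 (Lp_norm p0 w) by exists w.
  by have [] := mapT _ _ _ Xw (conj mf fw).
have bound k (a : R) (S : ('rV[R]_(n + m) -> complex R) -> ('rV[R]_(n + m) -> complex R)) :
    0 < a -> (forall f, measurable_complex (T f) -> measurable_complex (S f)) ->
    (forall N f, Lp_norms p0 (L k) N -> measurable_complex f -> (N f <= 1)%E ->
      (N (S f) <= a%:E)%E) ->
    forall N f, @mixed_norms R n m p q k%:R N -> in_space N f ->
      (N (S f) <= ((c k).2 * a)%:E * N f)%E.
  move=> a0 mS HS N f XN fN; have mTf := measT k N f XN fN.
  move: XN fN => [u [v [Au Av]]]; rewrite ge_max => /andP[uk vk] ->{N} [mf fN].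
  have [_ _ H] := Hc k; have [_ H2] := H u v Au Av uk vk f mf fN.
  apply: H2 => //; first exact: mS.
  move=> w Aw wc; apply: (Lp_bound_homogeneous hp0 a0 mf (mS _ mTf) _ Aw wc).
  by move=> N /norms_L XN; exact: HS.
have bound1 k (a : R) (S : ('rV[R]_(n + m) -> complex R) -> ('rV[R]_(n + m) -> complex R)) :
    0 < a -> (forall f, measurable_complex (T f) -> measurable_complex (S f)) ->
    (forall N f, Lp_norms p0 (L k) N -> measurable_complex f -> (N f <= 1)%E ->
      (N (S f) <= a%:E)%E) ->
    forall N f, @mixed_norms R n m p q k%:R N -> measurable_complex f -> (N f <= 1)%E ->
      (N (S f) <= ((c k).2 * a)%:E)%E.
  move=> a0 mS HS N f XN mf f1; have [_ c0 _] := Hc k.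
  have fN : in_space N f by split => //; apply: le_lt_trans f1 (ltry _).
  apply: (le_trans (bound k a S a0 mS HS N f XN fN)).
  rewrite -[leRHS]mule1; apply: lee_wpmul2l => //.
  by rewrite lee_fin mulr_ge0// ltW.
have mixed_level K N : 1 <= K -> @mixed_norms R n m p q K N ->
    @mixed_norms R n m p q (level K)%:R N.
  move=> K1 [u [v [Au Av uv ->]]]; exists u, v; split => //.
  by apply: (le_trans uv); rewrite lee_fin level_ge.
split.
  move=> K N f XN fN.
  have XN' : @mixed_norms R n m p q (level (Num.max 1 K))%:R N.
    apply: mixed_level; first by rewrite le_max lexx.
    move: XN => [u [v [Au Av uv ->]]]; exists u, v; split => //.
    by apply: (le_trans uv); rewrite lee_fin le_max lexx orbT.
  split; first exact: measT XN' fN.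
  apply: (le_lt_trans (bound _ (phi (L (level (Num.max 1 K)))) T _ _ _ N f XN' fN)) => //.
  - exact: phi0.
  - by move=> N' f' XN'' mf' f'1; exact: normT.
  - have [_ Nf] := fN; apply: lte_mul_pinfty => //.
    by rewrite lee_fin (ltW (B0 _)).
exists psi; split => //.
- by move=> s t _; exact: psi_mono.
- move=> K N f K1 XN mf f1.
  apply: (le_trans (bound1 _ (phi (L (level K))) T _ _ _ N f (mixed_level _ _ K1 XN) mf f1)) => //.
  + exact: phi0.
  + by move=> N' f' XN' mf' f'1; exact: normT.
  + by rewrite lee_fin; exact: B_psi.
- move=> eps K eps0 K1.
  have [r r0 Hr] := outsideT eps (L (level K)) eps0 (L1 _).
  exists r => // N f XN mf f1.
  apply: (le_trans (bound1 (level K) (phi (L (level K)) * eps)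
    (fun f x => if (euclidean_norm x < r)%R then 0%R else T f x)
    _ _ _ N f (mixed_level _ _ K1 XN) mf f1)).
  + by rewrite mulr_gt0// phi0.
  + by move=> f'; exact: measurable_complex_outside.
  + by move=> N' f' XN' mf' f'1; exact: Hr.
  + by rewrite lee_fin mulrA; apply: (ler_wpM2r (ltW eps0)); exact: B_psi.
- move=> eps K eps0 K1.
  have [delta delta0 Hd] := differenceT eps (L (level K)) eps0 (L1 _).
  exists delta => // h hd N f XN mf f1.
  apply: (le_trans (bound1 (level K) (phi (L (level K)) * eps)
    (fun f x => T f x - T f (x + h))%R
    _ _ _ N f (mixed_level _ _ K1 XN) mf f1)).
  + by rewrite mulr_gt0// phi0.
  + by move=> f'; exact: measurable_complex_difference.
  + by move=> N' f' XN' mf' f'1; exact: Hd.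
  + by rewrite lee_fin mulrA; apply: (ler_wpM2r (ltW eps0)); exact: B_psi.
Qed.
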